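(* Let $H\in(0,1)$ and $m(u)=\frac{|u|^{1-2H}}{2\pi}$. Let $\sigma,\mu$ be positive measures on $\mathbb R$ with $\int_{\mathbb R}\frac{d\sigma(u)}{u^2+1}<\infty$ and $\int_{\mathbb R}\frac{d\mu(u)}{u^2+1}<\infty$, such that the associated real Hilbert spaces $\mathcal H(\sigma)$ and $\mathcal H(\mu)$ are separable and infinite-dimensional, with orthonormal bases $(g_n)_{n\ge0}$ and $(h_n)_{n\ge0}$ respectively. Put $P_1=P_\sigma$, $P_2=P_\mu$, $Z_n=Q^\sigma_{g_n}$, $W_n=Q^\mu_{h_n}$, and for $t\in\mathbb R$ set $$B^{(1)}_t=\sum_{n=0}^\infty\left(\int_{\mathbb R}\frac{1-\cos tu}{u}\zeta_n(u)\sqrt{m(u)}\,du\right)Z_{2n},\qquad B^{(3)}_t=\sum_{n=0}^\infty\left(\int_{\mathbb R}\frac{\sin tu}{u}\zeta_n(u)\sqrt{m(u)}\,du\right)Z_{2n+1},$$ $$B^{(2)}_t=\sum_{n=0}^\infty\left(\int_{\mathbb R}\frac{1-\cos tu}{u}\zeta_n(u)\sqrt{m(u)}\,du\right)W_{2n},\qquad B^{(4)}_t=\sum_{n=0}^\infty\left(\int_{\mathbb R}\frac{\sin tu}{u}\zeta_n(u)\sqrt{m(u)}\,du\right)W_{2n+1},$$ where the series for $B^{(1)},B^{(3)}$ converge in $L^2(P_1)$ and those for $B^{(2)},B^{(4)}$ converge in $L^2(P_2)$. Then the $\mathbb H$-valued process $$B^H_p=\left(B^{(1)}_{\lambda_1}+B^{(3)}_{\lambda_1}\right)e_++\left(B^{(2)}_{\lambda_2}+B^{(4)}_{\lambda_2}\right)e_-,\qquad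 p=\lambda_1e_++\lambda_2e_-\in\mathbb H,$$ is centered Gaussian with covariance function $$E_{\mathbb H}(B^H_pB^H_q)=K_H(p,q)=\frac{V_H}{\pi}\left\{|p|_{\mathbb H}^{2H}+|q|_{\mathbb H}^{2H}-|p-q|_{\mathbb H}^{2H}\right\},\qquad p,q\in\mathbb H,$$ where $$V_H=\int_0^\infty\frac{1-\cos u}{u^2}u^{1-2H}\,du=\begin{cases}\dfrac{\Gamma(2-2H)\cos(H\pi)}{(1-2H)2H},& H\in(0,1)\setminus\{\frac12\},\\[2mm] \dfrac{\pi}{2},& H=\frac12.\end{cases}$$
   Context: Hyperbolic numbers: $\mathbb H=\{a+bk: a,b\in\mathbb R\}$ with $k\notin\mathbb R$ commuting with the reals and $k^2=1$ (the letter $H$ in roman math italic denotes the real Hurst parameter). Put $e_\pm=\frac{1\pm k}{2}$; then $e_\pm^2=e_\pm$, $e_+e_-=0$, $e_++e_-=1$, and each $p\in\mathbb H$ is uniquely $p=\lambda_1e_++\lambda_2e_-$ with $\lambda_1,\lambda_2\in\mathbb R$ (operations are componentwise). Set $|p|_{\mathbb H}^{2H}=|\lambda_1|^{2H}e_++|\lambda_2|^{2H}e_-$. White noise measures: $\mathcal S_{\mathbb R}$ is the space of real-valued Schwartz functions on $\mathbb R$, $\mathcal S'_{\mathbb R}$ its dual, $\mathcal C$ the cylinder $\sigma$-algebra of $\mathcal S'_{\mathbb R}$, and $\widehat s(u)=\int_{\mathbb R}e^{-iut}s(t)\,dt$. For a positive measure $\sigma$ with $\int\frac{d\sigma(u)}{u^2+1}<\infty$,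 $P_\sigma$ is the unique probability measure on $(\mathcal S'_{\mathbb R},\mathcal C)$ (given by the Bochner–Minlos theorem) with $e^{-\frac12\int|\widehat s(u)|^2d\sigma(u)}=\int_{\mathcal S'_{\mathbb R}}e^{i\langle w,s\rangle}dP_\sigma(w)$ for $s\in\mathcal S_{\mathbb R}$. $\mathcal H(\sigma)$ is the real Hilbert space completion of $\mathcal S_{\mathbb R}$ (modulo null vectors) for the inner product $\mathrm{Re}\int_{\mathbb R}\overline{\widehat{s_1}}\,\widehat{s_2}\,d\sigma$. The map $s\mapsto Q^\sigma_s$, $Q^\sigma_s(w)=\langle w,s\rangle$, is isometric into $L^2(\mathcal S'_{\mathbb R},\mathcal C,P_\sigma)$, and $Q^\sigma$ also denotes its extension to an isometry on $\mathcal H(\sigma)$. Normalized Hermite functions: $\zeta_n(x)=\frac{(-1)^n}{\pi^{1/4}2^{n/2}(n!)^{1/2}}e^{x^2/2}\left(\frac{d}{dx}\right)^ne^{-x^2}$, $n=0,1,2,\dots$ (an orthonormal basis of $L^2(\mathbb R,dx)$). Hyperbolic processes: for probability measures $P_1,P_2$ on a measurable space, $P_{\mathbb H}=P_1e_++P_2e_-$ and $L^2(P_{\mathbb H})=L^2(P_1)e_+\oplus L^2(P_2)e_-$. For $X=X_1e_++X_2e_-$, $E_{\mathbb H}(X)=E_{P_1}(X_1)e_++E_{P_2}(X_2)e_-$, so the covariance function of $X(p)=X_1(p)e_++X_2(p)e_-$ is $E_{\mathbb H}(X(p)X(q))=E_{P_1}(X_1(p)X_1(q))e_++E_{P_2}(X_2(p)X_2(q))e_-$.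 The process is (centered) Gaussian if $X_1$ is a (centered) Gaussian process with respect to $P_1$ and $X_2$ is a (centered) Gaussian process with respect to $P_2$. *)

(* Defs.v *)
From HB Require Import structures.
From mathcomp Require Import all_boot all_order all_algebra sesquilinear.
From mathcomp Require Import all_classical all_reals all_analysis.
From mathcomp Require Import complex.
From mathcomp Require Import ring.

Set Implicit Arguments.
Unset Strict Implicit.
Unset Printing Implicit Defensive.

Import Order.TTheory GRing.Theory Num.Theory.
Import numFieldNormedType.Exports.

Local Open Scope classical_set_scope.
Local Open Scope ring_scope.

(* [Hyp a b] is a + b k. *)
Record hyp (R : realType) := Hyp { hre : R ; him : R }.

Section Hyperbolic.
Variable R : realType.
Implicit Types p q : hyp R.

Definition hyp_pair p : R * R := (hre p, him p).
Definition pair_hyp (x : R * R) : hyp R := Hyp x.1 x.2.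
Lemma hyp_pairK : cancel hyp_pair pair_hyp. Proof. by case. Qed.

HB.instance Definition _ := Choice.copy (hyp R) (can_type hyp_pairK).

Definition hzero : hyp R := Hyp 0 0.
Definition hopp p := Hyp (- hre p) (- him p).
Definition hadd p q := Hyp (hre p + hre q) (him p + him q).
Definition hone : hyp R := Hyp 1 0.
Definition hmul p q :=
  Hyp (hre p * hre q + him p * him q) (hre p * him q + him p * hre q).
Definition hscale (a : R) p := Hyp (a * hre p) (a * him p).

Lemma haddA : associative hadd.
Proof. by case=> ? ? [? ?] [? ?]; congr Hyp; rewrite /= addrA. Qed.
Lemma haddC : commutative hadd.
Proof. by case=> ? ? [? ?]; congr Hyp; rewrite /= addrC. Qed.
Lemma hadd0 : left_id hzero hadd.
Proof. by case=> ? ?; congr Hyp; rewrite /= add0r. Qed.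
Lemma haddN : left_inverse hzero hopp hadd.
Proof. by case=> ? ?; congr Hyp; rewrite /= addNr. Qed.

HB.instance Definition _ :=
  GRing.isZmodule.Build (hyp R) haddA haddC hadd0 haddN.

Lemma hmulA : associative hmul.
Proof. by case=> ? ? [? ?] [? ?]; congr Hyp => /=; ring. Qed.
Lemma hmulC : commutative hmul.
Proof. by case=> ? ? [? ?]; congr Hyp => /=; ring. Qed.
Lemma hmul1 : left_id hone hmul.
Proof. by case=> ? ?; congr Hyp => /=; ring. Qed.
Lemma hmulDl : left_distributive hmul +%R.
Proof. by case=> ? ? [? ?] [? ?]; congr Hyp => /=; ring. Qed.
Lemma hone_neq0 : hone != 0.
Proof. by apply/eqP => -[/eqP]; rewrite oner_eq0. Qed.

HB.instance Definition _ :=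
  GRing.Zmodule_isComNzRing.Build (hyp R) hmulA hmulC hmul1 hmulDl hone_neq0.

Lemma hscaleA a b p : hscale a (hscale b p) = hscale (a * b) p.
Proof. by congr Hyp; rewrite /= mulrA. Qed.
Lemma hscale1 : left_id 1 hscale.
Proof. by case=> ? ?; congr Hyp; rewrite /= mul1r. Qed.
Lemma hscaleDr : right_distributive hscale +%R.
Proof. by move=> ? [? ?] [? ?]; congr Hyp; rewrite /= mulrDr. Qed.
Lemma hscaleDl p : {morph hscale^~ p : a b / a + b}.
Proof. by move=> ? ?; congr Hyp; rewrite /= mulrDl. Qed.

HB.instance Definition _ :=
  GRing.Zmodule_isLmodule.Build R (hyp R) hscaleA hscale1 hscaleDr hscaleDl.

Definition hk : hyp R := Hyp 0 1.
Definition hep : hyp R := 2^-1 *: (1 + hk).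
Definition hem : hyp R := 2^-1 *: (1 - hk).

(* the coordinates lambda_1, lambda_2 of p in the basis e_+, e_- *)
Definition hl1 p : R := hre p + him p.
Definition hl2 p : R := hre p - him p.

Lemma hk2 : hk * hk = 1.
Proof. by congr Hyp => /=; ring. Qed.

Lemma hep_idem : hep * hep = hep.
Proof. by congr Hyp => /=; field. Qed.

Lemma hem_idem : hem * hem = hem.
Proof. by congr Hyp => /=; field. Qed.

Lemma hepem : hep * hem = 0.
Proof. by congr Hyp => /=; field. Qed.

Lemma hep_add_hem : hep + hem = 1.
Proof. by congr Hyp => /=; field. Qed.

Lemma hyp_decomp p : p = hl1 p *: hep + hl2 p *: hem.
Proof. by case: p => a b; congr Hyp => /=; rewrite /hl1 /hl2 /=; field. Qed.

Lemma hl1E a b : hl1 (a *: hep + b *: hem) = a.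
Proof. by rewrite /hl1 /=; field. Qed.

Lemma hl2E a b : hl2 (a *: hep + b *: hem) = b.
Proof. by rewrite /hl2 /=; field. Qed.

(* |p|_H^a, used with a = 2H *)
Definition habspow (a : R) p : hyp R :=
  (`|hl1 p| `^ a) *: hep + (`|hl2 p| `^ a) *: hem.

End Hyperbolic.

Section Schwartz.
Variable R : realType.

Definition is_schwartz (f : R -> R) : Prop :=
  (forall n x, derivable (derive1n n f) x 1) /\
  (forall m n, exists C : R, forall x, `|x ^+ m * derive1n n f x| <= C).

Definition schwartz_pred : {pred R -> R} := fun f => `[< is_schwartz f >].

Record schwartz := Schwartz {
  schwartz_fun :> R -> R ; _ : schwartz_fun \in schwartz_pred }.

HB.instance Definition _ := [isSub for schwartz_fun].
HB.instance Definition _ := [Choice of schwartz by <:].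

Lemma derive1n_lin (a : R) (f g : R -> R) n :
  (forall m x, derivable (derive1n m f) x 1) ->
  (forall m x, derivable (derive1n m g) x 1) ->
  derive1n n (a *: f + g) = a *: derive1n n f + derive1n n g.
Proof.
move=> df dg; elim: n => [//|n IH].
rewrite derive1nS IH; apply/funext => x.
rewrite !derive1nS derive1E deriveD//; last exact: derivableZ.
by rewrite deriveZ// -!derive1E.
Qed.

Lemma schwartz_submod_closed : submod_closed schwartz_pred.
Proof.
split.
- have d0 n : derive1n n (0 : R -> R) = 0.
    elim: n => // n IH; rewrite derive1nS IH; apply/funext => x.
    by rewrite derive1_cst.
  apply/asboolP; split => [n x|m n].
    by rewrite d0; exact: derivable_cst.
  by exists 0 => x; rewrite d0 /= mulr0 normr0.
- move=> a f g /asboolP [df bf] /asboolP [dg bg].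
  apply/asboolP; split=> [n x|m n].
    by rewrite derive1n_lin//; apply: derivableD => //; exact: derivableZ.
  have [C hC] := bf m n; have [D hD] := bg m n.
  exists (`|a| * C + D) => x; rewrite derive1n_lin//.
  have -> : x ^+ m * (a *: derive1n n f + derive1n n g) x =
     a * (x ^+ m * derive1n n f x) + x ^+ m * derive1n n g x.
    rewrite /=; change (x ^+ m * (a * derive1n n f x + derive1n n g x) =
      a * (x ^+ m * derive1n n f x) + x ^+ m * derive1n n g x); ring.
  rewrite (le_trans (ler_normD _ _))// lerD// normrM.
  by rewrite ler_wpM2l.
Qed.

HB.instance Definition _ := GRing.isSubmodClosed.Build R (R -> R) schwartz_pred
  schwartz_submod_closed.
HB.instance Definition _ := [SubChoice_isSubLmodule of schwartz by <:].

(* The Frechet topology, defined by the seminorms sup_x |x^m f^(n)(x)|: it is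
   the initial topology of the maps f |-> x^m f^(n), for all m and n, into the
   space of functions with the topology of uniform convergence. *)
Definition schwartz_seminorms (f : schwartz) :
    prod_topology (fun _ : nat * nat => {uniform R -> R}) :=
  fun mn x => x ^+ mn.1 * derive1n mn.2 f x.

HB.instance Definition _ :=
  Topological.copy schwartz (initial_topology schwartz_seminorms).

Record tempered := Tempered {
  tempered_fun :> {linear schwartz -> R^o} ;
  tempered_continuous : continuous (tempered_fun : schwartz -> R^o) }.

HB.instance Definition _ := gen_eqMixin tempered.
HB.instance Definition _ := gen_choiceMixin tempered.

Lemma tempered0_continuous :
  continuous ((\0 : {linear schwartz -> R^o}) : schwartz -> R^o).
Proof. by move=> x; apply: cst_continuous. Qed.

HB.instance Definition _ :=
  isPointed.Build tempered (Tempered tempered0_continuous).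

(* Cylinders over a single Schwartz function are enough: the cylinders over
   finitely many Schwartz functions belong to the sigma-algebra they generate. *)
Definition cylinder_sets : set (set tempered) :=
  [set A | exists (s : schwartz) (B : set R),
     measurable B /\ A = [set w : tempered | B (w s)]].

End Schwartz.

Notation cylinderType R := (g_sigma_algebraType (@cylinder_sets R)).

Section WhiteNoise.
Variable R : realType.
Local Open Scope complex_scope.

Definition Cintegral d (T : measurableType d)
    (mu : {measure set T -> \bar R}) (f : T -> R[i]) : R[i] :=
  (\int[mu]_x complex.Re (f x)) +i* (\int[mu]_x complex.Im (f x)).

Definition expi (x : R) : R[i] := cos x +i* sin x.

Definition fourier (s : schwartz R) (u : R) : R[i] :=
  Cintegral (@lebesgue_measure R) (fun t => expi (- (u * t)) * (s t)%:C).

Definition admissible (sigma : {measure set R -> \bar R}) : Prop :=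
  (\int[sigma]_u ((u ^+ 2 + 1)^-1)%:E < +oo)%E.

Definition spectral_dot (sigma : {measure set R -> \bar R})
    (s1 s2 : schwartz R) : R :=
  complex.Re (Cintegral sigma (fun u => (fourier s1 u)^* * fourier s2 u)).

(* P is the measure P_sigma; the Bochner-Minlos theorem gives its existence and
   uniqueness. *)
Definition is_white_noise_measure (sigma : {measure set R -> \bar R})
    (P : probability (cylinderType R) R) : Prop :=
  forall s : schwartz R,
    (expR (- (2^-1 *
       \int[sigma]_u (ComplexField.Normc.normc (fourier s u) ^+ 2))))%:C
    = Cintegral P (fun w => expi ((w : tempered R) s)).

End WhiteNoise.

Section Hilbert.
Variable R : realType.

Record hilbert := Hilbert {
  hilbert_space :> completeNormedModType R ;
  hdot : {dot hilbert_space for idfun} ;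
  hdotE : forall x : hilbert_space, hdot x x = `|x| ^+ 2 }.

Definition separable (V : topologicalType) : Prop :=
  exists2 D : set V, countable D & dense D.

Definition linear_span (V : lmodType R) I (e : I -> V) : set V :=
  [set x | exists n (i : 'I_n -> I) (c : 'I_n -> R), x = \sum_j c j *: e (i j)].

Definition infinite_dim (V : lmodType R) : Prop :=
  forall n (e : 'I_n -> V), linear_span e <> setT.

Definition orthonormal_basis (V : hilbert) (e : nat -> V) : Prop :=
  (forall m n, hdot V (e m) (e n) = (m == n)%:R) /\ dense (linear_span e).

(* A Hilbert space completion of the Schwartz space for the (semi-)inner product
   attached to sigma. The null vectors are identified by [completion_map]. *)
Record completion (sigma : {measure set R -> \bar R}) := Completion {
  completion_space :> hilbert ;
  completion_map : {linear schwartz R -> completion_space} ;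
  completion_dot : forall s1 s2, hdot completion_space
    (completion_map s1) (completion_map s2) = spectral_dot sigma s1 s2 ;
  completion_dense : dense (range completion_map) }.

End Hilbert.

Section L2.
Variable R : realType.

Definition cvg_L2 d (T : measurableType d) (P : probability T R)
    (u : nat -> T -> R) (f : T -> R) : Prop :=
  [/\ forall n, u n \in Lfun P 2%:E, f \in Lfun P 2%:E
    & ('N[P]_2%:E[EFin \o (u n \- f)%R])%E @[n --> \oo] --> 0%E].

(* Q h is a representative of the image of h under the linear isometry
   H(sigma) -> L^2(P) that extends s |-> <., s>. *)
Definition is_isometric_extension (sigma : {measure set R -> \bar R})
    (P : probability (cylinderType R) R) (V : completion sigma)
    (Q : V -> cylinderType R -> R) : Prop :=
  [/\ forall h, Q h \in Lfun P 2%:E,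
      forall a h1 h2, {ae P, forall w, Q (a *: h1 + h2) w = a * Q h1 w + Q h2 w},
      forall h, 'N[P]_2%:E[EFin \o Q h]%E = `|h|%:E
    & forall s, {ae P, forall w, Q (completion_map V s) w = (w : tempered R) s}].

End L2.

Section Gaussian.
Variable R : realType.
Context d (T : measurableType d).

(* Point masses are allowed; they are treated apart because [normal_prob m 0] is
   not the point mass at m. *)
Definition gaussian (P : probability T R) (X : T -> R) : Prop :=
  measurable_fun setT X /\
  exists m s : R, forall A, measurable A ->
    P (X @^-1` A) = if s == 0 then \d_m A else normal_prob m s A.

Definition gaussian_process (P : probability T R) I (X : I -> T -> R) : Prop :=
  forall n (i : 'I_n -> I) (a : 'I_n -> R),
    gaussian P (fun w => \sum_j a j * X (i j) w).

Definition centered_gaussian_process (P : probability T R) I (X : I -> T -> R)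
    : Prop :=
  gaussian_process P X /\ forall i, ('E_P[X i] = 0)%E.

Definition hyp_centered_gaussian_process (P1 P2 : probability T R) I
    (X : I -> T -> hyp R) : Prop :=
  centered_gaussian_process P1 (fun i w => hl1 (X i w)) /\
  centered_gaussian_process P2 (fun i w => hl2 (X i w)).

Definition hyp_expectation (P1 P2 : probability T R) (X : T -> hyp R) : hyp R :=
  fine 'E_P1[fun w => hl1 (X w)]%E *: hep R +
  fine 'E_P2[fun w => hl2 (X w)]%E *: hem R.

End Gaussian.

Section Fractional.
Variable R : realType.
Local Notation mu := (@lebesgue_measure R).

Definition hermite_fun (n : nat) (x : R) : R :=
  (-1) ^+ n / (pi `^ 4^-1 * 2 `^ (n%:R / 2) * Num.sqrt n`!%:R)
  * expR (x ^+ 2 / 2) * derive1n n (fun y : R => expR (- y ^+ 2)) x.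

Definition fbm_density (H u : R) : R := `|u| `^ (1 - 2 * H) / (2 * pi).

Definition coef_cos (H t : R) (n : nat) : R :=
  \int[mu]_u ((1 - cos (t * u)) / u * hermite_fun n u * Num.sqrt (fbm_density H u)).

Definition coef_sin (H t : R) (n : nat) : R :=
  \int[mu]_u (sin (t * u) / u * hermite_fun n u * Num.sqrt (fbm_density H u)).

Definition partial_sums (T : Type) (c : nat -> R) (Z : nat -> T -> R)
    (N : nat) (w : T) : R :=
  \sum_(0 <= n < N) c n * Z n w.

Definition Gamma (s : R) : R :=
  \int[mu]_(x in `]0, +oo[) (x `^ (s - 1) * expR (- x)).

(* extended-real valued, so that an equation with a real number also says that
   the integral converges *)
Definition V_integral (H : R) : \bar R :=
  (\int[mu]_(u in `]0%R, +oo[) ((1 - cos u) / u ^+ 2 * u `^ (1 - 2 * H))%:E)%E.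

Definition V_const (H : R) : R := fine (V_integral H).

Definition K_kernel (H : R) (p q : hyp R) : hyp R :=
  (V_const H / pi) *:
    (habspow (2 * H) p + habspow (2 * H) q - habspow (2 * H) (p - q)).

Definition hyp_fbm (T : Type) (B1 B2 B3 B4 : R -> T -> R) (p : hyp R) (w : T)
    : hyp R :=
  (B1 (hl1 p) w + B3 (hl1 p) w) *: hep R + (B2 (hl2 p) w + B4 (hl2 p) w) *: hem R.

End Fractional.

(* Main.v *)
(* The coefficients of B^(1)_t and B^(3)_t are the Hermite coefficients of
   f_t(u) = (1 - cos tu)/u sqrt(m(u)) and g_t(u) = (sin tu)/u sqrt(m(u)), and
     (f_t - f_s)^2 + (g_t - g_s)^2 = 2 (1 - cos((t - s)u))/u^2 m(u).
   By Parseval, B^(1)_t + B^(3)_t is the image under Q^sigma of a vector k_t of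
   H(sigma) with |k_t - k_s|^2 = 2 (V_H/pi) |t - s|^2H; as k_0 = 0, polarization
   gives the covariance. Each Q^sigma_h is a centered Gaussian variable: its
   characteristic function is known on Schwartz functions and extends by density,
   and it determines the law.

   Uniqueness of Fourier transforms, which also gives the completeness of the
   Hermite functions, is obtained by smoothing with narrow Gaussian densities.
   The value of V_H is the limit for y -> +oo of the rescaled integral of
   u^(1-2H) e^-u (1 - cos(yu))/u^2, which integrations by parts reduce to
   Laplace transforms of u^(1-2H) cos(yu) and u^(1-2H) sin(yu). *)

Require Import Defs.
From HB Require Import structures.
From mathcomp Require Import all_boot all_order all_algebra sesquilinear.
From mathcomp Require Import all_classical all_reals all_analysis.
From mathcomp Require Import measurable_realfun complex.
From mathcomp Require Import zify ring lra.

Set Implicit Arguments.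
Unset Strict Implicit.
Unset Printing Implicit Defensive.

Import Order.TTheory GRing.Theory Num.Theory.
Import numFieldNormedType.Exports.

Local Open Scope classical_set_scope.
Local Open Scope ring_scope.

(** * Calculus and integration on the real line *)

(** Nonnegativity decides how [V_integral] is treated: the damped integrands increase to the
    undamped one, so monotone convergence gives an identity of extended reals, and convergence of
    the integral is read off from the limit of the closed forms. The closed form carries the factor
    [p (1 - p)] with [p = 1 - 2H], which vanishes at [H = 1/2]; there the damped integral is
    recovered from its second derivative in [y], which is [1 / (1 + y^2)].

    One uniqueness statement serves two purposes because it concerns a weight [phi] and a map [X]
    together: [phi = 1] compares the law of a random variable with a normal law, and [X] the
    identity shows that a function with zero Fourier transform vanishes almost everywhere.

    Elements of [L^2] are functions here, so the [B] processes are arbitrary versions of the limits,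
    and facts about them are transferred from [Q] of a vector through an almost sure equality.
    Cosine terms sit on even and sine terms on odd basis vectors, so both series are parts of one
    orthogonal series. *)

Section RealIntegrable.
Context d (T : measurableType d) (R : realType).
Variables (mu : {measure set T -> \bar R}) (D : set T).
Hypothesis mD : measurable D.
Implicit Types f g : T -> R.

Lemma RintegrableD f g : mu.-integrable D (EFin \o f) ->
  mu.-integrable D (EFin \o g) ->
  mu.-integrable D (EFin \o (fun x => f x + g x)).
Proof.
by move=> fi gi; apply: eq_integrable (integrableD mD fi gi).
Qed.

Lemma RintegrableZl (k : R) f : mu.-integrable D (EFin \o f) ->
  mu.-integrable D (EFin \o (fun x => k * f x)).
Proof.
by move=> fi; apply: eq_integrable (integrableZl mD k fi).
Qed.

Lemma RintegrableN f : mu.-integrable D (EFin \o f) ->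
  mu.-integrable D (EFin \o (fun x => - f x)).
Proof.
by move=> fi; apply: eq_integrable (integrableN fi).
Qed.

Lemma RintegrableB f g : mu.-integrable D (EFin \o f) ->
  mu.-integrable D (EFin \o g) ->
  mu.-integrable D (EFin \o (fun x => f x - g x)).
Proof.
by move=> fi gi; apply: eq_integrable (integrableB mD fi gi).
Qed.

Lemma Rintegrable_sum (I : Type) (s : seq I) (f : I -> T -> R) :
  (forall i, mu.-integrable D (EFin \o f i)) ->
  mu.-integrable D (EFin \o (fun x => \sum_(i <- s) f i x)).
Proof.
move=> fi; elim: s => [|i s IH].
  apply: (eq_integrable mD (cst 0%E)) => [x _ /=|]; first by rewrite big_nil.
  exact: integrable0.
apply: eq_integrable (RintegrableD (fi i) IH) => // x _ /=.
by rewrite big_cons.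
Qed.

Lemma Rintegral_sum (I : Type) (s : seq I) (f : I -> T -> R) :
  (forall i, mu.-integrable D (EFin \o f i)) ->
  \int[mu]_(x in D) (\sum_(i <- s) f i x) =
  \sum_(i <- s) \int[mu]_(x in D) f i x.
Proof.
move=> fi; elim: s => [|i s IH].
  rewrite big_nil; under eq_Rintegral do rewrite big_nil.
  by rewrite Rintegral_cst// mul0r.
rewrite big_cons -IH -RintegralD//; last exact: Rintegrable_sum.
by apply: eq_Rintegral => x _; rewrite big_cons.
Qed.

Lemma le_Rintegrable f g : measurable_fun D f ->
  (forall x, D x -> `|f x| <= g x) -> mu.-integrable D (EFin \o g) ->
  mu.-integrable D (EFin \o f).
Proof.
move=> mf fg gi; apply: le_integrable gi => //.
  exact/measurable_EFinP.
move=> x Dx; rewrite /= lee_fin (le_trans (fg x Dx))//.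
by rewrite real_ler_norm// ger0_real// (le_trans _ (fg x Dx)).
Qed.

Lemma Rdominated_cvg (f_ : nat -> T -> R) f g :
  (forall n, measurable_fun D (f_ n)) ->
  (forall x, D x -> f_ ^~ x @ \oo --> f x) ->
  (forall n x, D x -> `|f_ n x| <= g x) ->
  mu.-integrable D (EFin \o g) ->
  mu.-integrable D (EFin \o f) /\
  \int[mu]_(x in D) f_ n x @[n --> \oo] --> \int[mu]_(x in D) f x.
Proof.
move=> mf_ f_f fg gi.
have mf : measurable_fun D f by apply: measurable_fun_cvg mf_ f_f.
have [|||||fi _ cf] := @dominated_convergence _ _ _ mu D mD
  (fun n x => (f_ n x)%:E) (EFin \o f) (EFin \o g).
- by move=> n; exact/measurable_EFinP.
- exact/measurable_EFinP.
- by apply: aeW => x Dx; apply: cvg_EFin; [exact: nearW|exact: f_f].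
- exact: gi.
- by apply: aeW => x Dx n; rewrite lee_fin fg.
split=> //; apply: fine_cvg.
rewrite /Rintegral fineK//; exact: integrable_fin_num.
Qed.

End RealIntegrable.

Section ImproperFTC.
Context {R : realType}.
Notation mu := (@lebesgue_measure R).
Implicit Types F f : R -> R.

(** Dominated convergence, with bound [|f|], along the truncations of [f] to [[a_n, b_n]], each
    integrated by the ordinary fundamental theorem. Every point of [D] is eventually inside the
    interval, so the truncations are eventually constant at it. *)
Lemma improper_FTC F f (D : set R) (a_ b_ : nat -> R) (l : R) :
  measurable D ->
  (forall n, a_ n < b_ n) -> (forall n, `[a_ n, b_ n] `<=` D) ->
  (forall x, D x -> \forall n \near \oo, a_ n <= x <= b_ n) ->
  mu.-integrable D (EFin \o f) ->
  (forall x, D x -> {for x, continuous f}) ->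
  (forall x, D x -> is_derive x 1 F (f x)) ->
  F (b_ n) - F (a_ n) @[n --> \oo] --> l ->
  \int[mu]_(x in D) f x = l.
Proof.
move=> mD ab abD exh fi cf dF Fl.
have cF x : D x -> {for x, continuous F}.
  move=> Dx; apply: differentiable_continuous; apply/derivable1_diffP.
  by have [] := dF x Dx.
have mf : measurable_fun D f.
  by apply/measurable_EFinP; case/integrableP: fi.
have [||||_] := @Rdominated_cvg _ _ _ mu D mD (fun n => f \_ `[a_ n, b_ n]) f
  (fun x => `|f x|); last first.
have E n : \int[mu]_(x in D) (f \_ `[a_ n, b_ n]) x = F (b_ n) - F (a_ n).
  rewrite -Rintegral_mkcondr setIidr//.
  rewrite /Rintegral (@continuous_FTC2 _ f F)//.
  - apply: continuous_in_subspaceT => x /[!inE] /abD; exact: cf.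
  - split=> [x xab||].
    + by have [] := dF x (abD n x (subset_itv_oo_cc xab)).
    + apply: cvg_at_right_filter; apply: cF; apply: (abD n).
      by rewrite /= in_itv/= lexx ltW.
    + apply: cvg_at_left_filter; apply: cF; apply: (abD n).
      by rewrite /= in_itv/= lexx ltW.
  - move=> x xab; rewrite derive1E.
    by have [] := dF x (abD n x (subset_itv_oo_cc xab)).
under eq_cvg do rewrite E.
by move=> H; apply: (cvg_unique _ H).
- exact: integrable_norm fi.
- by move=> n x Dx; rewrite patchE; case: ifPn => // _; rewrite normr0.
- move=> x Dx; apply: cvg_near_cst; have [N _ HN] := exh x Dx.
  exists N => // n /HN xn; rewrite patchE ifT//.
  by rewrite inE/= in_itv.
- move=> n; apply/(measurable_restrict _ _ _).1 => //.
  by apply: measurable_funS mf => //; exact: subIsetl.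
Qed.

Lemma cvgr_idn_addn k : ((n + k)%:R : R) @[n --> \oo] --> +oo.
Proof. by rewrite (cvg_shiftn k (fun n => n%:R : R)); exact: cvgr_idn. Qed.

Lemma improper_FTC_T F f : mu.-integrable setT (EFin \o f) ->
  continuous f -> (forall x : R, is_derive x 1 F (f x)) ->
  F x @[x --> +oo] --> 0 -> F x @[x --> -oo] --> 0 ->
  \int[mu]_x f x = 0.
Proof.
move=> fi cf dF Fy FNy.
apply: (@improper_FTC F f setT
  (fun n => - (n + 1)%:R) (fun n => (n + 1)%:R)) => //.
- by move=> n; rewrite gtrN// ltr0n addn1.
- move=> x _; near=> n; rewrite -ler_norml.
  by near: n; move: (cvgr_idn_addn 1) => /cvgryPge; exact.
- by move=> x _; exact: cf.
- move/cvg_pinftyP : Fy => /(_ _ (cvgr_idn_addn 1)) Fy.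
  move/cvgNy_compNP/cvg_pinftyP : FNy => /(_ _ (cvgr_idn_addn 1)) FNy.
  by have := cvgB Fy FNy; rewrite subrr; exact.

Unshelve. all: by end_near. Qed.

Lemma improper_FTC_0y F f l0 l : mu.-integrable `]0, +oo[ (EFin \o f) ->
  (forall x : R, 0 < x -> {for x, continuous f}) ->
  (forall x : R, 0 < x -> is_derive x 1 F (f x)) ->
  F x @[x --> 0^'+] --> l0 -> F x @[x --> +oo] --> l ->
  \int[mu]_(x in `]0, +oo[) f x = l - l0.
Proof.
move=> fi cf dF F0 Fy.
have N0 n : 0 < (n + 2)%:R :> R by rewrite ltr0n addn2.
(* The shift by 2 makes the interval nondegenerate already for [n = 0]. *)
apply: (@improper_FTC F f _ (fun n => (n + 2)%:R^-1) (fun n => (n + 2)%:R)) => //.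
- move=> n; rewrite (@lt_trans _ _ 1)// ?invf_lt1//; by rewrite ltr1n addn2.
- move=> n x /=; rewrite !in_itv/= andbT => /andP[+ _]; apply: lt_le_trans.
  by rewrite invr_gt0.
- move=> x; rewrite /= in_itv/= andbT => x0; near=> n; apply/andP; split.
    rewrite invf_ple ?posrE//.
    by near: n; move: (cvgr_idn_addn 2) => /cvgryPge; exact.
  by near: n; move: (cvgr_idn_addn 2) => /cvgryPge; exact.
- by move=> x; rewrite /= in_itv/= andbT; exact: cf.
- by move=> x; rewrite /= in_itv/= andbT; exact: dF.
- apply: cvgB.
    by move/cvg_pinftyP : Fy; apply; exact: cvgr_idn_addn.
  move/cvg_at_rightP : F0; apply; split=> [n|]; first by rewrite invr_gt0.
  by apply/gtr0_cvgV0; [exact: nearW|exact: cvgr_idn_addn].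
Unshelve. all: by end_near. Qed.

End ImproperFTC.

(** * Derivatives of explicit expressions and of parametric integrals *)

Section PointwiseDerivatives.
Context {R : realType}.
Implicit Types (f g : R -> R) (x df dg c : R).

Lemma is_derive_fM f g x df dg : is_derive x 1 f df -> is_derive x 1 g dg ->
  is_derive x 1 (fun y => f y * g y) (df * g x + f x * dg).
Proof.
move=> hf hg; apply: (is_derive_eq (is_deriveM hf hg)).
by rewrite /GRing.scale/= addrC mulrC.
Qed.

Lemma is_derive_fD f g x df dg : is_derive x 1 f df -> is_derive x 1 g dg ->
  is_derive x 1 (fun y => f y + g y) (df + dg).
Proof. by move=> hf hg; exact: (is_deriveD hf hg). Qed.

Lemma is_derive_fB f g x df dg : is_derive x 1 f df -> is_derive x 1 g dg ->
  is_derive x 1 (fun y => f y - g y) (df - dg).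
Proof. by move=> hf hg; exact: (is_deriveB hf hg). Qed.

Lemma is_derive_fN f x df : is_derive x 1 f df ->
  is_derive x 1 (fun y => - f y) (- df).
Proof. by move=> hf; exact: (is_deriveN hf). Qed.

Lemma is_derive_fZ c f x df : is_derive x 1 f df ->
  is_derive x 1 (fun y => c * f y) (c * df).
Proof. by move=> hf; exact: (is_deriveZ c hf). Qed.

Lemma is_derive_fX n f x df : is_derive x 1 f df ->
  is_derive x 1 (fun y => f y ^+ n) (n%:R * f x ^+ n.-1 * df).
Proof.
move=> hf; have := is_deriveX n hf.
by rewrite (_ : f ^+ n = fun y => f y ^+ n)//; apply/funext => y; rewrite fctE.
Qed.

Lemma is_derive_fV f x df : f x != 0 -> is_derive x 1 f df ->
  is_derive x 1 (fun y => (f y)^-1) (- df / f x ^+ 2).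
Proof.
move=> fx0 hf; apply: (is_derive_eq (is_deriveV fx0 hf)).
by rewrite /GRing.scale/= mulNr mulrC mulNr.
Qed.

Lemma is_derive_fcomp f g x df dg : is_derive (g x) 1 f df ->
  is_derive x 1 g dg -> is_derive x 1 (fun y => f (g y)) (df * dg).
Proof. by move=> hf hg; exact: (is_derive1_comp hf hg). Qed.

Lemma is_derive_fscale c x : is_derive x 1 (fun y : R => c * y) c.
Proof.
by apply: (is_derive_eq (is_derive_fZ c (is_derive_id x 1))); rewrite mulr1.
Qed.

Lemma is_derive_cosZ c x :
  is_derive x 1 (fun y => cos (c * y)) (- sin (c * x) * c).
Proof. by apply: is_derive_fcomp; exact: is_derive_fscale. Qed.

Lemma is_derive_sinZ c x :
  is_derive x 1 (fun y => sin (c * y)) (cos (c * x) * c).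
Proof. by apply: is_derive_fcomp; exact: is_derive_fscale. Qed.

Lemma is_derive_1D x : is_derive x 1 (fun y => 1 + y) 1.
Proof.
apply: (is_derive_eq (is_derive_fD (is_derive_cst (1 : R) x 1) (is_derive_id x 1))).
exact: add0r.
Qed.

Lemma is_derive_continuous f x df : is_derive x 1 f df -> {for x, continuous f}.
Proof.
by move=> [dfx _]; apply: differentiable_continuous; exact/derivable1_diffP.
Qed.

Lemma continuous_cosZ c : continuous (fun x : R => cos (c * x)).
Proof. by move=> x; exact: is_derive_continuous (is_derive_cosZ c x). Qed.

Lemma continuous_sinZ c : continuous (fun x : R => sin (c * x)).
Proof. by move=> x; exact: is_derive_continuous (is_derive_sinZ c x). Qed.

Lemma measurable_cosZ c : measurable_fun [set: measurableTypeR R] (fun x : R => cos (c * x)).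
Proof. exact: (continuous_measurable_fun (@continuous_cosZ c)). Qed.

Lemma measurable_sinZ c : measurable_fun [set: measurableTypeR R] (fun x : R => sin (c * x)).
Proof. exact: (continuous_measurable_fun (@continuous_sinZ c)). Qed.

(** The derivative [df] is supplied in closed form, in place of the partial derivative operator, and
    is controlled only for parameters in a window around [a]. *)
Lemma is_derive_under_integral d (Y : measurableType d)
    (mu : {measure set Y -> \bar R}) (f df : R -> Y -> R) (B : set Y)
    (a u v : R) (G : Y -> R) :
  measurable B -> u < a < v ->
  (forall x, u < x < v -> mu.-integrable B (EFin \o f x)) ->
  (forall x y, u < x < v -> B y -> is_derive x 1 (f ^~ y) (df x y)) ->
  (forall y, 0 <= G y) -> mu.-integrable B (EFin \o G) ->
  (forall x y, u < x < v -> B y -> `|df x y| <= G y) ->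
  is_derive a 1 (fun x => \int[mu]_(y in B) f x y) (\int[mu]_(y in B) df a y).
Proof.
move=> mB auv fi fd G0 Gi dfG.
have fd1 x y : u < x < v -> B y -> partial1of2 f x y = df x y.
  by move=> xuv By; rewrite partial1of2E; have [] := fd x y xuv By.
have Iuv x : `]u, v[%classic x -> u < x < v by rewrite /= in_itv.
have Ia : `]u, v[%classic a by rewrite /= in_itv.
have H1 x : `]u, v[%classic x -> mu.-integrable B (EFin \o f x).
  by move/Iuv; exact: fi.
have H2 x y : `]u, v[%classic x -> B y -> derivable (f ^~ y) x 1.
  by move=> /Iuv xuv By; have [] := fd x y xuv By.
have H3 x y : `]u, v[%classic x -> B y -> `|partial1of2 f x y| <= G y.
  by move=> /Iuv xuv By; rewrite fd1//; exact: dfG.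
apply: DeriveDef.
  exact: (derivable_under_integral mB Ia H1 H2 G0 Gi H3).
rewrite -derive1E (differentiation_under_integral mB Ia H1 H2 G0 Gi H3).
by apply: eq_Rintegral => y /set_mem By; rewrite fd1.
Qed.

End PointwiseDerivatives.

Lemma cvg0_le_norm (R : realType) (T : Type) (F : set_system T) {FF : Filter F}
  (f g : T -> R) : (forall x, `|f x| <= g x) -> g x @[x --> F] --> 0 ->
  f x @[x --> F] --> 0.
Proof.
move=> fg g0; apply: (@squeeze_cvgr _ _ _ _ (fun x => - g x) g) => //.
  by apply: nearW => x; rewrite -ler_norml.
by rewrite -oppr0; exact: cvgN.
Qed.

(** * Reflection and scaling of Lebesgue measure *)

Section LebesgueSubstitution.
Context {R : realType}.
Notation mu := (@lebesgue_measure R).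

Lemma ge0_integralN (f : R -> \bar R) :
  measurable_fun [set: measurableTypeR R] f -> (forall x, (0 <= f x)%E) ->
  (\int[mu]_x f x = \int[mu]_x f (- x)%R)%E.
Proof.
move=> mf f0.
pose phi : measurableTypeR R -> measurableTypeR R := -%R.
have mphi : measurable_fun setT phi by exact: oppr_measurable.
rewrite -[RHS](ge0_integral_pushforward mphi mu measurableT mf)//.
by apply: eq_measure_integral => A mA _; exact/esym/lebesgue_measureN.
Qed.

Lemma Rintegral_odd (f : R -> R) : mu.-integrable setT (EFin \o f) ->
  (forall x, f (- x) = - f x) -> \int[mu]_x f x = 0.
Proof.
move=> fi fN.
have mf : measurable_fun [set: measurableTypeR R] (EFin \o f).
  by case/integrableP: fi.
have E : \int[mu]_x f x = - \int[mu]_x f x.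
  rewrite -[RHS]mulN1r -RintegralZl//.
  under [RHS]eq_Rintegral do rewrite mulN1r -fN.
  congr fine.
  pose phi : measurableTypeR R -> measurableTypeR R := -%R.
  have mphi : measurable_fun setT phi by exact: oppr_measurable.
  rewrite -[RHS](integral_pushforward mphi mf (D := setT))//.
    by apply: eq_measure_integral => A mA _; exact/esym/lebesgue_measureN.
  apply: eq_integrable (RintegrableN measurableT fi) => // x _.
  by rewrite /= fN.
by move/eqP: E; rewrite -addr_eq0 -mulr2n mulrn_eq0/= => /eqP.
Qed.

(** Lebesgue measure is determined by its values on half-open intervals, and [t] times the image
    measure has the right ones. *)
Lemma lebesgue_measureZ (t : R) (A : set R) : 0 < t -> measurable A ->
  pushforward mu (fun x => t * x : measurableTypeR R) A = (t^-1%:E * mu A)%E.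
Proof.
move=> t0 mA.
have t1 : 0 <= t by exact: ltW.
pose phi : measurableTypeR R -> measurableTypeR R := fun x => t * x.
have mphi : measurable_fun setT phi by exact: mulrl_measurable.
suff : mu A = (t%:E * pushforward mu phi A)%E.
  by move=> ->; rewrite muleA -EFinM mulVf ?gt_eqF// mul1e.
pose m' : {measure set (measurableTypeR R) -> \bar R} :=
  mscale (NngNum t1) (pushforward mu phi).
pose m := m' mphi.
suff : forall X, ocitv X -> mu X = m X.
  by move=> /(@lebesgue_measure_unique R m)/(_ A mA).
move=> _ [[a b]] _ <-.
change (mu `]a, b] = (t%:E * mu (phi @^-1` `]a, b]))%E).
have -> : phi @^-1` `]a, b] = `]t^-1 * a, t^-1 * b]%classic.
  by apply/seteqP; split=> x /=; rewrite !in_itv/= -ler_pdivlMl// -ltr_pdivrMl.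
rewrite !lebesgue_measure_itv/= !lte_fin ltr_pM2l ?invr_gt0//.
case: ifPn => _; last by rewrite mule0.
by rewrite -!EFinB -EFinM -mulrBr mulVKf// gt_eqF.
Qed.

Lemma ge0_integralZ (t : R) (f : R -> \bar R) (D : set R) : 0 < t ->
  measurable D -> measurable_fun D f -> (forall x, D x -> (0 <= f x)%E) ->
  (\int[mu]_(x in (fun x : R => t * x)%R @^-1` D) f (t * x)%R =
   t^-1%:E * \int[mu]_(x in D) f x)%E.
Proof.
move=> t0 mD mf f0; have t1 : 0 <= t^-1 by rewrite invr_ge0 ltW.
pose phi : measurableTypeR R -> measurableTypeR R := fun x => t * x.
have mphi : measurable_fun setT phi by exact: mulrl_measurable.
rewrite -(ge0_integral_pushforward mphi mu mD mf)//; last by move=> x /set_mem; exact: f0.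
rewrite -(ge0_integral_mscale mu mD (NngNum t1) mf f0).
apply: eq_measure_integral => A mA _; exact: lebesgue_measureZ.
Qed.

End LebesgueSubstitution.

(** * Uniqueness of Fourier transforms *)

Section GaussianIntegrals.
Context {R : realType}.
Notation mu := (@lebesgue_measure R).
Implicit Types (a c s t x : R).

(** The rate stays free because three values occur: 1 for the Hermite weight, [2^-1] for the factor
    of the Hermite functions, and [(2 s^2)^-1] for the normal density of deviation [s]. *)
Definition gaussc c x := expR (- (c * x ^+ 2)).

Lemma gaussc_gt0 c x : 0 < gaussc c x. Proof. exact: expR_gt0. Qed.

Lemma is_derive_gaussc c x :
  is_derive x 1 (gaussc c) (- (2 * c * x * gaussc c x)).
Proof.
apply: (@is_derive_eq _ _ _ _ _ _ _ (gaussc c x * - (c * (2%:R * x ^+ 1 * 1)))).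
  apply: is_derive_fcomp; apply: is_derive_fN; apply: is_derive_fZ.
  exact: is_derive_fX.
by rewrite expr1; ring.
Qed.

Lemma continuous_gaussc c : continuous (gaussc c).
Proof. by move=> x; exact: is_derive_continuous (is_derive_gaussc c x). Qed.

Lemma measurable_gaussc c : measurable_fun [set: measurableTypeR R] (gaussc c).
Proof. exact: (continuous_measurable_fun (@continuous_gaussc c)). Qed.

Lemma cvg_gaussc c : 0 < c -> gaussc c x @[x --> +oo] --> 0.
Proof.
move=> c0; apply: (@cvg_comp _ _ _ (fun x => c * x ^+ 2) (fun x => expR (- x)) _
  (pinfty_nbhs R)).
  exact: (gt0_cvgMry c0 cvgr_expr2).
exact: cvgr_expR.
Qed.

Lemma cvgNy_gaussc c : 0 < c -> gaussc c x @[x --> -oo] --> 0.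
Proof.
move=> c0; apply/cvgNy_compNP; apply: cvg_trans (cvg_gaussc c0).
by apply: near_eq_cvg; apply: nearW => x; rewrite /= /gaussc sqrrN.
Qed.

Lemma integrable_gaussc c : 0 < c -> mu.-integrable setT (EFin \o gaussc c).
Proof.
(* The deviation for which the normal density is a multiple of [gaussc c]. *)
move=> c0; pose s := Num.sqrt (2 * c)^-1.
have s2 : s ^+ 2 = (2 * c)^-1 by rewrite sqr_sqrtr// invr_ge0 mulr_ge0 ?ltW.
have s0 : s != 0 by rewrite gt_eqF// sqrtr_gt0 invr_gt0 mulr_gt0.
have := RintegrableZl measurableT (normal_peak s)^-1 (integrable_normal_pdf 0 s).
apply: eq_integrable => // x _ /=; congr EFin.
rewrite normal_pdfE// mulKf ?gt_eqF ?normal_peak_gt0//.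
rewrite /normal_fun /gaussc subr0 s2; congr expR.
by field; rewrite gt_eqF.
Qed.

(** Half of the rate absorbs the exponential: the exponent of the majorant exceeds the original one
    by [(2c)^-1 (a - c|x|)^2]. *)
Lemma integrable_exp_gaussc a c : 0 < c ->
  mu.-integrable setT (EFin \o (fun x => expR (a * `|x|) * gaussc c x)).
Proof.
move=> c0.
apply: (@le_Rintegrable _ _ _ mu setT measurableT _
    (fun x => expR (a ^+ 2 / (2 * c)) * gaussc (c / 2) x)).
- apply: measurable_funM; last first.
    exact: measurable_gaussc.
  by apply: measurableT_comp => //; apply: measurable_funM.
- move=> x _; rewrite ger0_norm ?mulr_ge0 ?expR_ge0// /gaussc.
  rewrite -!expRD ler_expR.
  have -> : x ^+ 2 = `|x| ^+ 2 by rewrite real_normK ?num_real.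
  rewrite -subr_ge0.
  suff -> : a ^+ 2 / (2 * c) - c / 2 * `|x| ^+ 2 - (a * `|x| - c * `|x| ^+ 2) =
    (2 * c)^-1 * (a - c * `|x|) ^+ 2.
    by rewrite mulr_ge0// ?sqr_ge0// invr_ge0 mulr_ge0// ltW.
  by field; rewrite gt_eqF.
- by apply: RintegrableZl => //; apply: integrable_gaussc; rewrite divr_gt0.
Qed.

Lemma ler_norm_expR n x : `|x| ^+ n <= n`!%:R * expR `|x|.
Proof.
case: n => [|n]; first by rewrite expr0 fact0 mul1r -expR0 ler_expR.
rewrite mulrC -ler_pdivrMr ?ltr0n ?fact_gt0//.
by rewrite (le_trans _ (expR_ge1Dxn n (normr_ge0 x)))// lerDr.
Qed.

Lemma integrable_monomial_gaussc n c : 0 < c ->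
  mu.-integrable setT (EFin \o (fun x => x ^+ n * gaussc c x)).
Proof.
move=> c0.
apply: (@le_Rintegrable _ _ _ mu setT measurableT _
    (fun x => n`!%:R * (expR (1 * `|x|) * gaussc c x))).
- apply: measurable_funM; first exact: exprn_measurable.
  exact: measurable_gaussc.
- move=> x _; rewrite normrM normrX (gtr0_norm (gaussc_gt0 _ _)) mul1r mulrA.
  by rewrite ler_pM2r ?gaussc_gt0// ler_norm_expR.
- by apply: RintegrableZl => //; exact: integrable_exp_gaussc.
Qed.

(** As a function of [t] the left side [F] satisfies [F' = - t / (2c) F]: differentiation under the
    integral produces [- x sin(tx)], and an integration by parts turns this back into [F]. Hence
    [F(t) exp(t^2 / (4c))] is constant. *)
Lemma Rintegral_cos_gaussc c t : 0 < c ->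
  \int[mu]_x (cos (t * x) * gaussc c x) =
  expR (- (t ^+ 2 / (4 * c))) * \int[mu]_x gaussc c x.
Proof.
move=> c0; pose F t := \int[mu]_x (cos (t * x) * gaussc c x).
have ig := integrable_gaussc c0.
have ix := integrable_monomial_gaussc 1 c0.
have mg := measurable_gaussc c.
have mcos := @measurable_cosZ R; have msin := @measurable_sinZ R.
have icos u : mu.-integrable setT (EFin \o (fun x => cos (u * x) * gaussc c x)).
  apply: (le_Rintegrable measurableT _ _ ig); first exact: measurable_funM.
  move=> x _; rewrite normrM (gtr0_norm (gaussc_gt0 _ _)).
  by rewrite ler_piMl ?(ltW (gaussc_gt0 _ _))// ler_norml cos_geN1 cos_le1.
have ixsin u : mu.-integrable setT
    (EFin \o (fun x => x * sin (u * x) * gaussc c x)).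
  apply: (le_Rintegrable measurableT _ _ (integrable_norm ix)).
    by apply: measurable_funM => //; apply: measurable_funM.
  move=> x _; rewrite /= expr1 mulrAC normrM ler_piMr//.
  by rewrite ler_norml sin_geN1 sin_le1.
have dF (u : R) : is_derive u 1 F (- (u / (2 * c)) * F u).
  have := @is_derive_under_integral R _ _ mu (fun t x => cos (t * x) * gaussc c x)
    (fun t x => - (x * sin (t * x) * gaussc c x)) setT u (u - 1) (u + 1)
    (fun x => `|x * gaussc c x|) measurableT.
  rewrite gtrBl ltrDl ltr01 => /(_ isT).
  move=> /(_ (fun v _ => icos v)) H.
  apply: (is_derive_eq (H _ _ _ _)) => //.
  - move=> v x _ _.
    apply: (@is_derive_eq _ _ _ _ _ _ _
      (- sin (v * x) * x * gaussc c x + cos (v * x) * 0)).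
      apply: is_derive_fM; apply: is_derive_fcomp.
      have -> : ( *%R^~ x) = (fun y : R => x * y) by apply/funext => y; rewrite mulrC.
      exact: is_derive_fscale.
    by rewrite mulr0 addr0; ring.
  - by apply: eq_integrable (integrable_norm ix).
  - move=> v x _ _; rewrite normrN mulrAC normrM ler_piMr//.
    by rewrite ler_norml sin_geN1 sin_le1.
  - have Fy (G : set_system R) (FG : Filter G) : gaussc c x @[x --> G] --> 0 ->
        sin (u * x) * gaussc c x @[x --> G] --> 0.
      apply: cvg0_le_norm => x; rewrite normrM (gtr0_norm (gaussc_gt0 _ _)).
      by rewrite ler_piMl ?(ltW (gaussc_gt0 _ _))// ler_norml sin_geN1 sin_le1.
    (* The integrand is the derivative of [sin(ux) gaussc c x], which vanishes at both
       infinities. *)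
    have : u * F u - 2 * c * \int[mu]_x (x * sin (u * x) * gaussc c x) = 0.
      rewrite -!RintegralZl// -RintegralB//; [|exact: RintegrableZl..].
      apply: (@improper_FTC_T R (fun x => sin (u * x) * gaussc c x)).
      - by apply: RintegrableB => //; exact: RintegrableZl.
      - move=> x; apply: cvgB; apply: cvgM; try exact: cvg_cst.
          apply: cvgM; last exact: continuous_gaussc.
          exact: continuous_cosZ.
        apply: cvgM; last exact: continuous_gaussc.
        apply: cvgM; first exact: cvg_id.
        exact: continuous_sinZ.
      - move=> x; apply: (@is_derive_eq _ _ _ _ _ _ _ (cos (u * x) * u * gaussc c x +
          sin (u * x) * - (2 * c * x * gaussc c x))).
          by apply: is_derive_fM; [exact: is_derive_sinZ|exact: is_derive_gaussc].
        ring.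
      - by apply: Fy; exact: cvg_gaussc.
      - by apply: Fy; exact: cvgNy_gaussc.
    rewrite -[X in X = _]/(u * F u - _).
    under [X in _ -> X = _]eq_Rintegral do rewrite -mulN1r.
    rewrite RintegralZl// => /subr0_eq E.
    apply: (@mulfI _ (2 * c)); first by rewrite gt_eqF// mulr_gt0.
    rewrite mulrCA -E; field.
    by rewrite gt_eqF.
pose K t := F t * expR (t ^+ 2 / (4 * c)).
have -> : \int[mu]_x gaussc c x = K 0.
  rewrite /K /F expr0n mul0r expR0 mulr1.
  by apply: eq_Rintegral => x _; rewrite mul0r cos0 mul1r.
suff -> : K 0 = K t by rewrite /K mulrCA -expRD addNr expR0 mulr1.
apply: is_derive_0_is_cst => u.
apply: (@is_derive_eq _ _ _ _ _ _ _ (- (u / (2 * c)) * F u * expR (u ^+ 2 / (4 * c))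
  + F u * (expR (u ^+ 2 / (4 * c)) * ((4 * c)^-1 * (2%:R * u ^+ 1 * 1))))).
  apply: is_derive_fM => //; apply: is_derive_fcomp.
  under eq_fun do rewrite mulrC.
  by apply: is_derive_fZ; exact: is_derive_fX.
by field; rewrite gt_eqF.
Qed.

Lemma normal_pdf_gaussc m s x : s != 0 ->
  normal_pdf m s x = normal_peak s * gaussc (2 * s ^+ 2)^-1 (x - m).
Proof.
move=> s0; rewrite normal_pdfE//; congr (_ * expR _).
by rewrite mulNr mulrC -(mulr_natl (s ^+ 2)).
Qed.

Lemma Rintegral_normal_pdf m s : \int[mu]_x normal_pdf m s x = 1.
Proof. by rewrite /Rintegral integral_normal_pdf. Qed.

Lemma Rintegral_cos_normal s t : s != 0 ->
  \int[mu]_x (normal_pdf 0 s x * cos (t * x)) = expR (- (t ^+ 2 * s ^+ 2 / 2)).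
Proof.
move=> s0; have c0 : 0 < (2 * s ^+ 2)^-1.
  by rewrite invr_gt0 mulr_gt0// exprn_even_gt0.
have E x : normal_pdf 0 s x = normal_peak s * gaussc (2 * s ^+ 2)^-1 x.
  by rewrite normal_pdf_gaussc// subr0.
under eq_Rintegral do rewrite E -mulrA [X in _ * X]mulrC.
rewrite RintegralZl//; last first.
  apply: (le_Rintegrable measurableT _ _ (integrable_gaussc c0)).
    by apply: measurable_funM; [exact: measurable_cosZ|exact: measurable_gaussc].
  move=> x _; rewrite normrM (gtr0_norm (gaussc_gt0 _ _)).
  by rewrite ler_piMl ?(ltW (gaussc_gt0 _ _))// ler_norml cos_geN1 cos_le1.
rewrite Rintegral_cos_gaussc// mulrCA -RintegralZl//; last exact: integrable_gaussc.
under [X in _ * X]eq_Rintegral do rewrite -E.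
rewrite Rintegral_normal_pdf mulr1; congr expR.
by field.
Qed.

Lemma Rintegral_sin_normal s t : s != 0 ->
  \int[mu]_x (normal_pdf 0 s x * sin (t * x)) = 0.
Proof.
move=> s0; apply: Rintegral_odd => [|x].
  apply: (le_Rintegrable measurableT _ _ (integrable_normal_pdf 0 s)).
    by apply: measurable_funM; [exact: measurable_normal_pdf|exact: measurable_sinZ].
  move=> x _; rewrite normrM (ger0_norm (normal_pdf_ge0 _ _ _)).
  by rewrite ler_piMr ?normal_pdf_ge0// ler_norml sin_geN1 sin_le1.
by rewrite !normal_pdf_gaussc// mulrN sinN mulrN !subr0 /gaussc sqrrN.
Qed.

End GaussianIntegrals.

(** The bound by [g] and Tonelli's theorem give joint integrability; integrability of every slice,
    and not just of almost every one, makes the inner real integrals agree with the extended ones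
    everywhere. *)
Lemma RFubini d1 d2 (T1 : measurableType d1) (T2 : measurableType d2)
    (R : realType) (m1 : {sigma_finite_measure set T1 -> \bar R})
    (m2 : {sigma_finite_measure set T2 -> \bar R}) (f : T1 * T2 -> R)
    (g : T1 -> R) :
  measurable_fun setT f ->
  (forall x, m2.-integrable setT (EFin \o (fun y => f (x, y)))) ->
  (forall y, m1.-integrable setT (EFin \o (fun x => f (x, y)))) ->
  (forall x, \int[m2]_y `|f (x, y)| <= g x) ->
  m1.-integrable setT (EFin \o g) ->
  \int[m1]_x \int[m2]_y f (x, y) = \int[m2]_y \int[m1]_x f (x, y).
Proof.
move=> mf fi1 fi2 fg gi.
have mf' : measurable_fun setT (EFin \o f) by exact/measurable_EFinP.
have fi : (m1 \x m2)%E.-integrable setT (EFin \o f).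
  apply/integrable12ltyP => //.
  apply: (@le_lt_trans _ _ (\int[m1]_x (g x)%:E)%E); last first.
    by rewrite ltey_eq integrable_fin_num.
  apply: ge0_le_integral => //.
  - by move=> x _; exact: integral_ge0.
  - apply: (@measurable_fun_fubini_tonelli_F _ _ _ _ _ m2 (abse \o (EFin \o f))) => //.
    exact: (measurableT_comp _ mf').
    by move=> z; exact: abse_ge0.
  - by case/integrableP: gi.
  - move=> x _; rewrite -[leLHS]fineK ?lee_fin; first exact: fg.
    apply: integrable_fin_num => //.
    exact: integrable_norm (fi1 x).
rewrite /Rintegral; congr fine.
transitivity (\int[m1]_x \int[m2]_y (f (x, y))%:E)%E.
  by apply: eq_integral => x _; rewrite fineK// (integrable_fin_num _ (fi1 x)).
transitivity (\int[m2]_y \int[m1]_x (f (x, y))%:E)%E; last first.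
  by apply: eq_integral => y _; rewrite fineK// (integrable_fin_num _ (fi2 y)).
exact: (Fubini fi).
Qed.

(** * Concentration of narrow normal laws *)

Section NormalTail.
Context {R : realType}.
Notation mu := (@lebesgue_measure R).

(** Half of the exponent is given up: on [D] the density is at most [sqrt 2 exp(-delta^2 / (4 s^2))]
    times the normal density of deviation [sqrt 2 s], whose total mass is 1. The factor [sqrt 2] is
    the ratio of the two peaks. *)
Lemma normal_prob_tail (x s delta : R) (D : set R) : 0 < s -> 0 <= delta ->
  measurable D -> (forall y, D y -> delta <= `|y - x|) ->
  (normal_prob x s D <= (Num.sqrt 2 * expR (- (delta ^+ 2 / (4 * s ^+ 2))))%:E)%E.
Proof.
move=> s0 d0 mD Dd; set e := expR _.
pose s' := Num.sqrt 2 * s.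
have s'0 : 0 < s' by rewrite mulr_gt0// sqrtr_gt0.
have s'2 : s' ^+ 2 = 2 * s ^+ 2 by rewrite exprMn sqr_sqrtr.
have peak2 : normal_peak s = Num.sqrt 2 * normal_peak s'.
  rewrite /normal_peak s'2; set Q := s ^+ 2 * pi *+ 2.
  have -> : 2 * s ^+ 2 * pi *+ 2 = 2 * Q by rewrite /Q; ring.
  have -> : Num.sqrt (2 * Q) = Num.sqrt 2 * Num.sqrt Q by exact: sqrtrM.
  rewrite invfM mulrA mulfV ?mul1r//.
rewrite /normal_prob.
apply: (@le_trans _ _ (\int[mu]_(y in D) (Num.sqrt 2 * e * normal_pdf x s' y)%:E)%E).
  apply: ge0_le_integral => //.
  - by move=> y _; rewrite lee_fin normal_pdf_ge0.
  - apply/measurable_EFinP; apply: measurable_funTS.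
    exact: measurable_normal_pdf.
  - apply/measurable_EFinP; apply: measurable_funTS.
    by apply: measurable_funM => //; exact: measurable_normal_pdf.
  - move=> y Dy; rewrite lee_fin !normal_pdf_gaussc ?gt_eqF// peak2.
    rewrite -!mulrA ler_wpM2l ?sqrtr_ge0// [leRHS]mulrCA.
    rewrite ler_wpM2l ?normal_peak_ge0//.
    rewrite /e /gaussc s'2 -expRD ler_expR.
    have : delta ^+ 2 <= (y - x) ^+ 2.
      by rewrite -(real_normK (num_real (y - x))) ler_pXn2r ?nnegrE// Dd.
    move=> H.
    have -> : - (delta ^+ 2 / (4 * s ^+ 2)) - (2 * (2 * s ^+ 2))^-1 * (y - x) ^+ 2
     = - ((2 * s ^+ 2)^-1 * (y - x) ^+ 2) +
       (4 * s ^+ 2)^-1 * ((y - x) ^+ 2 - delta ^+ 2).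
      by field; rewrite gt_eqF.
    rewrite lerDl mulr_ge0// ?subr_ge0// invr_ge0.
    by rewrite mulr_ge0// sqr_ge0.
under eq_integral do rewrite EFinM.
rewrite ge0_integralZl//; first last.
- by rewrite lee_fin mulr_ge0// expR_ge0.
- by move=> y _; rewrite lee_fin normal_pdf_ge0.
- apply/measurable_EFinP; apply: measurable_funTS.
  exact: measurable_normal_pdf.
rewrite -[leRHS]mule1 lee_pmul2l// ?lte_fin ?mulr_gt0 ?expR_gt0 ?sqrtr_gt0//.
exact: (probability_le1 (normal_prob x s')).
Qed.

Definition inv_succn (n : nat) : R := n.+1%:R^-1.

(** The threshold moves by [1/(n+1)] while the deviation is only [1/(n+1)^2], so the mass near [x]
    ends up on one side even when [x = b]. Without the shift the limit at [x = b] would be [1/2]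
    instead of 1. *)
Lemma cvg_normal_prob_itv (x b : R) :
  fine (normal_prob x (inv_succn n ^+ 2) `]-oo, b + inv_succn n]) @[n --> \oo]
    --> (\1_`]-oo, b] x : R).
Proof.
have d0 n : 0 < inv_succn n by rewrite invr_gt0.
have cd : inv_succn n @[n --> \oo] --> (0 : R) by exact: cvg_harmonic.
have tail n (D : set R) : measurable D -> (forall y, D y -> inv_succn n <= `|y - x|) ->
    (normal_prob x (inv_succn n ^+ 2) D <= (8 * inv_succn n)%:E)%E.
  move=> mD Dd.
  apply: (le_trans (normal_prob_tail (s := inv_succn n ^+ 2) _ (ltW (d0 n)) mD Dd)).
    by rewrite exprn_gt0.
  (* With [d = inv_succn n] the tail bound is [sqrt 2 exp(-1 / (4 d^2))]; here [sqrt 2 <= 2], and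
     [exp(-v) <= 1 / v] bounds the other factor by [4 d^2 <= 4 d]. *)
  have -> : 8 * inv_succn n = 2 * (4 * inv_succn n) by ring.
  rewrite lee_fin ler_pM ?expR_ge0//.
    by rewrite -[leRHS]ger0_norm// -sqrtr_sqr ler_sqrt// ?exprn_gt0// -natrX ler_nat.
  set u := _ / _; have u0 : u = (4 * inv_succn n ^+ 2)^-1.
    by rewrite /u; field; rewrite gt_eqF.
  rewrite expRN u0 -[leRHS]invrK lef_pV2 ?posrE ?expR_gt0 ?invr_gt0 ?mulr_gt0//.
  apply: (@le_trans _ _ (4 * inv_succn n ^+ 2)^-1).
    rewrite lef_pV2 ?posrE ?mulr_gt0 ?exprn_gt0// ler_pM2l// expr2 ler_piMl//.
      exact: ltW.
    by rewrite invf_le1// ler1n.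
  by rewrite (le_trans _ (expR_ge1Dx _))// lerDr.
have fin_p n D : measurable D -> normal_prob x (inv_succn n ^+ 2) D \is a fin_num.
  by move=> mD; exact: fin_num_measure.
rewrite indicE; have [xb|bx] := leP x b.
  rewrite mem_set/= ?in_itv//=.
  apply: (@squeeze_cvgr _ _ _ _ (fun n => 1 - 8 * inv_succn n) (cst 1)) => //.
  - apply: nearW => n; apply/andP; split; last first.
      rewrite -lee_fin fineK ?fin_p//.
      exact: (probability_le1 (normal_prob x (inv_succn n ^+ 2))).
    rewrite lerBlDr -lerBlDl -lee_fin EFinB fineK ?fin_p//.
    rewrite -(probability_setC (normal_prob x (inv_succn n ^+ 2)))//.
    apply: tail; first exact: measurableC.
    move=> y /=; rewrite in_itv/= => /negP; rewrite -ltNge => yb.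
    rewrite ger0_norm; last by move: (d0 n); lra.
    by lra.
  - rewrite -[X in _ --> X](subr0 1); apply: cvgB; first exact: cvg_cst.
    by rewrite -[X in _ --> X](mulr0 8); apply: cvgM => //; exact: cvg_cst.
  - exact: cvg_cst.
rewrite memNset/= ?in_itv/= ?leNgt ?bx//.
(* Eventually the shifted threshold stays farther than [inv_succn n] below [x]. *)
have near_d : \forall n \near \oo, inv_succn n < (x - b) / 2.
  by apply: (cvgr_lt _ cd); lra.
apply: (@squeeze_cvgr _ _ _ _ (cst 0) (fun n => 8 * inv_succn n)) => //.
- near=> n; rewrite fine_ge0//= -lee_fin fineK ?fin_p//; apply: tail => //.
  move=> y /=; rewrite in_itv/= => yb.
  have dn : inv_succn n < (x - b) / 2 by near: n.
  by rewrite distrC ger0_norm; move: (d0 n); lra.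
- exact: cvg_cst.
- by rewrite -[X in _ --> X](mulr0 8); apply: cvgM => //; exact: cvg_cst.
Unshelve. all: by end_near. Qed.

End NormalTail.

(** * Smoothed distribution functions and their limits *)

Section FourierUniqueness.
Context {R : realType}.
Notation mu := (@lebesgue_measure R).

Section Smoothing.
Context d (T : measurableType d) (m : {sigma_finite_measure set T -> \bar R}).
Variables (X phi : T -> R).
Hypotheses (mX : measurable_fun setT X)
  (iphi : m.-integrable setT (EFin \o phi)).

(** Together with [fourier_sin], the real and imaginary parts of the Fourier transform of the image
    under [X] of the signed measure [phi dm]. *)
Definition fourier_cos t := \int[m]_w (phi w * cos (t * X w)).
Definition fourier_sin t := \int[m]_w (phi w * sin (t * X w)).

Let mphi : measurable_fun setT phi.
Proof. by apply/measurable_EFinP; case/integrableP: iphi. Qed.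

Let le1_integrable (h : T -> R) : measurable_fun setT h ->
  (forall w, `|h w| <= 1) -> m.-integrable setT (EFin \o (fun w => phi w * h w)).
Proof.
move=> mh h1; apply: (le_Rintegrable measurableT _ _ (integrable_norm iphi)).
  exact: measurable_funM.
by move=> w _; rewrite normrM ler_piMr.
Qed.

Lemma fourier_cosB t y : \int[m]_w (phi w * cos (t * (X w - y))) =
  cos (t * y) * fourier_cos t + sin (t * y) * fourier_sin t.
Proof.
have mc : measurable_fun setT (fun w => cos (t * X w)).
  by apply: (measurableT_comp (measurable_cosZ t)).
have ms : measurable_fun setT (fun w => sin (t * X w)).
  by apply: (measurableT_comp (measurable_sinZ t)).
have ic := le1_integrable mc (fun w => cos_max _).
have i_s := le1_integrable ms (fun w => sin_max _).
rewrite -RintegralZl// -RintegralZl// -RintegralD//; [|exact: RintegrableZl..].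
by apply: eq_Rintegral => w _; rewrite mulrBr cosB; ring.
Qed.

(* Convolution with a Gaussian density only involves the Fourier transform of
   [phi] weighted by the law of [X]. *)
Lemma smoothing_density (s y : R) : 0 < s ->
  \int[m]_w (phi w * normal_pdf (X w) s y) =
  normal_peak s * \int[mu]_t (normal_pdf 0 s^-1 t *
    (cos (t * y) * fourier_cos t + sin (t * y) * fourier_sin t)).
Proof.
move=> s0; have s'0 : s^-1 != 0 by rewrite invr_neq0 ?gt_eqF.
(* A Gaussian of deviation [s] is, up to its peak, the Fourier transform of the normal density of
   deviation [s^-1]; this replaces the smoothing kernel by an average of cosines. *)
have IE w : \int[mu]_t (normal_pdf 0 s^-1 t * cos (t * (X w - y))) =
    gaussc (2 * s ^+ 2)^-1 (y - X w).
  under eq_Rintegral do rewrite [_ * (X w - y)]mulrC.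
  rewrite Rintegral_cos_normal// /gaussc; congr expR.
  by field; rewrite gt_eqF.
have mcos : measurable_fun setT (fun z : T * R => cos (z.2 * (X z.1 - y))).
  apply: measurableT_comp; first exact: continuous_measurable_fun (@continuous_cos R).
  apply: measurable_funM => //; apply: measurable_funB => //.
  exact: measurableT_comp.
have mpdf : measurable_fun setT (fun z : T * R => normal_pdf 0 s^-1 z.2).
  by apply: measurableT_comp => //; exact: measurable_normal_pdf.
have ipdf w : mu.-integrable setT
    (EFin \o (fun t => normal_pdf 0 s^-1 t * cos (t * (X w - y)))).
  apply: (le_Rintegrable measurableT _ _ (integrable_normal_pdf 0 s^-1)).
    apply: measurable_funM; first exact: measurable_normal_pdf.
    by under eq_fun do rewrite mulrC; exact: measurable_cosZ.
  move=> t _; rewrite normrM (ger0_norm (normal_pdf_ge0 _ _ _)).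
  by rewrite ler_piMr ?normal_pdf_ge0// cos_max.
pose f (z : T * R) := phi z.1 * (normal_pdf 0 s^-1 z.2 * cos (z.2 * (X z.1 - y))).
have mf : measurable_fun setT f.
  apply: measurable_funM; first exact: measurableT_comp.
  exact: measurable_funM.
under eq_Rintegral do rewrite normal_pdf_gaussc ?gt_eqF// mulrCA.
rewrite RintegralZl//; last first.
  apply: le1_integrable.
    apply: (measurableT_comp (measurable_gaussc _)).
    exact: measurable_funB.
  move=> w; rewrite ger0_norm ?expR_ge0// -expR0 ler_expR oppr_le0.
  by rewrite mulr_ge0 ?sqr_ge0// invr_ge0 mulr_ge0// sqr_ge0.
congr (_ * _).
transitivity (\int[m]_w \int[mu]_t f (w, t)).
  by apply: eq_Rintegral => w _; rewrite -IE -RintegralZl.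
have icos t : m.-integrable setT
    (EFin \o (fun w => phi w * cos (t * (X w - y)))).
  apply: le1_integrable => [|w]; last exact: cos_max.
  apply: (measurableT_comp (measurable_cosZ t)).
  exact: measurable_funB.
rewrite (@RFubini _ _ _ _ _ m mu f (fun w => `|phi w|))//.
- apply: eq_Rintegral => t _; rewrite /f/=.
  under eq_Rintegral do rewrite mulrCA.
  by rewrite RintegralZl// fourier_cosB.
- by move=> w; exact: (RintegrableZl measurableT (phi w) (ipdf w)).
- move=> t.
  apply: eq_integrable (RintegrableZl measurableT (normal_pdf 0 s^-1 t) (icos t)) => // w _ /=.
  by rewrite mulrCA.
- move=> w; rewrite -[leRHS]mulr1 -(Rintegral_normal_pdf (0 : R) s^-1) -RintegralZl//; last first.
    exact: integrable_normal_pdf.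
  apply: le_Rintegral => //.
  + exact: integrable_norm (RintegrableZl measurableT (phi w) (ipdf w)).
  + by apply: RintegrableZl => //; exact: integrable_normal_pdf.
  + move=> t _; rewrite /f/= !normrM ler_wpM2l// (ger0_norm (normal_pdf_ge0 _ _ _)).
    by rewrite ler_piMr ?normal_pdf_ge0// cos_max.
- exact: integrable_norm iphi.
Qed.

(** The previous identity integrated over [y <= b]. The left side is a smoothed distribution
    function of the weighted law of [X]; the right side depends on [X] and [phi] only through the
    two transforms. *)
Lemma smoothing_cdf (s b : R) : 0 < s ->
  \int[m]_w (phi w * fine (normal_prob (X w) s `]-oo, b])) =
  \int[mu]_y (\1_`]-oo, b] y * (normal_peak s * \int[mu]_t (normal_pdf 0 s^-1 t *
    (cos (t * y) * fourier_cos t + sin (t * y) * fourier_sin t)))).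
Proof.
move=> s0.
pose f (z : T * R) := phi z.1 * (\1_`]-oo, b] z.2 * normal_pdf (X z.1) s z.2).
have mpdf : measurable_fun setT (fun z : T * R => normal_pdf (X z.1) s z.2).
  under eq_fun do rewrite normal_pdf_gaussc ?gt_eqF//.
  apply: measurable_funM => //; apply: (measurableT_comp (measurable_gaussc _)).
  by apply: measurable_funB => //; exact: measurableT_comp.
have mf : measurable_fun setT f.
  apply: measurable_funM; first exact: measurableT_comp.
  apply: measurable_funM => //.
  by apply: measurableT_comp => //; exact: measurable_indic.
have ind1 y : `|\1_`]-oo, b] y| <= 1 :> R.
  by rewrite indicE; case: (_ \in _); rewrite ?normr1 ?normr0.
have ipdf w : mu.-integrable setT
    (EFin \o (fun y => \1_`]-oo, b] y * normal_pdf (X w) s y)).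
  apply: (le_Rintegrable measurableT _ _ (integrable_normal_pdf (X w) s)).
    by apply: measurable_funM; [exact: measurable_indic|exact: measurable_normal_pdf].
  move=> y _; rewrite normrM (ger0_norm (normal_pdf_ge0 _ _ _)).
  by rewrite ler_piMl ?normal_pdf_ge0.
have icos y : m.-integrable setT (EFin \o (fun w => phi w * normal_pdf (X w) s y)).
  (* Division by the peak bounds the density by 1, the form that [le1_integrable] accepts. *)
  have : m.-integrable setT (EFin \o (fun w => phi w * ((normal_peak s)^-1 * normal_pdf (X w) s y))).
    apply: le1_integrable.
      apply: measurable_funM => //; under eq_fun do rewrite normal_pdf_gaussc ?gt_eqF//.
      apply: measurable_funM => //; apply: (measurableT_comp (measurable_gaussc _)).
      exact: measurable_funB.
    move=> w; rewrite ger0_norm ?mulr_ge0 ?invr_ge0 ?normal_peak_ge0 ?normal_pdf_ge0//.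
    rewrite ler_pdivrMl ?normal_peak_gt0 ?gt_eqF// mulr1.
    by rewrite normal_pdf_ub// gt_eqF.
  move/(RintegrableZl measurableT (normal_peak s)); apply: eq_integrable => // w _ /=.
  by rewrite mulrCA mulVKf// gt_eqF// normal_peak_gt0 ?gt_eqF.
transitivity (\int[m]_w \int[mu]_y f (w, y)).
  apply: eq_Rintegral => w _; rewrite /f/= RintegralZl//; congr (_ * _).
  rewrite /Rintegral /normal_prob [in LHS]integral_mkcond; congr fine.
  apply: eq_integral => y _.
  by rewrite patchE indicE; case: (_ \in _); rewrite ?mul1r ?mul0r//.
rewrite (@RFubini _ _ _ _ _ m mu f (fun w => `|phi w|))//.
- apply: eq_Rintegral => y _; rewrite /f/= -smoothing_density//.
  under eq_Rintegral do rewrite mulrCA.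
  by rewrite RintegralZl.
- by move=> w; exact: (RintegrableZl measurableT (phi w) (ipdf w)).
- move=> y; apply: eq_integrable (RintegrableZl measurableT (\1_`]-oo, b] y) (icos y)) => // w _ /=.
  by rewrite mulrCA.
- move=> w; rewrite -[leRHS]mulr1 -(Rintegral_normal_pdf (X w) s) -RintegralZl//; last first.
    exact: integrable_normal_pdf.
  apply: le_Rintegral => //.
  + exact: integrable_norm (RintegrableZl measurableT (phi w) (ipdf w)).
  + by apply: RintegrableZl => //; exact: integrable_normal_pdf.
  + move=> y _; rewrite /f/= !normrM ler_wpM2l// (ger0_norm (normal_pdf_ge0 _ _ _)).
    by rewrite ler_piMl ?normal_pdf_ge0.
- exact: integrable_norm iphi.
Qed.

Lemma measurable_normal_prob (s : R) (D : set R) : 0 < s -> measurable D ->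
  measurable_fun setT (fun w => fine (normal_prob (X w) s D)).
Proof.
move=> s0 mD; apply: measurableT_comp => //.
under eq_fun do rewrite /normal_prob integral_mkcond.
pose f (z : T * R) := (\1_D z.2 * normal_pdf (X z.1) s z.2)%:E.
rewrite (_ : (fun _ => _) = (fun w => \int[mu]_y f (w, y))%E); last first.
  apply/funext => w; apply: eq_integral => y _.
  by rewrite patchE /f/= indicE; case: (_ \in _); rewrite ?mul1r ?mul0r.
apply: (@measurable_fun_fubini_tonelli_F _ _ _ _ _ mu f).
  apply/measurable_EFinP; apply: measurable_funM.
    by apply: measurableT_comp => //; exact: measurable_indic.
  under eq_fun do rewrite normal_pdf_gaussc ?gt_eqF//.
  apply: measurable_funM => //; apply: (measurableT_comp (measurable_gaussc _)).
  by apply: measurable_funB => //; exact: measurableT_comp.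
by move=> z; rewrite lee_fin mulr_ge0 ?normal_pdf_ge0.
Qed.

Lemma cvg_smoothing_cdf (b : R) :
  \int[m]_w (phi w * fine (normal_prob (X w) (inv_succn n ^+ 2)
     `]-oo, b + inv_succn n])) @[n --> \oo] -->
  \int[m]_w (phi w * \1_`]-oo, b] (X w)).
Proof.
have [||||_] := @Rdominated_cvg _ _ _ m setT measurableT
  (fun n w => phi w * fine (normal_prob (X w) (inv_succn n ^+ 2)
     `]-oo, b + inv_succn n])) (fun w => phi w * \1_`]-oo, b] (X w))
  (fun w => `|phi w|); last exact.
- move=> n; apply: measurable_funM => //; apply: measurable_normal_prob => //.
  by rewrite exprn_gt0// invr_gt0.
- move=> w _; apply: cvgM; first exact: cvg_cst.
  exact: cvg_normal_prob_itv.
- move=> n w _; rewrite normrM ler_piMr// ger0_norm ?fine_ge0//.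
  rewrite -lee_fin fineK ?fin_num_measure//.
  exact: (probability_le1 (normal_prob _ _)).
- exact: integrable_norm iphi.
Qed.

End Smoothing.

(** For each [n] the smoothed distribution functions on the two spaces coincide, and
    [cvg_smoothing_cdf] takes them to the two sides. *)
Lemma fourier_uniqueness d1 d2 (T1 : measurableType d1) (T2 : measurableType d2)
    (m1 : {sigma_finite_measure set T1 -> \bar R})
    (m2 : {sigma_finite_measure set T2 -> \bar R})
    (X1 phi1 : T1 -> R) (X2 phi2 : T2 -> R) (b : R) :
  measurable_fun setT X1 -> measurable_fun setT X2 ->
  m1.-integrable setT (EFin \o phi1) -> m2.-integrable setT (EFin \o phi2) ->
  fourier_cos m1 X1 phi1 =1 fourier_cos m2 X2 phi2 ->
  fourier_sin m1 X1 phi1 =1 fourier_sin m2 X2 phi2 ->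
  \int[m1]_w (phi1 w * \1_`]-oo, b] (X1 w)) =
  \int[m2]_w (phi2 w * \1_`]-oo, b] (X2 w)).
Proof.
move=> mX1 mX2 i1 i2 /funext C /funext S.
have H1 := @cvg_smoothing_cdf _ _ _ _ _ mX1 i1 b.
have H2 := @cvg_smoothing_cdf _ _ _ _ _ mX2 i2 b.
apply: (cvg_unique _ H1) => //; apply: cvg_trans H2.
apply: near_eq_cvg; apply: nearW => n.
by rewrite !smoothing_cdf ?C ?S// exprn_gt0// invr_gt0.
Qed.

(** Comparison with the zero weight shows that all integrals over []-oo, b]] vanish; by Lebesgue
    differentiation [phi] is almost everywhere the derivative of this zero primitive. *)
Lemma fourier_eq0_ae (phi : R -> R) : mu.-integrable setT (EFin \o phi) ->
  (forall t, \int[mu]_x (phi x * cos (t * x)) = 0) ->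
  (forall t, \int[mu]_x (phi x * sin (t * x)) = 0) ->
  {ae mu, forall x, phi x = 0}.
Proof.
move=> iphi C S.
have mid : measurable_fun [set: measurableTypeR R] (idfun : R -> R).
  exact: measurable_id.
have i0 : mu.-integrable setT (EFin \o (cst 0 : R -> R)).
  apply: eq_integrable (RintegrableZl measurableT 0 iphi) => // x _ /=.
  by rewrite mul0r.
have F0 b : \int[mu]_(x in `]-oo, b]) phi x = 0.
  rewrite Rintegral_mkcond.
  transitivity (\int[mu]_x (phi x * \1_`]-oo, b] (idfun x))).
    apply: eq_Rintegral => x _; rewrite patchE indicE.
    by case: (_ \in _); rewrite ?mulr1 ?mulr0.
  rewrite (fourier_uniqueness b mid mid iphi i0).
  - by under eq_Rintegral do rewrite mul0r; rewrite Rintegral_cst// mul0r.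
  - move=> t; rewrite /fourier_cos C.
    by under eq_Rintegral do rewrite mul0r; rewrite Rintegral_cst// mul0r.
  - move=> t; rewrite /fourier_sin S.
    by under eq_Rintegral do rewrite mul0r; rewrite Rintegral_cst// mul0r.
have [||N [mN N0 sN]] := @FTC1Ny R phi.
- by move=> y; apply: integrableS iphi.
- by have := integrable_locally measurableT iphi; rewrite patch_setT.
exists N; split => // x /= phix; apply: sN => /= -[_].
under eq_fun do rewrite F0.
by rewrite derive1_cst => /esym.
Qed.

(** With weight 1 under [P] and the normal density on the real line, uniqueness compares
    distribution functions. Complements give the rays []a, +oo[], a generating family stable under
    intersection. *)
Lemma normal_law d (T : measurableType d) (P : probability T R) (X : T -> R)
    (s : R) : s != 0 -> measurable_fun setT X ->
  (forall t, \int[P]_w cos (t * X w) = expR (- (t ^+ 2 * s ^+ 2 / 2))) ->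
  (forall t, \int[P]_w sin (t * X w) = 0) ->
  forall A, measurable A -> P (X @^-1` A) = normal_prob 0 s A.
Proof.
move=> s0 mX C S.
have mid : measurable_fun [set: measurableTypeR R] (idfun : R -> R).
  exact: measurable_id.
have i1 : P.-integrable setT (EFin \o (cst 1 : T -> R)).
  exact: finite_measure_integrable_cst.
have cdfE b : P (X @^-1` `]-oo, b]) = normal_prob 0 s `]-oo, b].
  have mXb : measurable (X @^-1` `]-oo, b]) by rewrite -[_ @^-1` _]setTI; exact: mX.
  have : \int[P]_w (cst 1 w * \1_`]-oo, b] (X w)) =
      \int[mu]_x (normal_pdf 0 s x * \1_`]-oo, b] (idfun x)).
    apply: fourier_uniqueness => //.
    - exact: integrable_normal_pdf.
    - move=> t; rewrite /fourier_cos Rintegral_cos_normal// -C.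
      by apply: eq_Rintegral => x _; rewrite mul1r.
    - move=> t; rewrite /fourier_sin Rintegral_sin_normal// -(S t).
      by apply: eq_Rintegral => x _; rewrite mul1r.
  have -> : \int[P]_w (cst 1 w * \1_`]-oo, b] (X w)) = fine (P (X @^-1` `]-oo, b])).
    transitivity (\int[P]_w (\1_(X @^-1` `]-oo, b]) w)).
      apply: eq_Rintegral => w _; rewrite mul1r !indicE.
      by congr (nat_of_bool _)%:R; apply/idP/idP; rewrite !inE.
    by rewrite /Rintegral integral_indic// setIT.
  have -> : \int[mu]_x (normal_pdf 0 s x * \1_`]-oo, b] (idfun x)) =
      fine (normal_prob 0 s `]-oo, b]).
    rewrite /normal_prob [in RHS]integral_mkcond; congr fine.
    apply: eq_integral => x _; rewrite patchE indicE.
    by case: (_ \in _); rewrite ?mulr1 ?mulr0.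
  move=> /(congr1 (@EFin R)); rewrite !fineK//; exact: fin_num_measure.
move=> A mA.
pose Y : T -> measurableTypeR R := X.
have mY : measurable_fun setT Y by exact: mX.
pose m' : {measure set (measurableTypeR R) -> \bar R} := pushforward P Y.
pose m := m' mY.
pose nu : {measure set (measurableTypeR R) -> \bar R} := normal_prob 0 s.
apply: (@measure_unique _ R (measurableTypeR R) (@RGenOInfty.G R)
  (fun n => `]- n%:R, +oo[%classic) _ _ _ _ m nu) => //.
- exact: RGenOInfty.measurableE.
- move=> _ _ [a ->] [c ->]; exists (Num.max a c).
  by apply/seteqP; split=> x /=; rewrite !in_itv/= !andbT gt_max => /andP.
- by move=> n; exists (- n%:R).
- apply/seteqP; split=> // x _.
  exists (Num.bound `|x|) => //=; rewrite in_itv/= andbT.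
  by rewrite ltrNl (le_lt_trans (ler_norm _))// normrN archi_boundP.
- move=> _ [a ->].
  change (P (X @^-1` `]a, +oo[) = normal_prob 0 s `]a, +oo[).
  rewrite -[`]a, +oo[%classic]setCK setCitvr.
  transitivity (1 - normal_prob 0 s `]-oo, a])%E; last first.
    by apply/esym; exact: (probability_setC (normal_prob 0 s)).
  have mXa : measurable (X @^-1` `]-oo, a]).
    by rewrite -[_ @^-1` _]setTI; exact: mX.
  by rewrite -cdfE -(probability_setC P mXa).
- move=> n; rewrite (le_lt_trans _ (ltry 1))//.
  by apply: probability_le1; rewrite -[_ @^-1` _]setTI; exact: mX.
Qed.

End FourierUniqueness.

(** * Square-integrable functions and Hermite functions *)

Section SquareIntegrable.
Context d (T : measurableType d) (R : realType).
Variable m : {measure set T -> \bar R}.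
Implicit Types (f g h : T -> R).

(** [L^2] for functions rather than classes, phrased with real integrals; [Lfun2P] and [Lnorm2E]
    translate to the spaces and norms of the statement. *)
Definition sqint f := measurable_fun setT f /\
  m.-integrable setT (EFin \o (fun x => f x ^+ 2)).

Lemma sqintM f g : sqint f -> sqint g ->
  m.-integrable setT (EFin \o (fun x => f x * g x)).
Proof.
move=> [mf fi] [mg gi].
apply: (le_Rintegrable measurableT _ _ (RintegrableD measurableT fi gi)).
  exact: measurable_funM.
move=> x _; rewrite normrM.
rewrite -(real_normK (num_real (f x))) -(real_normK (num_real (g x))).
have := sqr_ge0 (`|f x| - `|g x|); have := mulr_ge0 (normr_ge0 (f x)) (normr_ge0 (g x)).
rewrite sqrrB; lra.
Qed.

Lemma sqintZ c f : sqint f -> sqint (fun x => c * f x).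
Proof.
move=> [mf fi]; split; first exact: measurable_funM.
apply: eq_integrable (RintegrableZl measurableT (c ^+ 2) fi) => // x _ /=.
by rewrite exprMn.
Qed.

Lemma sqintD f g : sqint f -> sqint g -> sqint (fun x => f x + g x).
Proof.
move=> sf sg; have [mf fi] := sf; have [mg gi] := sg.
split; first exact: measurable_funD.
have := RintegrableD measurableT (RintegrableD measurableT fi gi)
  (RintegrableZl measurableT 2 (sqintM sf sg)).
by apply: eq_integrable => // x _ /=; congr EFin; ring.
Qed.

Lemma sqintB f g : sqint f -> sqint g -> sqint (fun x => f x - g x).
Proof.
move=> sf sg; have := sqintD sf (sqintZ (-1) sg).
by under eq_fun do rewrite mulN1r.
Qed.

Lemma sqint_sum (I : Type) (s : seq I) (F : I -> T -> R) :
  (forall i, sqint (F i)) -> sqint (fun x => \sum_(i <- s) F i x).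
Proof.
move=> sF; elim: s => [|i s IH].
  under eq_fun do rewrite big_nil.
  split; first exact: measurable_cst.
  apply: (eq_integrable measurableT (cst 0%E)); last exact: integrable0.
  by move=> x _ /=; rewrite expr0n.
by under eq_fun do rewrite big_cons; exact: sqintD.
Qed.

Lemma Lfun2P f : f \in Lfun m 2%:E <-> sqint f.
Proof.
split=> [fL|[mf fi]].
  split; last exact: Lfun2_integrable_sqr.
  by move: fL; rewrite inE => /andP[/[!inE]/=].
rewrite inE; apply/andP; split; first by rewrite inE.
rewrite inE/= /finite_norm unlock poweR_lty//.
have := integrable_lty measurableT fi.
under eq_integral do rewrite /= -(real_normK (num_real (f _))) -powR_mulrn//.
by [].
Qed.

Lemma Lnorm2E f : sqint f ->
  ('N[m]_2%:E[EFin \o f] = (Num.sqrt (\int[m]_x (f x ^+ 2)))%:E)%E.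
Proof.
move=> [mf fi]; rewrite unlock.
have -> : (\int[m]_x (`|(EFin \o f) x| `^ 2))%E = (\int[m]_x (f x ^+ 2))%:E.
  rewrite /Rintegral fineK; last exact: (integrable_fin_num _ fi).
  by apply: eq_integral => x _; rewrite /= powR_mulrn// real_normK// num_real.
by rewrite poweR_EFin powR12_sqrt// Rintegral_ge0// => x _; exact: sqr_ge0.
Qed.

Lemma Rintegral_sqr_ge0 f : 0 <= \int[m]_x (f x ^+ 2).
Proof. by apply: Rintegral_ge0 => x _; exact: sqr_ge0. Qed.

Lemma Rintegral_sqrD_le f g : sqint f -> sqint g ->
  \int[m]_x ((f x + g x) ^+ 2) <=
  2 * \int[m]_x (f x ^+ 2) + 2 * \int[m]_x (g x ^+ 2).
Proof.
move=> sf sg; have [_ fi] := sf; have [_ gi] := sg.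
rewrite -!RintegralZl// -RintegralD//; [|exact: RintegrableZl..].
apply: le_Rintegral => //.
- by case: (sqintD sf sg).
- by apply: RintegrableD => //; exact: RintegrableZl.
- move=> x _; have := sqr_ge0 (f x - g x); rewrite sqrrB sqrrD; lra.
Qed.

(* Riesz-Fischer: the sum of [4 ^+ k * (v k.+1 - v k) ^+ 2] is integrable, hence
   finite almost everywhere, where the differences decay geometrically. *)
Lemma fast_L2_limit (v : nat -> T -> R) : (forall k, sqint (v k)) ->
  (forall k, \int[m]_x ((v k.+1 x - v k x) ^+ 2) <= 8^-1 ^+ k) ->
  exists2 u, sqint u & \int[m]_x ((u x - v k x) ^+ 2) @[k --> \oo] --> 0.
Proof.
move=> sv dv.
pose dd k x := v k.+1 x - v k x.
have sd k : sqint (dd k) by exact: sqintB.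
pose W x := (\sum_(k <oo) (4 ^+ k * dd k x ^+ 2)%:E)%E.
have W0 x k : (0 <= (4 ^+ k * dd k x ^+ 2)%:E :> \bar R)%E.
  by rewrite lee_fin mulr_ge0 ?sqr_ge0 ?exprn_ge0.
have mt k : measurable_fun setT (fun x => (4 ^+ k * dd k x ^+ 2)%:E).
  apply/measurable_EFinP; apply: measurable_funM => //.
  by apply: measurable_funX; case: (sd k).
have mW : measurable_fun setT W.
  by apply: ge0_emeasurable_sum => // k x _ _.
have W_ge0 x : (0 <= W x)%E by exact: nneseries_ge0.
(* The terms integrate to at most [4^k 8^-k = 2^-k], with sum 2. *)
have intW : (\int[m]_x W x <= 2%:E)%E.
  rewrite /W integral_nneseries//.
  have H := @cvg_geometric_eseries_half R 2 0.
  rewrite expr0 divr1 in H; rewrite -(cvg_lim _ H)//.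
  apply: lee_nneseries => [k _ _|k _]; first exact: integral_ge0.
  have [_ ik] := sd k.
  under eq_integral do rewrite EFinM.
  rewrite integralZl//= -[X in (_ * X <= _)%E]fineK; last exact: (integrable_fin_num _ ik).
  rewrite -EFinM lee_fin addn1 natrX exprS invfM mulrA mulfV// mul1r.
  apply: (le_trans (ler_wpM2l _ (dv k))); first exact: exprn_ge0.
  rewrite -exprMn -exprVn lerXn2r ?nnegrE//; lra.
have dW x k : W x \is a fin_num -> `|dd k x| <= Num.sqrt (fine (W x)) * 2^-1 ^+ k.
  move=> Wf.
  have : ((4 ^+ k * dd k x ^+ 2)%:E <= W x)%E.
    apply: (@le_trans _ _ (\sum_(0 <= i < k.+1) (4 ^+ i * dd i x ^+ 2)%:E)%E).
      by rewrite big_nat_recr//= leeDr// sume_ge0.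
    by apply: nneseries_lim_ge.
  rewrite -[X in (_ <= X)%E]fineK// lee_fin => H.
  rewrite -sqrtr_sqr.
  have -> : (2^-1 : R) ^+ k = Num.sqrt (4^-1 ^+ k).
    have -> : 4^-1 = 2^-1 ^+ 2 :> R by field.
    by rewrite -exprM mulnC exprM sqrtr_sqr ger0_norm// exprn_ge0// invr_ge0.
  rewrite -sqrtrM; last by rewrite fine_ge0.
  rewrite ler_wsqrtr// exprVn ler_pdivlMr ?exprn_gt0//.
  by rewrite mulrC.
(* The factor [1 - 2^-j] records the exact partial geometric sum, which lets the induction on [j]
   close. *)
have vW x k j : W x \is a fin_num ->
    `|v (k + j)%N x - v k x| <= Num.sqrt (fine (W x)) * (2 * 2^-1 ^+ k) * (1 - 2^-1 ^+ j).
  move=> Wf; elim: j => [|j IH].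
    by rewrite addn0 subrr normr0 expr0 subrr mulr0.
  have -> : v (k + j.+1)%N x - v k x = dd (k + j)%N x + (v (k + j)%N x - v k x).
    by rewrite /dd addnS; ring.
  apply: (le_trans (ler_normD _ _)); apply: (le_trans (lerD (dW x (k + j)%N Wf) IH)).
  rewrite exprD exprS.
  by rewrite le_eqVlt; apply/orP; left; apply/eqP; field.
have cv x : W x \is a fin_num -> cvgn (fun k => v k x).
  move=> Wf; have : cvgn (series (fun k => dd k x)).
    apply: normed_cvg; apply: (@series_le_cvg _ _ (geometric (Num.sqrt (fine (W x))) 2^-1)).
    - by move=> n; exact: normr_ge0.
    - by move=> n; rewrite /= mulr_ge0 ?sqrtr_ge0// exprn_ge0// invr_ge0.
    - by move=> n; exact: dW.
    - by apply: is_cvg_geometric_series; rewrite ger0_norm ?invr_ge0// invf_lt1// ltr1n.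
  move=> cs; rewrite (_ : (fun k => v k x) =
      cst (v 0%N x) + series (fun k => dd k x)).
    by apply: is_cvgD => //; exact: is_cvg_cst.
  by apply/funext => n; rewrite fctE /series/= telescope_sumr// addrC subrK.
pose A := [set x | W x \is a fin_num].
have mA : measurable A.
  by rewrite -(setTI A); exact: emeasurable_fin_num.
(* Where [W] is infinite the truncated functions are 0, so the limit exists at every point and is
   measurable. *)
pose u x := limn (fun k => (v k \_ A) x).
have cA x : (v k \_ A) x @[k --> \oo] --> u x.
  rewrite /u; suff : cvgn (fun k => (v k \_ A) x) by [].
  have [Ax|nAx] := boolP (x \in A).
    under eq_fun do rewrite patchE ifT//.
    by apply: cv; move: Ax; rewrite inE.
  under eq_fun do rewrite patchE ifN//.
  exact: is_cvg_cst.
have mu : measurable_fun setT u.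
  apply: (@measurable_fun_cvg _ _ _ _ (fun k => v k \_ A)) => // k.
  by apply/(measurable_restrictT _ _).1 => //; apply: measurable_funTS; case: (sv k).
(* Off [A] the right side is [+oo]; on [A] this is the square of the limit of [vW] as [j] grows. *)
have uW k x : (((u x - v k x) ^+ 2)%:E <= (4 * 4^-1 ^+ k)%:E * W x)%E.
  have [Wf|] := boolP (W x \is a fin_num); last first.
    rewrite ge0_fin_numE// -leNgt leye_eq => /eqP ->.
    by rewrite gt0_muley ?leey// lte_fin mulr_gt0// exprn_gt0// invr_gt0.
  rewrite -[W x]fineK// -EFinM lee_fin.
  have : `|u x - v k x| <= Num.sqrt (fine (W x)) * (2 * 2^-1 ^+ k).
    have cu : `|v (j + k)%N x - v k x| @[j --> \oo] --> `|u x - v k x|.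
      apply: cvg_norm; apply: cvgB; last exact: cvg_cst.
      rewrite (cvg_shiftn k (fun j => v j x)); apply: cvg_trans (cA x).
      by apply: near_eq_cvg; apply: nearW => j; rewrite patchE ifT// inE.
    apply: (cvgr_to_le cu); apply: nearW => j; rewrite addnC.
    apply: (le_trans (vW x k j Wf)); rewrite ler_piMr ?mulr_ge0 ?sqrtr_ge0 ?exprn_ge0 ?invr_ge0//.
  move=> H; rewrite -(real_normK (num_real _)).
  have : `|u x - v k x| ^+ 2 <= (Num.sqrt (fine (W x)) * (2 * 2^-1 ^+ k)) ^+ 2.
    apply: lerXn2r => //; rewrite nnegrE//.
  move=> /le_trans; apply; rewrite exprMn sqr_sqrtr ?fine_ge0// mulrC.
  rewrite exprMn -exprM mulnC exprM ler_wpM2r ?fine_ge0//.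
  have -> : 2^-1 ^+ 2 = 4^-1 :> R by field.
  by have -> : 2 ^+ 2 = 4 :> R by ring.
have muv k : measurable_fun setT (fun x => (u x - v k x) ^+ 2).
  by apply: measurable_funX; apply: measurable_funB => //; case: (sv k).
have iuv k : (\int[m]_x ((u x - v k x) ^+ 2)%:E <= (8 * 4^-1 ^+ k)%:E)%E.
  have c0 : 0 <= 4 * 4^-1 ^+ k :> R by rewrite mulr_ge0// exprn_ge0// invr_ge0.
  apply: (@le_trans _ _ (\int[m]_x ((4 * 4^-1 ^+ k)%:E * W x))%E).
    apply: ge0_le_integral => //.
    - by move=> x _; rewrite lee_fin sqr_ge0.
    - exact/measurable_EFinP.
    - by apply: measurable_funeM.
  rewrite ge0_integralZl//.
  apply: (le_trans (lee_wpmul2l _ intW)); first by rewrite lee_fin.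
  rewrite -EFinM lee_fin; have -> : 4 * 4^-1 ^+ k * 2 = 8 * 4^-1 ^+ k :> R by ring.
  by [].
have suv k : sqint (fun x => u x - v k x).
  split; first by apply: measurable_funB => //; case: (sv k).
  apply/integrableP; split; first exact/measurable_EFinP.
  under eq_integral do rewrite /= ger0_norm ?sqr_ge0//.
  by apply: (le_lt_trans (iuv k)); rewrite ltry.
exists u.
  by have := sqintD (suv 0%N) (sv 0%N); under eq_fun do rewrite subrK.
apply: (@squeeze_cvgr _ _ _ _ (cst 0) (fun k => 8 * 4^-1 ^+ k)).
- apply: nearW => k; rewrite Rintegral_sqr_ge0/= -lee_fin.
  rewrite fineK; first exact: iuv.
  by case: (suv k) => _ H; exact: (integrable_fin_num _ H).
- exact: cvg_cst.
- rewrite -(mulr0 8); apply: cvgM; first exact: cvg_cst.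
  by apply: cvg_expr; rewrite ger0_norm ?invr_ge0// invf_lt1// ltr1n.
Qed.

Section Orthonormal.
Variable e : nat -> T -> R.
Hypothesis se : forall n, sqint (e n).
Hypothesis orth : forall i j, \int[m]_x (e i x * e j x) = (i == j)%:R.

Definition coef f n := \int[m]_x (f x * e n x).
Definition expansion f N x := \sum_(0 <= n < N) coef f n * e n x.
Definition energy f N := \sum_(0 <= n < N) coef f n ^+ 2.

Lemma sqint_expansion f N : sqint (expansion f N).
Proof. by apply: sqint_sum => n; exact: sqintZ. Qed.

Lemma fourier_coefB f g n : sqint f -> sqint g ->
  coef (fun x => f x - g x) n = coef f n - coef g n.
Proof.
move=> sf sg; rewrite /coef -RintegralB//; [|exact: sqintM..].
by apply: eq_Rintegral => x _; rewrite mulrBl.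
Qed.

Lemma coef_expansion f N n :
  coef (expansion f N) n = if (n < N)%N then coef f n else 0.
Proof.
rewrite /coef /expansion.
under eq_Rintegral do rewrite mulr_suml.
rewrite Rintegral_sum//; last first.
  by move=> i; apply: sqintM => //; exact: sqintZ.
rewrite (eq_bigr (fun i => if i == n then coef f n else 0)); last first.
  move=> i _; under eq_Rintegral do rewrite -mulrA.
  rewrite RintegralZl//; last exact: sqintM.
  by rewrite orth; case: eqP => [->|_]; rewrite ?mulr1 ?mulr0.
rewrite -big_mkcond/= big_mkord.
case: ltnP => nN; last first.
  by rewrite big1// => i /eqP E; move: (ltn_ord i); rewrite E ltnNge nN.
by rewrite (big_pred1 (Ordinal nN)).
Qed.

Lemma Rintegral_sqr_residual f N : sqint f ->
  \int[m]_x ((f x - expansion f N x) ^+ 2) = \int[m]_x (f x ^+ 2) - energy f N.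
Proof.
move=> sf; have sE := sqint_expansion f N.
have dotE g : sqint g ->
    \int[m]_x (g x * expansion f N x) = \sum_(0 <= n < N) coef f n * coef g n.
  move=> sg; rewrite /expansion; under eq_Rintegral do rewrite mulr_sumr.
  rewrite Rintegral_sum//; last by move=> i; apply: sqintM => //; exact: sqintZ.
  apply: eq_bigr => i _; under eq_Rintegral do rewrite mulrCA.
  by rewrite RintegralZl//; exact: sqintM.
transitivity (\int[m]_x (f x ^+ 2 - 2 * (f x * expansion f N x) +
    expansion f N x * expansion f N x)).
  by apply: eq_Rintegral => x _; ring.
have [_ fi] := sf.
have i1 := RintegrableZl measurableT 2 (sqintM sf sE).
rewrite RintegralD//; [|exact: RintegrableB|exact: sqintM].
rewrite RintegralB// RintegralZl//; last exact: sqintM.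
rewrite !dotE//.
have -> : \sum_(0 <= n < N) coef f n * coef f n = energy f N.
  by apply: eq_bigr => n _; rewrite expr2.
have -> : \sum_(0 <= n < N) coef f n * coef (expansion f N) n = energy f N.
  by apply: eq_big_nat => n /andP[_ nN]; rewrite coef_expansion nN expr2.
ring.
Qed.

Lemma bessel f N : sqint f -> energy f N <= \int[m]_x (f x ^+ 2).
Proof.
by move=> sf; rewrite -subr_ge0 -Rintegral_sqr_residual// Rintegral_sqr_ge0.
Qed.

Lemma coef_sqr_le f n : sqint f -> coef f n ^+ 2 <= \int[m]_x (f x ^+ 2).
Proof.
move=> sf; apply: le_trans (bessel n.+1 sf).
rewrite /energy big_nat_recr//= lerDr; apply: sumr_ge0 => i _; exact: sqr_ge0.
Qed.

Lemma energy_nondecreasing f : nondecreasing_seq (energy f).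
Proof.
apply/nondecreasing_seqP => n; rewrite /energy big_nat_recr//= lerDl.
exact: sqr_ge0.
Qed.

Lemma cvg_energy f : sqint f -> cvgn (energy f).
Proof.
move=> sf; apply: nondecreasing_is_cvgn; first exact: energy_nondecreasing.
by exists (\int[m]_x (f x ^+ 2)) => _ [n _ <-]; exact: bessel.
Qed.

Lemma expansion_expansion f M N x : (M <= N)%N ->
  expansion (expansion f N) M x = expansion f M x.
Proof.
move=> MN; apply: eq_big_nat => n /andP[_ nM].
by rewrite coef_expansion (leq_trans nM MN).
Qed.

Lemma energy_expansion f M N : (M <= N)%N ->
  energy (expansion f N) M = energy f M.
Proof.
move=> MN; apply: eq_big_nat => n /andP[_ nM].
by rewrite coef_expansion (leq_trans nM MN).
Qed.

Lemma Rintegral_sqr_expansion f N :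
  \int[m]_x (expansion f N x ^+ 2) = energy f N.
Proof.
have := Rintegral_sqr_residual N (sqint_expansion f N).
rewrite energy_expansion// => E; apply/subr0_eq; rewrite -E.
under eq_Rintegral do rewrite expansion_expansion// subrr expr0n.
by rewrite Rintegral_cst// mul0r.
Qed.

(** For [M <= N] the shorter expansion of [f] is also that of the longer one, so the residual
    formula applies to it. *)
Lemma expansion_diff f M N :
  \int[m]_x ((expansion f N x - expansion f M x) ^+ 2) =
  `|energy f N - energy f M|.
Proof.
wlog MN : M N / (M <= N)%N.
  move=> H; case/orP: (leq_total M N) => MN; first exact: H.
  by rewrite distrC -H//; apply: eq_Rintegral => x _; rewrite -sqrrN opprB.
rewrite ger0_norm ?subr_ge0 ?energy_nondecreasing//.
under eq_Rintegral do rewrite -(expansion_expansion f _ MN).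
rewrite Rintegral_sqr_residual; last exact: sqint_expansion.
by rewrite Rintegral_sqr_expansion energy_expansion.
Qed.

Hypothesis complete : forall r, sqint r -> (forall n, coef r n = 0) ->
  \int[m]_x (r x ^+ 2) = 0.

(** Bessel bounds the energies, and hence their limit [a], by the integral. A subsequence of the
    expansions converges in [L^2] to some [u] with the coefficients of [f], so [f - u] is orthogonal
    to the whole family and has norm 0 by completeness; this gives the reverse inequality. *)
Lemma parseval f : sqint f ->
  energy f N @[N --> \oo] --> \int[m]_x (f x ^+ 2).
Proof.
move=> sf; have ca := cvg_energy sf; pose a := limn (energy f).
have ea N : energy f N <= a.
  exact: nondecreasing_cvgn_le (@energy_nondecreasing f) ca N.
have pos8 k : 0 < 8^-1 ^+ k :> R by rewrite exprn_gt0// invr_gt0.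
(* Energies within [8^-k] of their limit make consecutive expansions close at the rate that
   [fast_L2_limit] requires; [k <= N_ k] puts every fixed index eventually below [N_ k]. *)
have /choice[N_ HN] k : exists N, (k <= N)%N /\ a - 8^-1 ^+ k <= energy f N.
  have : \forall N \near \oo, a - 8^-1 ^+ k <= energy f N.
    by apply: (cvgr_ge _ ca); rewrite gtrBl.
  by move=> [N0 _ HN0]; exists (maxn k N0); rewrite leq_maxl; split => //; apply: HN0; rewrite /= leq_maxr.
have kge k : \int[m]_x ((expansion f (N_ k.+1) x - expansion f (N_ k) x) ^+ 2) <= 8^-1 ^+ k.
  rewrite expansion_diff ler_norml; have [_ H1] := HN k.+1; have [_ H2] := HN k.
  have : 8^-1 ^+ k.+1 <= 8^-1 ^+ k :> R.
    by rewrite exprS ler_piMl ?(ltW (pos8 k))// invf_le1// ler1n.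
  move: (ea (N_ k)) (ea (N_ k.+1)); lra.
have [u su cu] := fast_L2_limit (fun k => sqint_expansion f (N_ k)) kge.
have sr : sqint (fun x => f x - u x) by exact: sqintB.
(* Once [n < N_ k], this coefficient is minus that of [u - expansion f (N_ k)], which Bessel bounds
   by a norm tending to 0. *)
have r0 n : coef (fun x => f x - u x) n = 0.
  apply/eqP; rewrite -sqrf_eq0 eq_le sqr_ge0 andbT.
  apply: (cvgr_to_ge cu); near=> k.
  have nk : (n < N_ k)%N.
    by apply: leq_trans (HN k).1; near: k; exact: nbhs_infty_gt.
  have sE := sqint_expansion f (N_ k).
  have -> : coef (fun x => f x - u x) n = - coef (fun x => u x - expansion f (N_ k) x) n.
    by rewrite !fourier_coefB// coef_expansion nk; ring.
  by rewrite sqrrN; apply: coef_sqr_le; exact: sqintB.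
(* The residual of [f] is split as [(f - u) + (u - expansion f (N_ k))], and the first part has norm
   0. *)
have fa : \int[m]_x (f x ^+ 2) - a <= 0.
  have c2 : 2 * \int[m]_x ((u x - expansion f (N_ k) x) ^+ 2) @[k --> \oo] --> (2 * 0 : R).
    by apply: cvgM => //; exact: cvg_cst.
  rewrite -(mulr0 2); apply: (cvgr_to_ge c2); apply: nearW => k; have sE := sqint_expansion f (N_ k).
  apply: (@le_trans _ _ (\int[m]_x (f x ^+ 2) - energy f (N_ k))).
    by rewrite lerD2l lerN2.
  rewrite -Rintegral_sqr_residual//.
  have := Rintegral_sqrD_le sr (sqintB su sE).
  rewrite (complete sr r0) mulr0 add0r; apply: le_trans.
  by under [leRHS]eq_Rintegral do rewrite addrA subrK.
suff -> : \int[m]_x (f x ^+ 2) = a by [].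
apply/eqP; rewrite eq_le -subr_le0 fa/=.
by apply: limr_le => //; apply: nearW => n; exact: bessel.
Unshelve. all: by end_near. Qed.
End Orthonormal.
End SquareIntegrable.

Lemma cvg0_sum (R : realType) (T I : Type) (F : set_system T) {FF : Filter F}
    (s : seq I) (f : I -> T -> R) :
  (forall i, f i x @[x --> F] --> 0) ->
  \sum_(i <- s) f i x @[x --> F] --> 0.
Proof.
move=> f0; elim: s => [|i s IH].
  by under eq_fun do rewrite big_nil; exact: cvg_cst.
under eq_fun do rewrite big_cons.
by have := cvgD (f0 i) IH; rewrite addr0; exact.
Qed.

(** * Hermite polynomials under the Gaussian weight *)

Section PolynomialGaussian.
Context {R : realType}.
Notation mu := (@lebesgue_measure R).
Implicit Types (p q : {poly R}) (c x t : R).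

Lemma is_derive_horner p x : is_derive x 1 (fun y => p.[y]) p^`().[x].
Proof.
elim/poly_ind: p => [|p c IH].
  rewrite linear0; under eq_fun do rewrite horner0.
  by rewrite horner0; exact: is_derive_cst.
under eq_fun do rewrite !hornerE.
rewrite derivMXaddC !hornerE.
apply: (is_derive_eq (is_derive_fD (is_derive_fM IH (is_derive_id x 1))
  (is_derive_cst c x 1))).
by rewrite addr0 mulr1 addrC.
Qed.

Lemma measurable_horner p : measurable_fun [set: measurableTypeR R] (fun x => p.[x]).
Proof.
apply: continuous_measurable_fun => x.
exact: is_derive_continuous (is_derive_horner p x).
Qed.

Lemma integrable_horner_gaussc p c : 0 < c ->
  mu.-integrable setT (EFin \o (fun x => p.[x] * gaussc c x)).
Proof.
move=> c0.
have : mu.-integrable setT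
    (EFin \o (fun x => \sum_(i < size p) p`_i * (x ^+ i * gaussc c x))).
  apply: Rintegrable_sum => // i; apply: RintegrableZl => //.
  exact: integrable_monomial_gaussc.
apply: eq_integrable => // x _ /=; rewrite horner_coef mulr_suml.
by congr EFin; apply: eq_bigr => i _; rewrite mulrA.
Qed.

Lemma cvg_horner_gaussc p (F : set_system R) (FF : Filter F) :
  (forall c, 0 < c -> gaussc c x @[x --> F] --> 0) ->
  p.[x] * gaussc 1 x @[x --> F] --> 0.
Proof.
move=> g0.
have mono i : x ^+ i * gaussc 1 x @[x --> F] --> 0.
  (* From [|x|^i <= i! exp |x|] and [|x| <= 1/2 + x^2 / 2]; half of the Gaussian exponent is left
     over. *)
  apply: (@cvg0_le_norm _ _ _ _ _
     (fun x => i`!%:R * expR 2^-1 * gaussc 2^-1 x)) => [x|]; last first.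
    rewrite -(mulr0 (i`!%:R * expR 2^-1)); apply: cvgM; first exact: cvg_cst.
    by apply: g0; rewrite invr_gt0.
  rewrite normrM normrX (gtr0_norm (gaussc_gt0 _ _)).
  apply: (le_trans (ler_wpM2r _ (ler_norm_expR i x))); first exact: expR_ge0.
  rewrite -!mulrA ler_wpM2l// /gaussc -!expRD ler_expR.
  have -> : x ^+ 2 = `|x| ^+ 2 by rewrite real_normK ?num_real.
  have := sqr_ge0 (`|x| - 1); rewrite sqrrB; lra.
rewrite (_ : (fun x => _) = (fun x => \sum_(i < size p) p`_i * (x ^+ i * gaussc 1 x))).
  apply: cvg0_sum => i.
  by have := cvgM (cvg_cst p`_i) (mono i); rewrite mulr0; exact.
apply/funext => x; rewrite horner_coef mulr_suml.
by apply: eq_bigr => i _; rewrite mulrA.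
Qed.

Definition gauss_poly p := \int[mu]_x (p.[x] * gaussc 1 x).

Lemma gauss_polyD p q : gauss_poly (p + q) = gauss_poly p + gauss_poly q.
Proof.
rewrite /gauss_poly -RintegralD//; [|exact: integrable_horner_gaussc..].
by apply: eq_Rintegral => x _; rewrite hornerD mulrDl.
Qed.

Lemma gauss_polyZ c p : gauss_poly (c *: p) = c * gauss_poly p.
Proof.
rewrite /gauss_poly -RintegralZl//; last exact: integrable_horner_gaussc.
by apply: eq_Rintegral => x _; rewrite hornerZ mulrA.
Qed.

(** The derivative of [p gaussc 1] is [(p' - 2 X p) gaussc 1], and its integral over the line is
    0. *)
Lemma gauss_poly_deriv p : gauss_poly (p^`()) = gauss_poly (2 *: ('X * p)).
Proof.
suff : gauss_poly (p^`() + (-1) *: (2 *: ('X * p))) = 0.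
  by rewrite gauss_polyD gauss_polyZ mulN1r => /subr0_eq.
apply: (@improper_FTC_T R (fun x => p.[x] * gaussc 1 x)).
- exact: integrable_horner_gaussc.
- move=> x; apply: cvgM; last exact: continuous_gaussc.
  exact: is_derive_continuous (is_derive_horner _ x).
- move=> x.
  apply: (is_derive_eq (is_derive_fM (is_derive_horner p x) (is_derive_gaussc 1 x))).
  by rewrite !(hornerD, hornerZ, hornerM, hornerX); ring.
- by apply: cvg_horner_gaussc => c; exact: cvg_gaussc.
- by apply: cvg_horner_gaussc => c; exact: cvgNy_gaussc.
Qed.

Lemma gauss_poly1 : gauss_poly 1 = Num.sqrt pi.
Proof.
rewrite /gauss_poly /Rintegral.
under eq_integral do rewrite hornerE mul1r /gaussc mul1r.
by rewrite integralT_gauss.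
Qed.

(** The physicists' Hermite polynomials; the recurrence is what one more derivative of [exp(-x^2)]
    does to the polynomial factor, up to sign. *)
Fixpoint hermite_poly n : {poly R} :=
  if n is n'.+1 then 2 *: ('X * hermite_poly n') - (hermite_poly n')^`() else 1.

(** Under the weight, passing from [H_n] to [H_(n+1)] is adjoint to differentiation: [p H_(n+1)]
    equals [p' H_n] plus [2 X q - q'] for [q = p H_n], and the latter integrates to 0. Iteration
    moves all [n] derivatives onto [p]. *)
Lemma gauss_poly_hermite p n :
  gauss_poly (p * hermite_poly n) = gauss_poly p^`(n).
Proof.
elim: n p => [|n IH] p; first by rewrite mulr1 derivn0.
rewrite derivSn -IH /=; set h := hermite_poly n.
rewrite (_ : p * _ = 2 *: ('X * (p * h)) + (-1) *: (p * h)^`() + p^`() * h).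
  rewrite 2!gauss_polyD [X in _ + X + _]gauss_polyZ -[X in X + _ + _]gauss_poly_deriv.
  by rewrite mulN1r subrr add0r.
rewrite derivM mulrBr -scalerAr scaleN1r opprD addrA.
rewrite [p * ('X * h)]mulrCA; ring.
Qed.

Lemma size_hermite_poly n : (size (hermite_poly n) <= n.+1)%N.
Proof.
elim: n => [|n IH] /=; first by rewrite size_poly1.
rewrite (leq_trans (size_polyD _ _))// geq_max size_polyN; apply/andP; split.
  rewrite (leq_trans (size_scale_leq _ _))//.
  by rewrite (leq_trans (size_polyMleq _ _))// size_polyX.
apply/leq_sizeP => j nj; rewrite coef_deriv (leq_sizeP _ _ IH) ?mul0rn//.
by rewrite (leq_trans _ (leqW nj)).
Qed.

Lemma coef_hermite_poly n : (hermite_poly n)`_n = 2 ^+ n.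
Proof.
elim: n => [|n IH] /=; first by rewrite coef1.
rewrite coefB coefZ coefXM/= IH coef_deriv.
by rewrite (leq_sizeP _ _ (size_hermite_poly n))// mul0rn subr0 exprS.
Qed.

(** The larger index differentiates the other polynomial: for equal indices only the leading
    coefficient [2^j] survives, times [j!], and otherwise the degree is too small. *)
Lemma gauss_hermite_orthogonal i j :
  gauss_poly (hermite_poly i * hermite_poly j) =
  if i == j then 2 ^+ i * i`!%:R * Num.sqrt pi else 0.
Proof.
wlog ij : i j / (i <= j)%N.
  move=> H; case/orP: (leq_total i j) => ij; first exact: H.
  by rewrite mulrC H// eq_sym; case: eqP => // ->.
rewrite gauss_poly_hermite; move: ij; rewrite leq_eqVlt => /predU1P[->|ij].
  rewrite eqxx; have -> : (hermite_poly j)^`(j) = (2 ^+ j * j`!%:R) *: 1.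
    apply/polyP => k; rewrite coef_derivn coefZ coef1.
    case: k => [|k]; first by rewrite addn0 coef_hermite_poly ffactnn mulr1 mulr_natr.
    rewrite (leq_sizeP _ _ (size_hermite_poly j)) ?mul0rn ?mulr0//.
    by rewrite addnS ltnS leq_addr.
  by rewrite gauss_polyZ gauss_poly1.
rewrite ltn_eqF// derivn_poly0; last exact: leq_trans (size_hermite_poly i) ij.
by rewrite -(scale0r 0) gauss_polyZ mul0r.
Qed.

End PolynomialGaussian.

(** * Hermite functions: orthonormality and completeness *)

Section HermiteFunctions.
Context {R : realType}.
Notation mu := (@lebesgue_measure R).
Implicit Types (p q : {poly R}) (c x t : R).

Definition hermite_norm n : R := (pi `^ 4^-1 * 2 `^ (n%:R / 2) * Num.sqrt n`!%:R)^-1.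

Lemma hermite_norm_gt0 n : 0 < hermite_norm n.
Proof.
by rewrite invr_gt0 !mulr_gt0// ?powR_gt0 ?pi_gt0 ?sqrtr_gt0 ?ltr0n ?fact_gt0.
Qed.

Lemma hermite_norm_sqr n :
  hermite_norm n ^+ 2 * (2 ^+ n * n`!%:R * Num.sqrt pi) = 1.
Proof.
have e1 : (pi `^ 4^-1) ^+ 2 = Num.sqrt pi :> R.
  rewrite -powR_mulrn ?powR_ge0// -powRrM -powR12_sqrt ?pi_ge0//.
  by congr powR; field.
have e2 : (2 `^ (n%:R / 2)) ^+ 2 = 2 ^+ n :> R.
  rewrite -powR_mulrn ?powR_ge0// -powRrM -powR_mulrn//.
  by congr powR; field.
rewrite /hermite_norm exprVn !exprMn sqr_sqrtr// e1 e2.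
have pi0 : Num.sqrt pi != 0 :> R by rewrite gt_eqF// sqrtr_gt0 pi_gt0.
have f0 : n`!%:R != 0 :> R by rewrite pnatr_eq0 -lt0n fact_gt0.
have t0 : 2 ^+ n != 0 :> R by rewrite expf_neq0.
by field; rewrite pi0 f0 t0.
Qed.

Lemma derive1n_gauss n x : derive1n n (fun y : R => expR (- y ^+ 2)) x =
  (-1) ^+ n * ((hermite_poly n).[x] * gaussc 1 x).
Proof.
elim: n x => [|n IH] x; first by rewrite expr0 mul1r hornerE mul1r /gaussc mul1r.
rewrite derive1nS derive1E (_ : derive1n n _ =
    fun y => (-1) ^+ n * ((hermite_poly n).[y] * gaussc 1 y)); last first.
  exact/funext.
have [_ ->] := is_derive_fZ ((-1) ^+ n) (is_derive_fM
  (is_derive_horner (hermite_poly n) x) (is_derive_gaussc 1 x)).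
rewrite exprS /= !(hornerD, hornerN, hornerZ, hornerM, hornerX); ring.
Qed.

Lemma hermite_funE n x : hermite_fun n x =
  hermite_norm n * ((hermite_poly n).[x] * gaussc 2^-1 x).
Proof.
rewrite /hermite_fun derive1n_gauss -/(hermite_norm n).
have -> : gaussc 2^-1 x = expR (x ^+ 2 / 2) * gaussc 1 x.
  by rewrite /gaussc -expRD; congr expR; field.
have : (-1) ^+ n * (-1) ^+ n = 1 :> R by rewrite -exprMn mulrNN mulr1 expr1n.
set s := (-1) ^+ n => ss.
transitivity (s * s * (hermite_norm n * ((hermite_poly n).[x] *
  (expR (x ^+ 2 / 2) * gaussc 1 x)))); last by rewrite ss mul1r.
by rewrite /hermite_norm; ring.
Qed.

Lemma gaussc_half_sqr x : gaussc 2^-1 x * gaussc 2^-1 x = gaussc 1 x.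
Proof. by rewrite /gaussc -expRD; congr expR; field. Qed.

Lemma sqint_horner_gaussc p : sqint mu (fun x => p.[x] * gaussc 2^-1 x).
Proof.
split.
  by apply: measurable_funM; [exact: measurable_horner|exact: measurable_gaussc].
apply: eq_integrable (integrable_horner_gaussc (p * p) ltr01) => // x _ /=.
by rewrite hornerM -gaussc_half_sqr; congr EFin; ring.
Qed.

Lemma sqint_hermite n : sqint mu (hermite_fun n).
Proof.
rewrite (_ : hermite_fun n = fun x => hermite_norm n *
  ((hermite_poly n).[x] * gaussc 2^-1 x)); last exact/funext/hermite_funE.
exact/sqintZ/sqint_horner_gaussc.
Qed.

Lemma hermite_orthonormal i j :
  \int[mu]_x (hermite_fun i x * hermite_fun j x) = (i == j)%:R.
Proof.
transitivity (hermite_norm i * hermite_norm j *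
    gauss_poly (hermite_poly i * hermite_poly j)).
  rewrite /gauss_poly -RintegralZl//; last exact: integrable_horner_gaussc.
  apply: eq_Rintegral => x _.
  by rewrite !hermite_funE hornerM -gaussc_half_sqr; ring.
rewrite gauss_hermite_orthogonal; case: eqP => [<-|_]; last by rewrite mulr0.
by rewrite -expr2 hermite_norm_sqr.
Qed.

Section Completeness.
Variable r : R -> R.
Hypothesis sr : sqint mu r.
Hypothesis r0 : forall n, \int[mu]_x (r x * hermite_fun n x) = 0.

(** Induction on a bound for the size: subtracting a multiple of a Hermite polynomial removes the
    top coefficient, and the subtracted part is orthogonal to [r] by hypothesis. *)
Lemma hermite_orthogonal_poly p : \int[mu]_x (r x * (p.[x] * gaussc 2^-1 x)) = 0.
Proof.
have [N] := ubnP (size p); elim: N p => // N IH p; rewrite ltnS => pN.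
case: N => [|N] in IH pN *.
  move: pN; rewrite leqn0 size_poly_eq0 => /eqP ->.
  under eq_Rintegral do rewrite horner0 mul0r mulr0.
  by rewrite Rintegral_cst// mul0r.
(* [2^N] is the leading coefficient of [hermite_poly N]. *)
pose c := p`_N / 2 ^+ N; pose q := p - c *: hermite_poly N.
have q0 : \int[mu]_x (r x * (q.[x] * gaussc 2^-1 x)) = 0.
  apply: IH; rewrite ltnS; apply/leq_sizeP => j; rewrite leq_eqVlt => /predU1P[<-|Nj].
    by rewrite coefB coefZ coef_hermite_poly /c divfK ?subrr// expf_neq0.
  rewrite coefB coefZ (leq_sizeP _ _ pN)// (leq_sizeP _ _ (size_hermite_poly N))//.
  by rewrite mulr0 subrr.
transitivity (\int[mu]_x (r x * (q.[x] * gaussc 2^-1 x) +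
    c / hermite_norm N * (r x * hermite_fun N x))).
  apply: eq_Rintegral => x _; rewrite /q hermite_funE hornerD hornerN hornerZ.
  by field; rewrite gt_eqF// hermite_norm_gt0.
rewrite RintegralD//; first by rewrite q0 RintegralZl// ?r0 ?mulr0 ?addr0//;
  apply: sqintM => //; exact: sqint_hermite.
- by apply: sqintM => //; exact: sqint_horner_gaussc.
- by apply: RintegrableZl => //; apply: sqintM => //; exact: sqint_hermite.
Qed.

Lemma sqint_exp_gaussc a : sqint mu (fun x => expR (a * `|x|) * gaussc 2^-1 x).
Proof.
split.
  apply: measurable_funM; last exact: measurable_gaussc.
  by apply: measurableT_comp => //; apply: measurable_funM.
apply: eq_integrable (integrable_exp_gaussc (2 * a) ltr01) => // x _ /=.
rewrite -gaussc_half_sqr -mulrA mulr_natl -[_ *+ 2]/(_ + _) expRD.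
by congr EFin; ring.
Qed.

(* trigonometric factors are limits of their Taylor polynomials, dominated by
   an exponential *)
Lemma hermite_orthogonal_series (f : R -> R) (a : nat -> R) t :
  (forall n, `|a n| <= 1) ->
  (forall x, series (fun n => a n * (t * x) ^+ n / n`!%:R) n @[n --> \oo] --> f x) ->
  \int[mu]_x (r x * gaussc 2^-1 x * f x) = 0.
Proof.
move=> a1 sf.
have mr : measurable_fun [set: measurableTypeR R] r by case: sr.
pose q n : {poly R} := \poly_(k < n) (a k * t ^+ k / k`!%:R).
have qE n x : (q n).[x] = series (fun n => a n * (t * x) ^+ n / n`!%:R) n.
  rewrite horner_poly /series/= big_mkord; apply: eq_bigr => k _.
  by rewrite exprMn; ring.
have qle n x : `|(q n).[x]| <= expR (`|t| * `|x|).
  rewrite qE /series/= (le_trans (ler_norm_sum _ _ _))//.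
  apply: (@le_trans _ _ (series (exp_coeff (`|t| * `|x|)) n)).
    apply: ler_sum => k _; rewrite /exp_coeff/= !normrM normfV normrX normrM.
    rewrite [X in _ / X]ger0_norm// ler_wpM2r ?invr_ge0// ler_piMl//.
  apply: nondecreasing_cvgn_le; last exact: is_cvg_series_exp_coeff.
  by apply: nondecreasing_series => k _ _; apply: exp_coeff_ge0; rewrite mulr_ge0.
have [||||_] := @Rdominated_cvg _ _ _ mu setT measurableT
  (fun n x => r x * ((q n).[x] * gaussc 2^-1 x))
  (fun x => r x * (f x * gaussc 2^-1 x))
  (fun x => `|r x * (expR (`|t| * `|x|) * gaussc 2^-1 x)|).
- move=> n; apply: measurable_funM => //.
  by apply: measurable_funM; [exact: measurable_horner|exact: measurable_gaussc].
- move=> x _; apply: cvgM; first exact: cvg_cst.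
  by apply: cvgM; [under eq_fun do rewrite qE; exact: sf|exact: cvg_cst].
- move=> n x _; rewrite !normrM ler_wpM2l// ler_wpM2r//.
  by rewrite (ger0_norm (expR_ge0 _)).
- apply: integrable_norm; apply: sqintM => //; exact: sqint_exp_gaussc.
under eq_fun do rewrite hermite_orthogonal_poly.
move=> H; have := cvg_unique _ H (cvg_cst 0) => /(_ (@Rhausdorff R)) E.
by rewrite -E; apply: eq_Rintegral => x _; ring.
Qed.

(** [r gaussc 2^-1] is integrable, as a product of two square-integrable functions, and its Fourier
    transform vanishes by the series argument; so it is 0 almost everywhere, and the Gaussian factor
    has no zero. *)
Lemma hermite_complete : \int[mu]_x (r x ^+ 2) = 0.
Proof.
have mr : measurable_fun [set: measurableTypeR R] r by case: sr.
have sg : sqint mu (gaussc 2^-1).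
  have := sqint_horner_gaussc 1.
  by under eq_fun do rewrite hornerE mul1r.
have H := fourier_eq0_ae (sqintM sr sg).
have {}H : {ae mu, forall x, r x * gaussc 2^-1 x = 0}.
  apply: H => t.
    apply: (hermite_orthogonal_series (a := fun n => (~~ odd n)%:R * (-1) ^+ n./2)
      (t := t)) => [n|x].
      rewrite normrM normrX normrN1 expr1n mulr1.
      by case: (odd n); rewrite ?normr0 ?normr1.
    rewrite unlock; exact: is_cvg_series_cos_coeff.
  apply: (hermite_orthogonal_series (a := fun n => (odd n)%:R * (-1) ^+ n.-1./2)
    (t := t)) => [n|x].
    rewrite normrM normrX normrN1 expr1n mulr1.
    by case: (odd n); rewrite ?normr0 ?normr1.
  rewrite unlock; exact: is_cvg_series_sin_coeff.
rewrite /Rintegral (ae_eq_integral (cst 0%E))//.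
- by rewrite integral0.
- by apply/measurable_EFinP; exact: measurable_funX.
- have [N [mN N0 sN]] := H; exists N; split => // x /= nx; apply: sN => /= /eqP.
  rewrite mulf_eq0 (gt_eqF (gaussc_gt0 _ _)) orbF => /eqP rx.
  by apply: nx => _; rewrite rx expr0n.
Qed.

End Completeness.

Lemma hermite_parseval f : sqint mu f ->
  energy mu (@hermite_fun R) f N @[N --> \oo] --> \int[mu]_x (f x ^+ 2).
Proof.
apply: parseval.
- exact: sqint_hermite.
- exact: hermite_orthonormal.
- move=> r sr r0; exact: hermite_complete sr r0.
Qed.

End HermiteFunctions.

(** * The value of V_H *)

Section ImproperGamma.
Context {R : realType}.
Notation mu := (@lebesgue_measure R).
Implicit Types (p y u : R).
Local Notation Rpos := (`]0, +oo[%classic : set R).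

Lemma Rpos_gt0 u : Rpos u -> 0 < u. Proof. by rewrite /= in_itv/= andbT. Qed.

Lemma measurable_Rpos (f : R -> R) :
  (forall u, 0 < u -> {for u, continuous f}) ->
  measurable_fun (Rpos : set (measurableTypeR R)) f.
Proof.
move=> cf; apply: open_continuous_measurable_fun; first exact: interval_open.
by move=> u /set_mem/Rpos_gt0; exact: cf.
Qed.

(** Integrability needs a source other than [improper_FTC], which presupposes it. Here it comes from
    Fatou's lemma on the truncations to [[1/(n+2), n+2]], whose integrals are increments of [F] and
    so at most [M]. *)
Lemma ge0_integrable_bounded_primitive (F f : R -> R) (M : R) :
  (forall u, 0 < u -> {for u, continuous f}) -> (forall u, 0 < u -> 0 <= f u) ->
  (forall u, 0 < u -> is_derive u 1 F (f u)) ->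
  (forall u, 0 < u -> 0 <= F u <= M) ->
  mu.-integrable Rpos (EFin \o f).
Proof.
move=> cf f0 dF FM.
have mf := measurable_Rpos cf.
apply/integrableP; split; first exact/measurable_EFinP.
pose I n : set R := `[(n + 2)%:R^-1, (n + 2)%:R]%classic.
have n20 n : 0 < (n + 2)%:R :> R by rewrite ltr0n addn2.
have IR n : I n `<=` Rpos.
  move=> u; rewrite /I/= !in_itv/= andbT => /andP[+ _]; apply: lt_le_trans.
  by rewrite invr_gt0.
pose g n u := ((f \_ (I n)) u)%:E.
have mg n : measurable_fun (Rpos : set (measurableTypeR R)) (g n).
  apply/measurable_EFinP; apply/(measurable_restrict _ _ _).1 => //.
    exact: measurable_itv.
  by apply: measurable_funS mf; [exact: measurable_itv|exact: subIsetl].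
have g0 n u : Rpos u -> (0 <= g n u)%E.
  by move=> /Rpos_gt0 u0; rewrite lee_fin patchE; case: ifPn => // _; exact: f0.
have := fatou mu (measurable_itv `]0, +oo[) mg g0.
have -> : (\int[mu]_(u in Rpos) limn_einf (g ^~ u) = \int[mu]_(u in Rpos) `|(f u)%:E|)%E.
  apply: eq_integral => u /set_mem/Rpos_gt0 u0.
  rewrite gee0_abs ?lee_fin ?f0//.
  have cg : g n u @[n --> \oo] --> (f u)%:E.
    apply: cvg_near_cst; near=> n; rewrite /g patchE ifT//.
    rewrite inE /I/= in_itv/=; apply/andP; split.
      rewrite invf_ple ?posrE//.
      by near: n; move: (@cvgr_idn_addn R 2) => /cvgryPge; exact.
    by near: n; move: (@cvgr_idn_addn R 2) => /cvgryPge; exact.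
  by rewrite (cvg_limn_einf_sup cg).1.
move=> /le_lt_trans; apply.
have intg n : (\int[mu]_(u in Rpos) g n u <= M%:E)%E.
  have ab : (n + 2)%:R^-1 < (n + 2)%:R :> R.
    by rewrite (@lt_trans _ _ 1)// ?invf_lt1//; rewrite ltr1n addn2.
  have -> : (\int[mu]_(u in Rpos) g n u = \int[mu]_(u in I n) (f u)%:E)%E.
    rewrite -[in RHS](setIidr (@IR n)) integral_mkcondr.
    by apply: eq_integral => u _; rewrite /g restrict_EFin.
  have pos u : u \in `[(n + 2)%:R^-1, (n + 2)%:R] -> 0 < u.
    by move=> uI; apply: Rpos_gt0; exact: (@IR n).
  have cF u : u \in `[(n + 2)%:R^-1, (n + 2)%:R] -> {for u, continuous F}.
    by move=> /pos u0; exact: is_derive_continuous (dF u u0).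
  rewrite (@continuous_FTC2 _ f F)//.
  - rewrite -EFinB lee_fin.
    have /andP[_ h1] := FM _ (n20 n).
    have /andP[h2 _] : 0 <= F ((n + 2)%:R^-1) <= M by apply: FM; rewrite invr_gt0.
    lra.
  - by apply: continuous_in_subspaceT => u /set_mem uI; apply: cf; exact: pos.
  - split=> [u uI||].
    + by have [] := dF u (pos u (subset_itv_oo_cc uI)).
    + by apply: cvg_at_right_filter; apply: cF; rewrite in_itv/= lexx ltW.
    + by apply: cvg_at_left_filter; apply: cF; rewrite in_itv/= lexx ltW.
  - move=> u uI; rewrite derive1E.
    by have [] := dF u (pos u (subset_itv_oo_cc uI)).
apply: (@le_lt_trans _ _ M%:E); last exact: ltry.
rewrite limn_einf_lim; apply: lime_le; first exact: is_cvg_einfs.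
apply: nearW => n; apply: le_trans (intg n).
by apply: ereal_inf_lbound; exists n => //=.
Unshelve. all: by end_near. Qed.

(** This is [u / p <= exp(u / p)] raised to the power [p]. *)
Lemma powR_le_expR p u : 0 < p -> 0 <= u -> u `^ p <= p `^ p * expR u.
Proof.
move=> p0 u0; have -> : expR u = expR (u / p) `^ p.
  by rewrite -expRM divfK// gt_eqF.
rewrite -powRM ?expR_ge0 ?(ltW p0)// ge0_ler_powR ?nnegrE ?mulr_ge0 ?expR_ge0 ?(ltW p0)//.
rewrite mulrC -ler_pdivrMr//; apply: le_trans (expR_ge1Dx _).
by rewrite lerDr.
Qed.

Lemma is_derive_powR p u : 0 < u ->
  is_derive u 1 (fun x : R => x `^ p) (p * u `^ p / u).
Proof.
move=> u0; apply: (is_derive_eq (is_derive1_powR p u0)).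
have E : u `^ (p - 1 + 1) = u `^ (p - 1) * u `^ 1.
  by rewrite powRD// (gt_eqF u0) implybT.
rewrite subrK powRr1 ?(ltW u0)// in E.
by rewrite E mulrA mulfK// gt_eqF.
Qed.

Lemma continuous_powR p u : 0 < u -> {for u, continuous (fun x : R => x `^ p)}.
Proof. by move=> u0; exact: is_derive_continuous (is_derive_powR p u0). Qed.

Lemma is_derive_expRN u : is_derive u 1 (fun x : R => expR (- x)) (- expR (- u)).
Proof.
apply: (is_derive_eq (is_derive_fcomp (is_derive_expR _)
  (is_derive_fN (is_derive_id u 1)))).
by rewrite mulrN1.
Qed.

(** The majorant is a multiple of the derivative of [(u / (1 + u))^(p + 1)], a primitive with values
    in [[0, 1]]: it behaves like [u^p] at 0, where [p] may be negative, and decays like [u^-2] at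
    infinity. *)
Lemma integrable_powR_expR p : -1 < p ->
  mu.-integrable Rpos (EFin \o (fun u => u `^ p * expR (- u))).
Proof.
move=> p1; pose b := p + 1; have b0 : 0 < b by rewrite /b; lra.
have u1 u : 0 < u -> 0 < 1 + u by move=> ?; lra.
have dq u : 0 < u -> is_derive u 1 (fun x : R => x / (1 + x)) ((1 + u) ^- 2).
  move=> u0; have n0 : 1 + u != 0 by rewrite gt_eqF// u1.
  apply: (is_derive_eq (is_derive_fM (is_derive_id u 1)
    (is_derive_fV n0 (is_derive_1D u)))).
  by field.
have q0 u : 0 < u -> 0 < u / (1 + u) by move=> u0; rewrite divr_gt0// u1.
have dqp r u (u0 : 0 < u) : is_derive u 1 (fun x : R => (x / (1 + x)) `^ r)
    (r * (u / (1 + u)) `^ r / (u / (1 + u)) * (1 + u) ^- 2).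
  exact: (@is_derive_fcomp R (fun x => x `^ r) (fun x => x / (1 + x)) u _ _
    (is_derive_powR r (q0 u u0)) (dq u u0)).
pose f u := b * (u / (1 + u)) `^ p * (1 + u) ^- 2.
have fi : mu.-integrable Rpos (EFin \o f).
  apply: (@ge0_integrable_bounded_primitive (fun u => (u / (1 + u)) `^ b) _ 1).
  - move=> u u0; apply: cvgM; last first.
      apply: cvgV; first by rewrite expf_neq0// gt_eqF// u1.
      by apply: cvgM; apply: cvgD; [exact: cvg_cst|exact: cvg_id|exact: cvg_cst|exact: cvg_id].
    apply: cvgM; first exact: cvg_cst.
    exact: is_derive_continuous (dqp p u u0).
  - move=> u u0; rewrite /f !mulr_ge0 ?powR_ge0 ?(ltW b0)// invr_ge0.
    exact: sqr_ge0.
  - move=> u u0; apply: (is_derive_eq (dqp b u u0)).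
    rewrite /f /b powRD ?powRr1 ?(ltW (q0 u u0))//; last by rewrite (gt_eqF (q0 u u0)) implybT.
    by rewrite -/b; field; rewrite !gt_eqF ?u1.
  - move=> u u0; rewrite powR_ge0/=; apply: (@le_trans _ _ (1 `^ b)); last by rewrite powR1.
    rewrite ge0_ler_powR ?nnegrE ?(ltW b0) ?(ltW (q0 u u0))//.
    by rewrite ler_pdivrMr ?u1// mul1r lerDr.
have cle : forall u, Rpos u -> `|u `^ p * expR (- u)| <= b^-1 * (b + 1) `^ (b + 1) * expR 1 * f u.
  move=> u /Rpos_gt0 u0; rewrite ger0_norm ?mulr_ge0 ?powR_ge0 ?expR_ge0//.
  have E : u `^ p = (u / (1 + u)) `^ p * (1 + u) `^ p.
    rewrite -powRM ?divfK ?gt_eqF ?u1//; first by rewrite ltW// q0.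
    by rewrite ltW// u1.
  (* The exponent [p + 2 = b + 1] is positive, so [powR_le_expR] at [1 + u] bounds [(1 + u)^(p + 2)]
     by [(b + 1)^(b + 1) exp(1 + u)]. *)
  have H : (1 + u) `^ p * expR (- u) <= (b + 1) `^ (b + 1) * expR 1 * (1 + u) ^- 2.
    rewrite -[leRHS]mulrC ler_pdivlMl ?exprn_gt0 ?u1//.
    rewrite -powR_mulrn ?(ltW (u1 u u0))// mulrA -powRD; last by rewrite (gt_eqF (u1 u u0)) implybT.
    have -> : 2 + p = b + 1 by rewrite /b; lra.
    rewrite expRN ler_pdivrMr ?expR_gt0// -mulrA -expRD.
    by apply: powR_le_expR; [lra|rewrite ltW// u1].
  rewrite E -mulrA; apply: (le_trans (ler_wpM2l (powR_ge0 _ _) H)).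
  by rewrite /f le_eqVlt; apply/orP; left; apply/eqP; field; rewrite !gt_eqF ?u1.
apply: (@le_Rintegrable _ _ _ mu Rpos _ _
  (fun u => b^-1 * (b + 1) `^ (b + 1) * expR 1 * f u) _ cle).
- exact: measurable_itv.
-
  apply: measurable_Rpos => u u0; apply: cvgM; first exact: continuous_powR.
  exact: is_derive_continuous (is_derive_expRN u).
- by apply: RintegrableZl => //; exact: measurable_itv.
Qed.

End ImproperGamma.

Lemma cvg0_le_norm_near (R : realType) (T : Type) (F : set_system T) {FF : Filter F}
  (f g : T -> R) : (\forall x \near F, `|f x| <= g x) -> g x @[x --> F] --> 0 ->
  f x @[x --> F] --> 0.
Proof.
move=> fg g0; apply: (@squeeze_cvgr _ _ _ _ (fun x => - g x) g) => //.
  by apply: filterS fg => x; rewrite -ler_norml.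
by rewrite -oppr0; exact: cvgN.
Qed.

(** * Laplace transforms of powers times cosines and sines *)

Section LaplaceTransforms.
Context {R : realType}.
Notation mu := (@lebesgue_measure R).
Implicit Types (p y u x : R).
Local Notation Rpos := (`]0, +oo[%classic : set R).

Lemma normr_sin_le x : `|sin x| <= `|x|.
Proof.
wlog x0 : x / 0 <= x.
  move=> H; case: (leP 0 x) => [|x0]; first exact: H.
  by rewrite -(normrN x) -(normrN (sin x)) -sinN; apply: H; rewrite oppr_ge0 ltW.
have [|c _] := @MVT_segment R sin cos 0 x x0 (fun z _ => is_derive_sin z).
  by apply: continuous_subspaceT; exact: continuous_sin.
rewrite sin0 !subr0 => ->.
by rewrite normrM ler_piMl// cos_max.
Qed.

Lemma subr_cos_ge0 x : 0 <= 1 - cos x. Proof. by rewrite subr_ge0 cos_le1. Qed.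

Lemma subr_cos_le x : 1 - cos x <= x ^+ 2 / 2.
Proof.
have -> : cos x = 1 - 2 * sin (x / 2) ^+ 2.
  rewrite [in LHS](_ : x = x / 2 + x / 2); last by field.
  rewrite cosD -!expr2; have := cos2Dsin2 (x / 2); lra.
have : sin (x / 2) ^+ 2 <= (x / 2) ^+ 2.
  rewrite -(real_normK (num_real (sin _))) -(real_normK (num_real (x / 2))).
  by apply: lerXn2r; rewrite ?nnegrE// normr_sin_le.
have -> : (x / 2) ^+ 2 = x ^+ 2 / 4 by field.
lra.
Qed.

(** In [1 - cos x = 2 sin(x/2)^2] one factor is bounded by 1 and the other by [|x|/2]. *)
Lemma subr_cos_le_norm x : 1 - cos x <= `|x|.
Proof.
have -> : cos x = 1 - 2 * sin (x / 2) ^+ 2.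
  rewrite [in LHS](_ : x = x / 2 + x / 2); last by field.
  rewrite cosD -!expr2; have := cos2Dsin2 (x / 2); lra.
rewrite -(real_normK (num_real (sin _))) expr2.
have s1 := sin_max (x / 2); have := normr_sin_le (x / 2).
rewrite normrM [`|2^-1|]ger0_norm// => s2.
have : `|sin (x / 2)| * `|sin (x / 2)| <= `|sin (x / 2)| by rewrite ler_piMl.
lra.
Qed.

Lemma cvgy_powR_expR p : u `^ p * expR (- u) @[u --> +oo] --> 0.
Proof.
(* A positive exponent above [p]; the power [u^q] then uses up half of the exponential. *)
pose q := `|p| + 1; have q0 : 0 < q by rewrite ltr_pwDr.
apply: (@cvg0_le_norm_near _ _ _ _ _
  (fun u => 2 `^ q * q `^ q * expR (- (2^-1 * u)))); last first.
  rewrite -(mulr0 (2 `^ q * q `^ q)); apply: cvgM; first exact: cvg_cst.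
  apply: (@cvg_comp _ _ _ (fun u => 2^-1 * u) (fun u => expR (- u)) _ (pinfty_nbhs R)).
    by apply: gt0_cvgMry; [rewrite invr_gt0|exact: cvg_id].
  exact: cvgr_expR.
near=> u.
have u1 : 1 <= u by near: u; exact: nbhs_pinfty_ge.
have u0 : 0 <= u by lra.
rewrite ger0_norm ?mulr_ge0 ?powR_ge0 ?expR_ge0//.
have -> : expR (- (2^-1 * u)) = expR (u / 2) * expR (- u).
  by rewrite -expRD; congr expR; field.
rewrite mulrA ler_wpM2r ?expR_ge0//.
apply: (@le_trans _ _ (u `^ q)).
  by rewrite ler_powR// /q (le_trans (ler_norm _))// lerDl.
have -> : u `^ q = 2 `^ q * (u / 2) `^ q.
  rewrite -powRM//; last by rewrite divr_ge0.
  by congr powR; field.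
rewrite -mulrA ler_wpM2l ?powR_ge0// powR_le_expR// divr_ge0//.
Unshelve. all: by end_near. Qed.

(** Real part of the Laplace transform of [u^p] at [1 - iy]; [laplace_sin] is the imaginary part. *)
Definition laplace_cos p y := \int[mu]_(u in Rpos) (u `^ p * expR (- u) * cos (y * u)).
Definition laplace_sin p y := \int[mu]_(u in Rpos) (u `^ p * expR (- u) * sin (y * u)).

Lemma continuous_powR_expR p u : 0 < u ->
  {for u, continuous (fun x : R => x `^ p * expR (- x))}.
Proof.
move=> u0; apply: cvgM; first exact: continuous_powR.
exact: is_derive_continuous (is_derive_expRN u).
Qed.

Lemma integrable_powR_expRM p (h : R -> R) (C : R) : -1 < p ->
  (forall u, 0 < u -> {for u, continuous h}) ->
  (forall u, 0 < u -> `|h u| <= C) ->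
  mu.-integrable Rpos (EFin \o (fun u => u `^ p * expR (- u) * h u)).
Proof.
move=> p1 ch hC.
apply: (@le_Rintegrable _ _ _ mu Rpos _ _ (fun u => C * (u `^ p * expR (- u)))).
- exact: measurable_itv.
- apply: measurable_Rpos => u u0; apply: cvgM; last exact: ch.
  exact: continuous_powR_expR.
- move=> u /Rpos_gt0 u0; have w0 : 0 <= u `^ p * expR (- u).
    by rewrite mulr_ge0 ?powR_ge0 ?expR_ge0.
  by rewrite normrM (ger0_norm w0) [leLHS]mulrC ler_wpM2r// hC.
- by apply: RintegrableZl; [exact: measurable_itv|exact: integrable_powR_expR].
Qed.

Lemma integrable_laplace_cos p y : -1 < p ->
  mu.-integrable Rpos (EFin \o (fun u => u `^ p * expR (- u) * cos (y * u))).
Proof.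
move=> p1; apply: (integrable_powR_expRM (C := 1)) => // u _.
  exact: continuous_cosZ.
exact: cos_max.
Qed.

Lemma integrable_laplace_sin p y : -1 < p ->
  mu.-integrable Rpos (EFin \o (fun u => u `^ p * expR (- u) * sin (y * u))).
Proof.
move=> p1; apply: (integrable_powR_expRM (C := 1)) => // u _.
  exact: continuous_sinZ.
exact: sin_max.
Qed.

Lemma powRS p u : 0 < u -> u `^ (p + 1) = u * u `^ p.
Proof.
move=> u0; rewrite powRD ?powRr1 ?(ltW u0) 1?mulrC//.
by rewrite (gt_eqF u0) implybT.
Qed.

Lemma is_derive_laplace_cos p y : -1 < p ->
  is_derive y 1 (laplace_cos p) (- laplace_sin (p + 1) y).
Proof.
move=> p1; have p2 : -1 < p + 1 by lra.
have := @is_derive_under_integral R _ _ mu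
  (fun y u => u `^ p * expR (- u) * cos (y * u))
  (fun y u => - (u `^ (p + 1) * expR (- u) * sin (y * u))) Rpos y (y - 1) (y + 1)
  (fun u => u `^ (p + 1) * expR (- u)) (measurable_itv _).
rewrite gtrBl ltrDl ltr01 => /(_ isT) H.
have {}H := H (fun v _ => integrable_laplace_cos v p1).
apply: (is_derive_eq (H _ _ _ _)).
- move=> v u _ /Rpos_gt0 u0; rewrite powRS//.
  have := is_derive_fZ (u `^ p * expR (- u)) (is_derive_cosZ u v).
  under eq_fun do rewrite [u * _]mulrC.
  by move=> D; apply: (is_derive_eq D); rewrite [v * u]mulrC; ring.
- by move=> u; rewrite mulr_ge0 ?powR_ge0 ?expR_ge0.
- exact: integrable_powR_expR.
- move=> v u _ _; rewrite normrN normrM ger0_norm ?mulr_ge0 ?powR_ge0 ?expR_ge0//.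
  by rewrite ler_piMr ?sin_max// mulr_ge0 ?powR_ge0 ?expR_ge0.
under eq_Rintegral do rewrite -mulN1r.
by rewrite RintegralZl ?mulN1r//; exact: integrable_laplace_sin.
Qed.

Lemma is_derive_laplace_sin p y : -1 < p ->
  is_derive y 1 (laplace_sin p) (laplace_cos (p + 1) y).
Proof.
move=> p1; have p2 : -1 < p + 1 by lra.
have := @is_derive_under_integral R _ _ mu
  (fun y u => u `^ p * expR (- u) * sin (y * u))
  (fun y u => u `^ (p + 1) * expR (- u) * cos (y * u)) Rpos y (y - 1) (y + 1)
  (fun u => u `^ (p + 1) * expR (- u)) (measurable_itv _).
rewrite gtrBl ltrDl ltr01 => /(_ isT) H.
have {}H := H (fun v _ => integrable_laplace_sin v p1).
apply: H.
- move=> v u _ /Rpos_gt0 u0; rewrite powRS//.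
  have := is_derive_fZ (u `^ p * expR (- u)) (is_derive_sinZ u v).
  under eq_fun do rewrite [u * _]mulrC.
  by move=> D; apply: (is_derive_eq D); rewrite [v * u]mulrC; ring.
- by move=> u; rewrite mulr_ge0 ?powR_ge0 ?expR_ge0.
- exact: integrable_powR_expR.
- move=> v u _ _; rewrite normrM ger0_norm ?mulr_ge0 ?powR_ge0 ?expR_ge0//.
  by rewrite ler_piMr ?cos_max// mulr_ge0 ?powR_ge0 ?expR_ge0.
Qed.

(* integration by parts against [u `^ (p + 1) * expR (- u)], which vanishes at
   both ends of the half-line *)
Lemma laplace_by_parts p (h dh : R -> R) (C D : R) : -1 < p ->
  continuous h -> continuous dh -> (forall u, is_derive u 1 h (dh u)) ->
  (forall u, `|h u| <= C) -> (forall u, `|dh u| <= D) ->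
  (p + 1) * \int[mu]_(u in Rpos) (u `^ p * expR (- u) * h u) =
  \int[mu]_(u in Rpos) (u `^ (p + 1) * expR (- u) * (h u - dh u)).
Proof.
move=> p1 ch cdh hd hC dhD; have p2 : -1 < p + 1 by lra.
have mR := measurable_itv `]0, +oo[ : measurable (Rpos : set (measurableTypeR R)).
have i1 := integrable_powR_expRM p1 (fun u _ => ch u) (fun u _ => hC u).
have i2 := integrable_powR_expRM p2 (fun u _ => ch u) (fun u _ => hC u).
have i3 := integrable_powR_expRM p2 (fun u _ => cdh u) (fun u _ => dhD u).
rewrite -RintegralZl//.
rewrite (_ : \int[mu]_(u in Rpos) (u `^ (p + 1) * expR (- u) * (h u - dh u)) =
  \int[mu]_(u in Rpos) (u `^ (p + 1) * expR (- u) * h u) -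
  \int[mu]_(u in Rpos) (u `^ (p + 1) * expR (- u) * dh u)); last first.
  rewrite -RintegralB//; by apply: eq_Rintegral => u _; rewrite mulrBr.
pose F u := u `^ (p + 1) * expR (- u) * h u.
have FC (G : set_system R) (FG : Filter G) :
    u `^ (p + 1) * expR (- u) @[u --> G] --> 0 -> F u @[u --> G] --> 0.
  move=> H; apply: (@cvg0_le_norm _ _ _ _ _ (fun u => C * (u `^ (p + 1) * expR (- u)))).
    move=> u; have w0 : 0 <= u `^ (p + 1) * expR (- u).
      by rewrite mulr_ge0 ?powR_ge0 ?expR_ge0.
    by rewrite normrM (ger0_norm w0) [leLHS]mulrC ler_wpM2r.
  by have := cvgM (cvg_cst C) H; rewrite mulr0; exact.
have i5 := RintegrableB mR (RintegrableZl mR (p + 1) i1) i2.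
have i4 := RintegrableD mR i5 i3.
have E := RintegralD mR i5 i3.
rewrite (RintegralB mR (RintegrableZl mR (p + 1) i1) i2) in E.
suff Z : \int[mu]_(x in Rpos) ((p + 1) * (x `^ p * expR (- x) * h x) -
    x `^ (p + 1) * expR (- x) * h x + x `^ (p + 1) * expR (- x) * dh x) = 0.
  by rewrite Z in E; lra.
apply: (etrans (y := 0 - 0)); last by rewrite subrr.
apply: (improper_FTC_0y (F := F)) => //.
- move=> u u0; apply: cvgD; last first.
    by apply: cvgM; [exact: continuous_powR_expR|exact: cdh].
  apply: cvgB.
    apply: cvgM; first exact: cvg_cst.
    by apply: cvgM; [exact: continuous_powR_expR|exact: ch].
  by apply: cvgM; [exact: continuous_powR_expR|exact: ch].
- move=> u u0.
  apply: (is_derive_eq (is_derive_fM (is_derive_fM (is_derive_powR (p + 1) u0)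
    (is_derive_expRN u)) (hd u))).
  by rewrite powRS//; field; rewrite gt_eqF.
- apply: FC.
  have c1 : u `^ (p + 1) @[u --> 0^'+] --> (0 : R) by apply: powR_cvg0; lra.
  have c2 : expR (- u) @[u --> 0^'+] --> expR (- (0 : R)).
    apply: cvg_at_right_filter.
    exact: is_derive_continuous (is_derive_expRN 0).
  by have := cvgM c1 c2; rewrite mul0r; exact.
- by apply: FC; exact: cvgy_powR_expR.
Qed.

Lemma laplace_cos_by_parts p y : -1 < p ->
  (p + 1) * laplace_cos p y = laplace_cos (p + 1) y + y * laplace_sin (p + 1) y.
Proof.
move=> p1; have p2 : -1 < p + 1 by lra.
rewrite /laplace_cos (@laplace_by_parts p (fun u => cos (y * u))
  (fun u => - sin (y * u) * y) 1 `|y| p1 (@continuous_cosZ R y) _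
  (is_derive_cosZ y) (fun u => cos_max _) _)//.
- rewrite /laplace_sin -RintegralZl; [|exact: measurable_itv|exact: integrable_laplace_sin].
  rewrite -RintegralD; [|exact: measurable_itv|exact: integrable_laplace_cos|].
    by apply: eq_Rintegral => u _; ring.
  by apply: RintegrableZl; [exact: measurable_itv|exact: integrable_laplace_sin].
- move=> u; apply: cvgM; last exact: cvg_cst.
  by apply: cvgN; exact: continuous_sinZ.
- by move=> u; rewrite normrM normrN ler_piMl// sin_max.
Qed.

Lemma laplace_sin_by_parts p y : -1 < p ->
  (p + 1) * laplace_sin p y = laplace_sin (p + 1) y - y * laplace_cos (p + 1) y.
Proof.
move=> p1; have p2 : -1 < p + 1 by lra.
rewrite /laplace_sin (@laplace_by_parts p (fun u => sin (y * u))
  (fun u => cos (y * u) * y) 1 `|y| p1 (@continuous_sinZ R y) _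
  (is_derive_sinZ y) (fun u => sin_max _) _)//.
- rewrite /laplace_cos -RintegralZl; [|exact: measurable_itv|exact: integrable_laplace_cos].
  rewrite -RintegralB; [|exact: measurable_itv|exact: integrable_laplace_sin|].
    by apply: eq_Rintegral => u _; ring.
  by apply: RintegrableZl; [exact: measurable_itv|exact: integrable_laplace_cos].
- move=> u; apply: cvgM; last exact: cvg_cst.
  exact: continuous_cosZ.
- by move=> u; rewrite normrM ler_piMl// cos_max.
Qed.

End LaplaceTransforms.

Section LaplaceClosedForms.
Context {R : realType}.
Notation mu := (@lebesgue_measure R).
Implicit Types (p y u x a : R).
Local Notation Rpos := (`]0, +oo[%classic : set R).

Let mR : measurable (Rpos : set (measurableTypeR R)).
Proof. exact: measurable_itv. Qed.

Lemma laplace_cos0 p : laplace_cos p 0 = Gamma (p + 1).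
Proof.
by apply: eq_Rintegral => u _; rewrite mul0r cos0 mulr1 addrK.
Qed.

Lemma laplace_sin0 p : laplace_sin p (0 : R) = 0.
Proof.
rewrite /laplace_sin; under eq_Rintegral do rewrite mul0r sin0 mulr0.
by rewrite Rintegral_mkcond/= (_ : _ \_ _ = cst 0) ?Rintegral_cst ?mul0r//;
  apply/funext => x; rewrite patchE; case: ifP.
Qed.

Lemma onepsqr_gt0 y : 0 < 1 + y ^+ 2.
Proof. by rewrite ltr_pwDl// sqr_ge0. Qed.

Lemma is_derive_onepsqr y : is_derive y 1 (fun x : R => 1 + x ^+ 2) (2 * y).
Proof.
apply: (is_derive_eq (is_derive_fD (is_derive_cst (1 : R) y 1)
  (is_derive_fX 2 (is_derive_id y 1)))).
by rewrite add0r mulr1 expr1.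
Qed.

(* Real and imaginary parts of the identity
   [\int u^p e^(-u + iyu) du = Gamma (p + 1) (1 - iy)^-(p + 1)]: both sides solve
   the same linear differential equation in [y]. *)
Section ClosedForm.
Variable p : R.
Hypothesis p1 : -1 < p.
Let b := p + 1.
Let psi y := b * atan y.
Let E y := (1 + y ^+ 2) `^ (b / 2).

Let dE y : is_derive y 1 E (b * y * E y / (1 + y ^+ 2)).
Proof.
apply: (is_derive_eq (@is_derive_fcomp R (fun x => x `^ (b / 2))
  (fun x => 1 + x ^+ 2) y _ _ (is_derive_powR _ (onepsqr_gt0 y)) (is_derive_onepsqr y))).
by rewrite /E; field; rewrite gt_eqF// onepsqr_gt0.
Qed.

Let dpsi y : is_derive y 1 psi (b / (1 + y ^+ 2)).
Proof. exact: (is_derive_fZ b (is_derive1_atan y)). Qed.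

Let dcos y : is_derive y 1 (fun y => cos (psi y)) (- sin (psi y) * (b / (1 + y ^+ 2))).
Proof. exact: is_derive_fcomp. Qed.

Let dsin y : is_derive y 1 (fun y => sin (psi y)) (cos (psi y) * (b / (1 + y ^+ 2))).
Proof. exact: is_derive_fcomp. Qed.

(** The two relations by parts form a linear system for the transforms of exponent [p + 1], with
    determinant [1 + y^2]. *)
Let sinE y : laplace_sin (p + 1) y =
  b * (laplace_sin p y + y * laplace_cos p y) / (1 + y ^+ 2).
Proof.
have := laplace_cos_by_parts y p1; have := laplace_sin_by_parts y p1.
rewrite -/b => H1 H2; rewrite mulrDr mulrCA H1 H2.
by field; rewrite gt_eqF// onepsqr_gt0.
Qed.

Let cosE y : laplace_cos (p + 1) y =
  b * (laplace_cos p y - y * laplace_sin p y) / (1 + y ^+ 2).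
Proof.
have := laplace_cos_by_parts y p1; have := laplace_sin_by_parts y p1.
rewrite -/b => H1 H2; rewrite mulrBr mulrCA H1 H2.
by field; rewrite gt_eqF// onepsqr_gt0.
Qed.

(** Real part, and minus the imaginary part, of the transform multiplied by [(1 - iy)^b], a number
    of modulus [E y] and argument [- psi y]. Both have derivative 0 by [sinE] and [cosE], so they
    keep their values at [y = 0]. *)
Let rotation y :
  (laplace_cos p y * cos (psi y) + laplace_sin p y * sin (psi y)) * E y = Gamma b /\
  (laplace_cos p y * sin (psi y) - laplace_sin p y * cos (psi y)) * E y = 0.
Proof.
have psi0 : psi 0 = 0 by rewrite /psi atan0 mulr0.
have E0 : E 0 = 1 by rewrite /E expr0n addr0 powR1.
pose K1 y := (laplace_cos p y * cos (psi y) + laplace_sin p y * sin (psi y)) * E y.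
pose K2 y := (laplace_cos p y * sin (psi y) - laplace_sin p y * cos (psi y)) * E y.
have -> : Gamma b = K1 0.
  by rewrite /K1 psi0 E0 cos0 sin0 laplace_cos0 laplace_sin0 mul0r addr0 !mulr1.
have <- : K2 0 = 0.
  by rewrite /K2 psi0 sin0 laplace_sin0 mulr0 mul0r subrr mul0r.
have dc := is_derive_laplace_cos _ p1; have ds := is_derive_laplace_sin _ p1.
split.
  rewrite -/(K1 y); apply: is_derive_0_is_cst => x.
  apply: (is_derive_eq (is_derive_fM (is_derive_fD (is_derive_fM (dc x) (dcos x))
    (is_derive_fM (ds x) (dsin x))) (dE x))).
  by rewrite sinE cosE; field; rewrite gt_eqF// onepsqr_gt0.
rewrite -/(K2 y); apply: is_derive_0_is_cst => x.
apply: (is_derive_eq (is_derive_fM (is_derive_fB (is_derive_fM (dc x) (dsin x))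
  (is_derive_fM (ds x) (dcos x))) (dE x))).
by rewrite sinE cosE; field; rewrite gt_eqF// onepsqr_gt0.
Qed.

Lemma laplace_cosE y : laplace_cos p y * (1 + y ^+ 2) `^ ((p + 1) / 2) =
  Gamma (p + 1) * cos ((p + 1) * atan y).
Proof.
have [H1 H2] := rotation y; have := cos2Dsin2 (psi y) => H3.
rewrite -/b -/(E y) -/(psi y) -H1.
transitivity (laplace_cos p y * E y * (cos (psi y) ^+ 2 + sin (psi y) ^+ 2)).
  by rewrite H3 mulr1.
transitivity ((laplace_cos p y * cos (psi y) + laplace_sin p y * sin (psi y)) * E y *
  cos (psi y) + (laplace_cos p y * sin (psi y) - laplace_sin p y * cos (psi y)) *
  E y * sin (psi y)); first by ring.
by rewrite H2 mul0r addr0.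
Qed.

Lemma laplace_sinE y : laplace_sin p y * (1 + y ^+ 2) `^ ((p + 1) / 2) =
  Gamma (p + 1) * sin ((p + 1) * atan y).
Proof.
have [H1 H2] := rotation y; have := cos2Dsin2 (psi y) => H3.
rewrite -/b -/(E y) -/(psi y) -H1.
transitivity (laplace_sin p y * E y * (cos (psi y) ^+ 2 + sin (psi y) ^+ 2)).
  by rewrite H3 mulr1.
transitivity ((laplace_cos p y * cos (psi y) + laplace_sin p y * sin (psi y)) * E y *
  sin (psi y) - (laplace_cos p y * sin (psi y) - laplace_sin p y * cos (psi y)) *
  E y * cos (psi y)); first by ring.
by rewrite H2 mul0r subr0.
Qed.

End ClosedForm.

(** The integrand is the derivative of [u^p e^-u h(u)]. For [p <= 0] the factor [u^p] does not
    vanish at 0, whence the bound [D u] on [h]: the boundary term is then of order [u^(p + 1)]. The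
    bound [C] serves at infinity and [K] gives integrability. *)
Lemma powR_parts p (h dh : R -> R) (C D K : R) : -1 < p ->
  (forall u, 0 < u -> is_derive u 1 h (dh u)) ->
  (forall u, 0 < u -> {for u, continuous dh}) ->
  (forall u, 0 < u -> `|h u| <= C) -> (forall u, 0 < u -> `|h u| <= D * u) ->
  (forall u, 0 < u -> `|p * (h u / u) - h u + dh u| <= K) ->
  \int[mu]_(u in Rpos) (u `^ p * expR (- u) * (p * (h u / u) - h u + dh u)) = 0.
Proof.
move=> p1 hd cdh hC hD hK.
apply: (etrans (y := 0 - 0)); last by rewrite subrr.
pose F u := u `^ p * expR (- u) * h u.
apply: (improper_FTC_0y (F := F)).
- apply: (integrable_powR_expRM (C := K)) => // u u0.
  apply: cvgD; last exact: cdh.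
  have ch := is_derive_continuous (hd u u0).
  apply: cvgB => //; apply: cvgM; first exact: cvg_cst.
  by apply: cvgM => //; apply: cvgV; [rewrite gt_eqF|exact: cvg_id].
- move=> u u0; apply: cvgM; first exact: continuous_powR_expR.
  apply: cvgD; last exact: cdh.
  have ch := is_derive_continuous (hd u u0).
  apply: cvgB => //; apply: cvgM; first exact: cvg_cst.
  by apply: cvgM => //; apply: cvgV; [rewrite gt_eqF|exact: cvg_id].
- move=> u u0.
  apply: (is_derive_eq (is_derive_fM (is_derive_fM (is_derive_powR p u0)
    (is_derive_expRN u)) (hd u u0))).
  by field; rewrite gt_eqF.
- apply: (@cvg0_le_norm_near _ _ _ _ _ (fun u => D * u `^ (p + 1))).
    near=> u; have u0 : 0 < u by near: u; exact: nbhs_right_gt.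
    rewrite /F !normrM ger0_norm ?powR_ge0// ger0_norm ?expR_ge0// powRS//.
    have e1 : expR (- u) <= 1 by rewrite -expR0 ler_expR oppr_le0 ltW.
    rewrite -mulrA [leRHS]mulrA [leRHS]mulrC ler_wpM2l ?powR_ge0//.
    by apply: le_trans (hD u u0); rewrite ler_piMl.
  have := cvgM (cvg_cst D) (powR_cvg0 (_ : 0 < p + 1)).
  by rewrite mulr0; apply; lra.
- apply: (@cvg0_le_norm_near _ _ _ _ _ (fun u => C * (u `^ p * expR (- u)))).
    near=> u; have u0 : 0 < u by near: u; exact: nbhs_pinfty_gt.
    have w0 : 0 <= u `^ p * expR (- u) by rewrite mulr_ge0 ?powR_ge0 ?expR_ge0.
    by rewrite /F normrM (ger0_norm w0) [leLHS]mulrC ler_wpM2r// hC.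
  by have := cvgM (cvg_cst C) (cvgy_powR_expR p); rewrite mulr0; exact.
Unshelve. all: by end_near. Qed.

End LaplaceClosedForms.

(** * The damped versine integral in closed form *)

Section DampedVersine.
Context {R : realType}.
Notation mu := (@lebesgue_measure R).
Implicit Types (p y u x a : R).
Local Notation Rpos := (`]0, +oo[%classic : set R).

Let mR : measurable (Rpos : set (measurableTypeR R)).
Proof. exact: measurable_itv. Qed.

Lemma versine_ratio1_le y u : 0 < u -> `|(1 - cos (y * u)) / u| <= `|y|.
Proof.
move=> u0; rewrite normrM normfV (gtr0_norm u0) ger0_norm ?subr_cos_ge0//.
rewrite ler_pdivrMr// (le_trans (subr_cos_le_norm _))//.
by rewrite normrM (gtr0_norm u0).
Qed.

Lemma versine_ratio2_le y u : 0 < u -> `|(1 - cos (y * u)) / u ^+ 2| <= y ^+ 2 / 2.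
Proof.
move=> u0; rewrite ger0_norm ?divr_ge0 ?subr_cos_ge0 ?sqr_ge0//.
rewrite ler_pdivrMr ?exprn_gt0// (le_trans (subr_cos_le _))//.
by rewrite exprMn; lra.
Qed.

Lemma sin_ratio_le y u : 0 < u -> `|sin (y * u) / u| <= `|y|.
Proof.
move=> u0; rewrite normrM normfV (gtr0_norm u0).
rewrite ler_pdivrMr// (le_trans (normr_sin_le _))//.
by rewrite normrM (gtr0_norm u0).
Qed.

Lemma continuous_ratio (h : R -> R) n u : 0 < u -> {for u, continuous h} ->
  {for u, continuous (fun x => h x / x ^+ n)}.
Proof.
move=> u0 ch; apply: cvgM => //; apply: cvgV; first by rewrite expf_neq0// gt_eqF.
exact: is_derive_continuous (is_derive_fX n (is_derive_id u 1)).
Qed.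

Lemma continuous_ratio1 (h : R -> R) u : 0 < u -> {for u, continuous h} ->
  {for u, continuous (fun x => h x / x)}.
Proof. exact: (@continuous_ratio h 1). Qed.

Lemma is_derive_versineZ y u :
  is_derive u 1 (fun x => 1 - cos (y * x)) (y * sin (y * u)).
Proof.
apply: (is_derive_eq (is_derive_fB (is_derive_cst (1 : R) u 1) (is_derive_cosZ y u))).
by ring.
Qed.

Lemma continuous_versineZ y : continuous (fun x => 1 - cos (y * x)).
Proof. by move=> u; exact: is_derive_continuous (is_derive_versineZ y u). Qed.

(* The scaling [u := y u] turns the damping factor into [expR (- u / y)], which
   tends to 1 for large [y]. *)
Definition damped_versine p y :=
  \int[mu]_(u in Rpos) (u `^ p * expR (- u) * ((1 - cos (y * u)) / u ^+ 2)).

Lemma integrable_damped_versine p y : -1 < p ->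
  mu.-integrable Rpos
    (EFin \o (fun u => u `^ p * expR (- u) * ((1 - cos (y * u)) / u ^+ 2))).
Proof.
move=> p1; apply: (integrable_powR_expRM (C := y ^+ 2 / 2)) => // u u0.
  by apply: continuous_ratio => //; exact: continuous_versineZ.
exact: versine_ratio2_le.
Qed.

(** Two integrations by parts, each lowering the power of [u] in the denominator: first with
    [h = (1 - cos yu) / u], then with [h = g], which is again of order [u] at 0. They produce the
    factors [1 - p] and [p]. *)
Lemma damped_versine_parts p y : -1 < p ->
  p * ((1 - p) * damped_versine p y) =
  (1 - y ^+ 2) * laplace_cos p y + 2 * y * laplace_sin p y - Gamma (p + 1).
Proof.
move=> p1.
pose g u := y * sin (y * u) - (1 - cos (y * u)).
pose dg u := y ^+ 2 * cos (y * u) - y * sin (y * u).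
have g_d u : is_derive u 1 g (dg u).
  apply: (is_derive_eq (is_derive_fB (is_derive_fZ y (is_derive_sinZ y u))
    (is_derive_versineZ y u))).
  by rewrite /dg; ring.
have cg u : {for u, continuous g} by exact: is_derive_continuous (g_d u).
have cs := @continuous_sinZ R y; have cc := @continuous_cosZ R y.
have cdg u : {for u, continuous dg}.
  by apply: cvgB; apply: cvgM; try exact: cvg_cst; [exact: cc|exact: cs].
have y2 : `|y| * `|y| = y ^+ 2 by rewrite -expr2 real_normK ?num_real.
have gu u : 0 < u -> `|g u / u| <= y ^+ 2 + `|y|.
  move=> u0; rewrite /g mulrBl (le_trans (ler_normB _ _))// lerD//.
    by rewrite -mulrA normrM -y2 ler_wpM2l// sin_ratio_le.
  exact: versine_ratio1_le.
have gb u : `|g u| <= `|y| + 2.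
  rewrite /g (le_trans (ler_normB _ _))// lerD//.
    by rewrite normrM ler_piMr// sin_max.
  by rewrite (le_trans (ler_normB _ _))// normr1 -[2]/(1 + 1) lerD2l cos_max.
have dgb u : `|dg u| <= y ^+ 2 + `|y|.
  rewrite /dg (le_trans (ler_normB _ _))// lerD//.
    by rewrite normrM ger0_norm ?sqr_ge0// ler_piMr ?sqr_ge0// cos_max.
  by rewrite normrM ler_piMr// sin_max.
have iJ := integrable_damped_versine y p1.
have ig : mu.-integrable Rpos
    (EFin \o (fun u => u `^ p * expR (- u) * (g u / u))).
  apply: (integrable_powR_expRM (C := y ^+ 2 + `|y|)) => // u u0.
  by apply: continuous_ratio1.
have ic := integrable_laplace_cos y p1.
have i_s := integrable_laplace_sin y p1.
have ie := integrable_powR_expR p1.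
have H1 : (1 - p) * damped_versine p y =
    \int[mu]_(u in Rpos) (u `^ p * expR (- u) * (g u / u)).
  apply/eqP; rewrite eq_sym -subr_eq0 -RintegralZl// -RintegralB//; last exact: RintegrableZl.
  apply/eqP.
  (* Here [p h / u - h + h'] equals [g / u - (1 - p) (1 - cos yu) / u^2]. *)
  rewrite -[RHS](@powR_parts R p (fun u => (1 - cos (y * u)) / u)
    (fun u => y * (sin (y * u) / u) - (1 - cos (y * u)) / u ^+ 2) `|y| (y ^+ 2 / 2)
    (`|p| * (y ^+ 2 / 2) + `|y| + (y ^+ 2 + y ^+ 2 / 2)))//.
  - apply: eq_Rintegral => u /set_mem/Rpos_gt0 u0.
    by rewrite /g; field; rewrite gt_eqF.
  - move=> u u0.
    apply: (is_derive_eq (is_derive_fM (is_derive_versineZ y u)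
      (is_derive_fV (lt0r_neq0 u0) (is_derive_id u 1)))).
    by field; rewrite gt_eqF.
  - move=> u u0; apply: cvgB; last first.
      exact: (@continuous_ratio _ 2 u u0 (@continuous_versineZ y u)).
    by apply: cvgM; [exact: cvg_cst|exact: (@continuous_ratio1 _ u u0 (cs u))].
  - by move=> u; exact: versine_ratio1_le.
  - move=> u u0; have := versine_ratio2_le y u0.
    rewrite expr2 invfM mulrA normrM [`|u^-1|]normfV (gtr0_norm u0).
    by rewrite ler_pdivrMr.
  - move=> u u0; rewrite (le_trans (ler_normD _ _))// lerD//.
      rewrite (le_trans (ler_normB _ _))// lerD ?versine_ratio1_le//.
      rewrite normrM ler_wpM2l//; have := versine_ratio2_le y u0.
      by rewrite expr2 invfM mulrA.
    rewrite (le_trans (ler_normB _ _))// lerD ?versine_ratio2_le//.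
    by rewrite normrM -y2 ler_wpM2l// sin_ratio_le.
rewrite H1.
have H2 := @powR_parts R p g dg (`|y| + 2) (y ^+ 2 + `|y|)
    (`|p| * (y ^+ 2 + `|y|) + (`|y| + 2) + (y ^+ 2 + `|y|)) p1
    (fun u _ => g_d u) (fun u _ => cdg u) (fun u _ => gb u) _ _.
have H2' : \int[mu]_(u in Rpos) (u `^ p * expR (- u) * (p * (g u / u) - g u + dg u)) = 0.
  apply: H2 => u u0.
    by have := gu u u0; rewrite normrM normfV (gtr0_norm u0) ler_pdivrMr.
  rewrite (le_trans (ler_normD _ _))// lerD// (le_trans (ler_normB _ _))// lerD//.
  by rewrite normrM ler_wpM2l// gu.
(* [g - g'] is [(1 - y^2) cos yu + 2 y sin yu - 1]; its constant term produces the Gamma value. *)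
have E u : u `^ p * expR (- u) * (p * (g u / u) - g u + dg u) =
    p * (u `^ p * expR (- u) * (g u / u)) +
    (u `^ p * expR (- u) - ((1 - y ^+ 2) * (u `^ p * expR (- u) * cos (y * u)) +
     2 * y * (u `^ p * expR (- u) * sin (y * u)))).
  by rewrite /g /dg; ring.
have {}H2' : \int[mu]_(u in Rpos) (p * (u `^ p * expR (- u) * (g u / u)) +
    (u `^ p * expR (- u) - ((1 - y ^+ 2) * (u `^ p * expR (- u) * cos (y * u)) +
     2 * y * (u `^ p * expR (- u) * sin (y * u))))) = 0.
  by apply: etrans H2'; apply: eq_Rintegral => u _; rewrite E.
have iZc := RintegrableZl mR (1 - y ^+ 2) ic.
have iZs := RintegrableZl mR (2 * y) i_s.
have iZ := RintegrableD mR iZc iZs.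
rewrite (RintegralD mR (RintegrableZl mR p ig) (RintegrableB mR ie iZ)) in H2'.
rewrite (RintegralB mR ie iZ) (RintegralD mR iZc iZs) in H2'.
rewrite !RintegralZl// in H2'.
have -> : Gamma (p + 1) = \int[mu]_(u in Rpos) (u `^ p * expR (- u)).
  by rewrite /Gamma addrK.
rewrite /laplace_cos /laplace_sin; lra.
Qed.

(** With [theta = atan y] one has [1 - y^2 = (1 + y^2) cos(2 theta)] and
    [2 y = (1 + y^2) sin(2 theta)], so the closed forms of the two transforms combine by the
    addition formula into [cos(2 theta - (p + 1) theta)]. *)
Lemma damped_versineE p y : -1 < p ->
  p * (1 - p) * damped_versine p y =
  Gamma (p + 1) * ((1 + y ^+ 2) `^ ((1 - p) / 2) * cos ((1 - p) * atan y) - 1).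
Proof.
move=> p1; rewrite -mulrA damped_versine_parts//.
have E0 : 0 < (1 + y ^+ 2) `^ ((p + 1) / 2) by rewrite powR_gt0 ?onepsqr_gt0.
set E := _ `^ _ in E0.
have HC := laplace_cosE p1 y; have HS := laplace_sinE p1 y.
rewrite -/E in HC HS.
have one0 := onepsqr_gt0 y.
have EE : E * (1 + y ^+ 2) `^ ((1 - p) / 2) = 1 + y ^+ 2.
  rewrite /E -powRD; last by rewrite (gt_eqF one0) implybT.
  have -> : (p + 1) / 2 + (1 - p) / 2 = 1 by field.
  by rewrite powRr1// ltW.
apply: (@mulIf _ E); first by rewrite gt_eqF.
transitivity ((1 - y ^+ 2) * (laplace_cos p y * E) +
  2 * y * (laplace_sin p y * E) - Gamma (p + 1) * E); first by ring.
rewrite HC HS.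
transitivity (Gamma (p + 1) * ((1 - y ^+ 2) * cos ((p + 1) * atan y) +
  2 * y * sin ((p + 1) * atan y)) - Gamma (p + 1) * E); first by ring.
have -> : Gamma (p + 1) * ((1 + y ^+ 2) `^ ((1 - p) / 2) * cos ((1 - p) * atan y) - 1) * E
  = Gamma (p + 1) * ((E * (1 + y ^+ 2) `^ ((1 - p) / 2)) * cos ((1 - p) * atan y)) -
    Gamma (p + 1) * E by ring.
rewrite EE; congr (_ * _ - _).
have -> : (1 - p) * atan y = 2 * atan y - (p + 1) * atan y by ring.
rewrite cosB mulrDr !mulrA.
set c := cos (atan y); set s := sin (atan y).
have c2 : c ^+ 2 * (1 + y ^+ 2) = 1.
  rewrite /c cos_atan exprVn sqr_sqrtr ?(ltW one0)// mulVf// gt_eqF//.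
have c0 : c != 0 by apply/eqP => c0; move: c2; rewrite c0 expr0n mul0r => /eqP; rewrite eq_sym oner_eq0.
have sy : s = y * c.
  by have := atanK y; rewrite /tan -/c -/s => <-; rewrite divfK.
have -> : cos (2 * atan y) = c * c - s * s.
  by rewrite mulr_natl mulr2n cosD.
have -> : sin (2 * atan y) = s * c + c * s.
  by rewrite mulr_natl mulr2n sinD.
congr (_ * _ + _ * _).
  transitivity ((1 - y ^+ 2) * (c ^+ 2 * (1 + y ^+ 2))); first by rewrite c2 mulr1.
  by rewrite sy; ring.
transitivity (2 * y * (c ^+ 2 * (1 + y ^+ 2))); first by rewrite c2 mulr1.
by rewrite sy; ring.
Qed.

End DampedVersine.

(** * The exponent zero, and removal of the damping *)

Section AbelLimit.
Context {R : realType}.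
Notation mu := (@lebesgue_measure R).
Implicit Types (p y u x a : R).
Local Notation Rpos := (`]0, +oo[%classic : set R).

Let mR : measurable (Rpos : set (measurableTypeR R)).
Proof. exact: measurable_itv. Qed.

Lemma Gamma1 : Gamma 1 = 1 :> R.
Proof.
rewrite /Gamma; apply: (etrans (y := 0 - - expR (- 0))); last first.
  by rewrite oppr0 expR0 opprK add0r.
have := integrable_powR_expR (_ : -1 < 1 - 1 :> R); rewrite subrr => /(_ (ltrN10 R)) ie.
apply: (improper_FTC_0y (F := fun u => - expR (- u))) => //.
- by move=> u u0; have := @continuous_powR_expR R 0 u u0.
- move=> u u0; apply: (is_derive_eq (is_derive_fN (is_derive_expRN u))).
  by rewrite opprK powRr0 mul1r.
- apply: cvg_at_right_filter; apply: cvgN.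
  exact: is_derive_continuous (is_derive_expRN 0).
- by rewrite -oppr0; apply: cvgN; exact: cvgr_expR.
Qed.

Lemma laplace_cos_p0 y : laplace_cos 0 y = (1 + y ^+ 2)^-1.
Proof.
have one0 := onepsqr_gt0 y.
have := laplace_cosE (ltrN10 R) y.
rewrite add0r !mul1r Gamma1 mul1r powR12_sqrt ?(ltW one0)// cos_atan => H.
apply: (@mulIf _ (Num.sqrt (1 + y ^+ 2))); first by rewrite gt_eqF// sqrtr_gt0.
rewrite H; have := sqr_sqrtr (ltW one0).
have : Num.sqrt (1 + y ^+ 2) != 0 by rewrite gt_eqF// sqrtr_gt0.
set s := Num.sqrt (1 + y ^+ 2); move=> s0 <-; field.
exact: s0.
Qed.

(** For exponent 0 the factor [p (1 - p)] makes [damped_versineE] void. The derivative of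
    [damped_versine 0] in [y] is this integral, whose own derivative is
    [laplace_cos 0 y = 1 / (1 + y^2)]. The trivial power is kept so that the lemmas for general
    exponents apply. *)
Definition damped_sinc y :=
  \int[mu]_(u in Rpos) (u `^ 0 * expR (- u) * (sin (y * u) / u)).

Lemma integrable_damped_sinc y :
  mu.-integrable Rpos (EFin \o (fun u => u `^ 0 * expR (- u) * (sin (y * u) / u))).
Proof.
apply: (integrable_powR_expRM (C := `|y|)) (ltrN10 R) _ _ => u u0.
  by apply: continuous_ratio1 => //; exact: continuous_sinZ.
exact: sin_ratio_le.
Qed.

Lemma is_derive_damped_sinc y : is_derive y 1 damped_sinc (1 + y ^+ 2)^-1.
Proof.
rewrite -laplace_cos_p0.
have := @is_derive_under_integral R _ _ mu
  (fun y u => u `^ 0 * expR (- u) * (sin (y * u) / u))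
  (fun y u => u `^ 0 * expR (- u) * cos (y * u)) Rpos y (y - 1) (y + 1)
  (fun u => u `^ 0 * expR (- u)) mR.
rewrite gtrBl ltrDl ltr01 => /(_ isT) H.
apply: H.
- by move=> v _; exact: integrable_damped_sinc.
- move=> v u _ /Rpos_gt0 u0.
  have := is_derive_fZ (u `^ 0 * expR (- u) / u) (is_derive_sinZ u v).
  under eq_fun do rewrite [u * _]mulrC mulrAC -mulrA.
  by move=> D; apply: (is_derive_eq D); rewrite [v * u]mulrC; field; rewrite gt_eqF.
- by move=> u; rewrite mulr_ge0 ?powR_ge0 ?expR_ge0.
- exact: integrable_powR_expR (ltrN10 R).
- move=> v u _ _; rewrite normrM ger0_norm ?mulr_ge0 ?powR_ge0 ?expR_ge0//.
  by rewrite ler_piMr ?cos_max// mulr_ge0 ?powR_ge0 ?expR_ge0.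
Qed.

Lemma is_derive_damped_versine0 y :
  is_derive y 1 (damped_versine 0) (damped_sinc y).
Proof.
have := @is_derive_under_integral R _ _ mu
  (fun y u => u `^ 0 * expR (- u) * ((1 - cos (y * u)) / u ^+ 2))
  (fun y u => u `^ 0 * expR (- u) * (sin (y * u) / u)) Rpos y (y - 1) (y + 1)
  (fun u => (`|y| + 1) * (u `^ 0 * expR (- u))) mR.
rewrite gtrBl ltrDl ltr01 => /(_ isT) H.
apply: H.
- by move=> v _; exact: integrable_damped_versine (ltrN10 R).
- move=> v u _ /Rpos_gt0 u0.
  have := is_derive_fZ (u `^ 0 * expR (- u) / u ^+ 2) (is_derive_versineZ u v).
  under eq_fun do rewrite [u * _]mulrC mulrAC -mulrA.
  by move=> D; apply: (is_derive_eq D); rewrite [v * u]mulrC; field; rewrite gt_eqF.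
- by move=> u; rewrite mulr_ge0 ?addr_ge0// mulr_ge0 ?powR_ge0 ?expR_ge0.
- by apply: RintegrableZl => //; exact: integrable_powR_expR (ltrN10 R).
- move=> v u vy /Rpos_gt0 u0; have w0 : 0 <= u `^ 0 * expR (- u).
    by rewrite mulr_ge0 ?powR_ge0 ?expR_ge0.
  rewrite normrM (ger0_norm w0) mulrC ler_wpM2r//.
  (* [|sin(vu) / u| <= |v|], and [v] lies within 1 of [y]: hence the constant [|y| + 1]. *)
  rewrite (le_trans (sin_ratio_le _ u0))//.
  rewrite -lerBlDl (le_trans (lerB_dist v y))// ler_norml; lra.
Qed.

Lemma damped_sincE y : damped_sinc y = atan y.
Proof.
suff : damped_sinc y - atan y = damped_sinc 0 - atan 0.
  rewrite atan0 subr0 => /eqP; rewrite subr_eq => /eqP ->.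
  suff -> : damped_sinc 0 = 0 by rewrite add0r.
  transitivity (\int[mu]_(u in Rpos) ((fun _ => 0) u)).
    by apply: eq_Rintegral => u _; rewrite mul0r sin0 mul0r mulr0.
  by rewrite /Rintegral integral0.
apply: (@is_derive_0_is_cst R (fun y => damped_sinc y - atan y)) => x.
apply: (is_derive_eq (is_derive_fB (is_derive_damped_sinc x) (is_derive1_atan x))).
by rewrite subrr.
Qed.

Lemma damped_versine0E y :
  damped_versine 0 y = y * atan y - 2^-1 * ln (1 + y ^+ 2).
Proof.
pose F y : R := y * atan y - 2^-1 * ln (1 + y ^+ 2).
suff : damped_versine 0 y - F y = damped_versine 0 0 - F 0.
  have -> : F 0 = 0 by rewrite /F mul0r expr0n addr0 ln1 mulr0 subr0.
  suff -> : damped_versine 0 0 = 0 :> R by rewrite subrr => /subr0_eq.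
  transitivity (\int[mu]_(u in Rpos) ((fun _ => 0) u)).
    by apply: eq_Rintegral => u _; rewrite mul0r cos0 subrr mul0r mulr0.
  by rewrite /Rintegral integral0.
apply: (@is_derive_0_is_cst R (fun y => damped_versine 0 y - F y)) => x.
have dln : is_derive x 1 (fun y : R => ln (1 + y ^+ 2)) ((1 + x ^+ 2)^-1 * (2 * x)).
  exact: (@is_derive_fcomp R _ (fun y => 1 + y ^+ 2) x _ _
    (is_derive1_ln (onepsqr_gt0 x)) (is_derive_onepsqr x)).
apply: (is_derive_eq (is_derive_fB (is_derive_damped_versine0 x)
  (is_derive_fB (is_derive_fM (is_derive_id x 1) (is_derive1_atan x))
    (is_derive_fZ 2^-1 dln)))).
rewrite damped_sincE; field.
by rewrite gt_eqF// onepsqr_gt0.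
Qed.

Lemma preimage_scale_Rpos y : 0 < y -> (fun x : R => y * x) @^-1` Rpos = Rpos.
Proof.
by move=> y0; apply/seteqP; split=> u /=; rewrite !in_itv/= !andbT pmulr_rgt0.
Qed.

(** After rescaling, the damping factor increases with [n]; the integrand is nonnegative, so
    monotone convergence applies before the limit is known to be finite. *)
Lemma V_integral_cvg (H : R) : 0 < H < 1 ->
  ((inv_succn n) `^ (2 * H) * damped_versine (1 - 2 * H) n.+1%:R)%:E @[n --> \oo]
   --> V_integral H.
Proof.
move=> /andP[H0 H1]; set p := 1 - 2 * H.
have p1 : -1 < p by rewrite /p; lra.
pose f u : R := (1 - cos u) / u ^+ 2 * u `^ p.
have f0 u : 0 <= f u.
  by rewrite mulr_ge0 ?powR_ge0// divr_ge0 ?subr_cos_ge0 ?sqr_ge0.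
pose g n u : \bar R := (f u * expR (- (u * inv_succn n)))%:E.
have cf u : 0 < u -> {for u, continuous f}.
  move=> u0; apply: cvgM; last exact: continuous_powR.
  have := @continuous_ratio R (fun x => 1 - cos x) 2 u u0; apply.
  by apply: cvgB; [exact: cvg_cst|exact: continuous_cos].
have mf : measurable_fun (Rpos : set (measurableTypeR R)) f by exact: measurable_Rpos.
have mg n : measurable_fun (Rpos : set (measurableTypeR R)) (g n).
  apply/measurable_EFinP; apply: measurable_funM => //.
  apply: measurableT_comp => //; apply: measurableT_comp => //.
  exact: measurable_funM.
have g0 n u : Rpos u -> (0 <= g n u)%E.
  by move=> _; rewrite lee_fin mulr_ge0 ?expR_ge0.
have ndg u : Rpos u -> nondecreasing_seq (g ^~ u).
  move=> /Rpos_gt0 u0 m n mn; rewrite lee_fin ler_wpM2l// ler_expR lerN2.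
  rewrite ler_wpM2l ?(ltW u0)// /inv_succn lef_pV2 ?posrE//.
  by rewrite ler_nat ltnS.
have := cvg_monotone_convergence mR mg g0 ndg => /(_ mu).
have -> : (\int[mu]_(u in Rpos) (limn (g ^~ u)))%E = V_integral H.
  apply: eq_integral => u _; apply/cvg_lim => //; apply: cvg_EFin; first exact: nearW.
  have h : - (u * inv_succn n) @[n --> \oo] --> (0 : R).
    rewrite -[X in _ --> X]oppr0; apply: cvgN; rewrite -[X in _ --> X](mulr0 u).
    by apply: cvgM; [exact: cvg_cst|exact: cvg_harmonic].
  have := cvgM (cvg_cst (f u)) (cvg_comp _ _ h (@continuous_expR R 0)).
  by rewrite expR0 mulr1; exact.
apply: cvg_trans; apply: near_eq_cvg; apply: nearW => n.
pose y : R := n.+1%:R; have y0 : 0 < y by [].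
have := @ge0_integralZ R y (g n) Rpos y0 mR (mg n) (g0 n).
rewrite preimage_scale_Rpos// => E.
have {}E : (\int[mu]_(u in Rpos) g n u = y%:E * \int[mu]_(u in Rpos) g n (y * u)%R)%E.
  by rewrite E muleA -EFinM mulfV ?gt_eqF// mul1e.
rewrite E /damped_versine.
have iJ := integrable_damped_versine y p1.
rewrite EFinM /Rintegral fineK; last exact: (integrable_fin_num _ iJ).
(* The rescaled integrand carries [y^p / y^2] and the Jacobian one more [y]: in all
   [y^(p - 1) = y^(-2H)], the prefactor of the statement. *)
pose c : R := y `^ p / y ^+ 2.
have -> : (\int[mu]_(u in Rpos) g n (y * u)%R =
    \int[mu]_(u in Rpos) (c%:E * (u `^ p * expR (- u) * ((1 - cos (y * u)) / u ^+ 2))%:E))%E.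
  apply: eq_integral => u /set_mem/Rpos_gt0 u0.
  rewrite /g /f -!EFinM; congr EFin.
  have -> : y * u * inv_succn n = u by rewrite /inv_succn -/y mulrAC mulfV ?mul1r// gt_eqF.
  rewrite powRM ?(ltW y0) ?(ltW u0)// /c.
  by field; rewrite !gt_eqF.
rewrite integralZl// muleA -EFinM; congr (_%:E * _)%E.
rewrite /c /inv_succn -/y -(powR_inv1 (ltW y0)) -powRrM mulN1r.
rewrite -(powR_mulrn 2 (ltW y0)) -powRN.
rewrite -{1}(powRr1 (ltW y0)) -!powRD; last 2 first.
- by rewrite (gt_eqF y0) implybT.
- by rewrite (gt_eqF y0) implybT.
by congr (_ `^ _); rewrite /p; ring.
Qed.

End AbelLimit.

(** * Limits of the closed forms *)

Section ValueOfV.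
Context {R : realType}.
Notation mu := (@lebesgue_measure R).
Implicit Types (p y u x a : R).

Lemma inv_succn_gt0 n : 0 < inv_succn n :> R.
Proof. by rewrite invr_gt0. Qed.

Lemma cvg_inv_succn_powR a : 0 < a -> (inv_succn n : R) `^ a @[n --> \oo] --> 0.
Proof.
move=> a0; apply: ((@cvg_at_rightP R (fun x => x `^ a) 0 0).1 (powR_cvg0 a0)).
by split; [exact: inv_succn_gt0|exact: cvg_harmonic].
Qed.

Lemma cvg_succn_atan : atan n.+1%:R @[n --> \oo] --> (pi / 2 : R).
Proof.
have := cvg_comp _ _ (@cvgr_idn_addn R 1) (@cvgy_atan R).
by under eq_cvg do rewrite /= addn1.
Qed.

Lemma cvg_scaled_damped_versine a : 0 < a < 2 -> a != 1 ->
  (inv_succn n) `^ a * damped_versine (1 - a) n.+1%:R @[n --> \oo]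
   --> Gamma (2 - a) * cos (a * (pi / 2)) / ((1 - a) * a).
Proof.
move=> /andP[a0 a2] a1.
have p1 : -1 < 1 - a by lra.
have pa0 : (1 - a) * a != 0.
  by apply: mulf_neq0; [rewrite subr_eq0 eq_sym|rewrite gt_eqF].
pose c := Gamma (2 - a) / ((1 - a) * a).
(* With [y = n + 1], the prefactor [y^-a] joins [(1 + y^2)^(a / 2)] into [(y^-2 + 1)^(a / 2)], which
   tends to 1. *)
pose h n : R := c * ((inv_succn n ^+ 2 + 1) `^ (a / 2) * cos (a * atan n.+1%:R)
                     - inv_succn n `^ a).
have Eh n : inv_succn n `^ a * damped_versine (1 - a) n.+1%:R = h n.
  have := damped_versineE n.+1%:R p1.
  have -> : 1 - (1 - a) = a by ring.
  have -> : 1 - a + 1 = 2 - a by ring.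
  move=> E; apply: (mulfI pa0); rewrite mulrCA E /h /c.
  have z0 := ltW (inv_succn_gt0 n).
  have -> : inv_succn n `^ a = (inv_succn n ^+ 2) `^ (a / 2).
    by rewrite -powR_mulrn// -powRrM; congr (_ `^ _); field.
  have -> : inv_succn n ^+ 2 + 1 = inv_succn n ^+ 2 * (1 + n.+1%:R ^+ 2) :> R.
    by rewrite mulrDr mulr1 /inv_succn exprVn mulVf// expf_neq0.
  have y0 := ltW (onepsqr_gt0 (n.+1%:R : R)); rewrite (powRM _ (sqr_ge0 _) y0).
  by field; move: pa0; rewrite mulf_eq0 negb_or => /andP[-> ->].
under eq_fun do rewrite Eh.
have -> : Gamma (2 - a) * cos (a * (pi / 2)) / ((1 - a) * a) =
    c * (1 * cos (a * (pi / 2)) - 0) by rewrite /c subr0 mul1r mulrAC.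
apply: cvgM; first exact: cvg_cst.
apply: cvgB; last exact: cvg_inv_succn_powR.
apply: cvgM.
  have h1 : (inv_succn n ^+ 2 + 1 : R) @[n --> \oo] --> (1 : R).
    have hs : (inv_succn n : R) @[n --> \oo] --> (0 : R) by exact: cvg_harmonic.
    have := cvgD (cvgM hs hs) (@cvg_cst _ (1 : R) _ \oo _).
    by rewrite mul0r add0r; exact.
  have := cvg_comp _ _ h1 (@continuous_powR R (a / 2) 1 ltr01).
  by rewrite powR1; exact.
have h2 : a * atan n.+1%:R @[n --> \oo] --> (a * (pi / 2)).
  by apply: cvgM; [exact: cvg_cst|exact: cvg_succn_atan].
exact: cvg_comp h2 (@continuous_cos R _).
Qed.

Lemma cvg_scaled_damped_versine0 :
  inv_succn n * damped_versine 0 n.+1%:R @[n --> \oo] --> (pi / 2 : R).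
Proof.
have Eh n : inv_succn n * damped_versine 0 n.+1%:R = atan n.+1%:R
    - 2^-1 * (inv_succn n * ln (1 + n.+1%:R ^+ 2)) :> R.
  by rewrite damped_versine0E /inv_succn; field; rewrite gt_eqF.
under eq_fun do rewrite Eh.
have -> : pi / 2 = pi / 2 - 2^-1 * 0 :> R by rewrite mulr0 subr0.
apply: cvgB; first exact: cvg_succn_atan.
apply: cvgM; first exact: cvg_cst.
(* With [z = inv_succn n] and [s = z^(1/2)]: [1 + z^-2 <= 16 z^-2 = (2 / s)^4] and [ln v <= v] give
   [z ln(1 + z^-2) <= 4 z (2 / s) = 8 s]. *)
have h8 : 8 * (inv_succn n : R) `^ 2^-1 @[n --> \oo] --> (0 : R).
  have := cvgM (@cvg_cst _ (8 : R) _ \oo _) (@cvg_inv_succn_powR 2^-1 _).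
  by rewrite mulr0; apply; rewrite invr_gt0.
apply: (cvg0_le_norm _ h8) => n.
set z : R := inv_succn n; have z0 : 0 < z := inv_succn_gt0 n.
have Ey : n.+1%:R = z^-1 by rewrite /z /inv_succn invrK.
have z1 : z <= 1 by rewrite invf_le1 ?ler1n.
set s := z `^ 2^-1; have s0 : 0 < s by exact: powR_gt0.
have Ez : z = s ^+ 2.
  by rewrite -powR_mulrn ?ltW// -powRrM mulVf// powRr1// ltW.
have l0 : 0 <= ln (1 + n.+1%:R ^+ 2 : R) by rewrite ln_ge0// lerDl sqr_ge0.
rewrite ger0_norm ?mulr_ge0 ?(ltW z0)//.
have le : 1 + n.+1%:R ^+ 2 <= (2 / s) ^+ 4.
  rewrite Ey.
  have -> : (2 / s) ^+ 4 = 16 * z ^- 2 by rewrite Ez; field; rewrite gt_eqF.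
  have : 1 <= z^-1 ^+ 2 by rewrite exprn_ege1// invf_ge1.
  by rewrite exprVn; lra.
have lb : ln (1 + n.+1%:R ^+ 2) <= 8 / s.
  have s20 : 0 < 2 / s by rewrite divr_gt0.
  rewrite (@le_trans _ _ (ln ((2 / s) ^+ 4)))//.
    by rewrite ler_ln// ?posrE ?exprn_gt0// onepsqr_gt0.
  rewrite lnXn//; have := ln_sublinear s20; lra.
apply: (le_trans (ler_wpM2l (ltW z0) lb)).
by rewrite Ez le_eqVlt; apply/orP; left; apply/eqP; field; rewrite gt_eqF.
Qed.

Lemma V_integralE (H : R) : 0 < H < 1 -> V_integral H =
  (if H == 2^-1 then pi / 2
   else Gamma (2 - 2 * H) * cos (H * pi) / ((1 - 2 * H) * (2 * H)))%:E.
Proof.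
move=> H01; apply: cvg_unique (V_integral_cvg H01) _ => //; apply: cvg_EFin; first exact: nearW.
have [->|nH] := eqVneq H 2^-1.
  rewrite mulfV// subrr; apply: cvg_trans cvg_scaled_damped_versine0.
  apply: near_eq_cvg; apply: nearW => n /=.
  by rewrite powRr1// ltW// inv_succn_gt0.
have -> : H * pi = 2 * H * (pi / 2) by field.
apply: cvg_scaled_damped_versine; first by lra.
apply: contra_neq nH => E; have : 2 * H = 2 * 2^-1 by rewrite E mulfV.
by apply: mulfI.
Qed.

End ValueOfV.

(** * Spectral kernels of fractional Brownian motion *)

Section SpectralKernels.
Context {R : realType}.
Notation mu := (@lebesgue_measure R).
Implicit Types (u r s t : R).
Local Notation Rpos := (`]0, +oo[%classic : set R).

(** Inversion is discontinuous at 0, so it is written as [u (u^2)^-1] with a real power, which is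
    measurable; at 0 both sides are 0. *)
Lemma measurable_funV : measurable_fun [set: measurableTypeR R] (fun u : R => u^-1).
Proof.
apply: (eq_measurable_fun (fun u : R => u * (u ^+ 2) `^ (-1))).
  move=> u _; have [->|u0] := eqVneq u 0; first by rewrite mul0r invr0.
  by rewrite powR_inv1 ?sqr_ge0//; field.
apply: measurable_funM => //; apply: (measurableT_comp (@measurable_powR R (-1)) (g := fun u => u ^+ 2)).
exact: measurable_funX.
Qed.

(** [f] is the sum of its restriction [g] to the open half-line and of the reflection of [g];
    [f 0 = 0] makes this exact at the origin. *)
Lemma ge0_integral_even (f : R -> R) : measurable_fun [set: measurableTypeR R] f ->
  (forall u, 0 <= f u) -> (forall u, f (- u) = f u) -> f 0 = 0 ->
  (\int[mu]_u (f u)%:E = 2%:E * \int[mu]_(u in Rpos) (f u)%:E)%E.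
Proof.
move=> mf f0 fN f00.
pose g u : \bar R := ((EFin \o f) \_ Rpos) u.
have mpos : measurable (Rpos : set (measurableTypeR R)) by exact: measurable_itv.
have mg : measurable_fun [set: measurableTypeR R] g.
  apply/(measurable_restrictT _ mpos); apply: measurable_funTS.
  exact/measurable_EFinP.
have g0 u : (0 <= g u)%E by apply: erestrict_ge0 => v _; rewrite lee_fin.
have gE u : (f u)%:E = (g u + g (- u)%R)%E.
  rewrite /g /patch; case: (ltgtP u 0) => [u0|u0|->].
  - rewrite memNset ?mem_set ?add0e /= ?fN// ?in_itv/= ?andbT ?oppr_gt0//.
    by rewrite lt_gtF.
  - rewrite mem_set ?memNset ?adde0//= in_itv/= ?andbT ?oppr_gt0//.
    by rewrite lt_gtF.
  - by rewrite oppr0 memNset ?adde0 ?f00//= in_itv/= ltxx.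
have -> : (\int[mu]_(u in Rpos) (f u)%:E = \int[mu]_u g u)%E by rewrite -integral_mkcond.
have mgN : measurable_fun [set: measurableTypeR R] (g \o -%R).
  pose phi : measurableTypeR R -> measurableTypeR R := -%R.
  have mphi : measurable_fun setT phi by exact: oppr_measurable.
  exact: (measurableT_comp mg mphi).
under eq_integral do rewrite gE.
by rewrite ge0_integralD// -(ge0_integralN mg g0) mule_natl mule2n.
Qed.

(** This is [|exp(iru) - 1|^2 / u^2] times the spectral density. *)
Definition versine_kernel (H r u : R) : R :=
  2 * (1 - cos (r * u)) / u ^+ 2 * fbm_density H u.

Lemma fbm_density_ge0 (H u : R) : 0 <= fbm_density H u.
Proof. by rewrite divr_ge0 ?powR_ge0// mulr_ge0// pi_ge0. Qed.

Lemma versine_kernel_ge0 (H r u : R) : 0 <= versine_kernel H r u.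
Proof.
by rewrite mulr_ge0 ?fbm_density_ge0// divr_ge0 ?sqr_ge0// mulr_ge0// subr_cos_ge0.
Qed.

Lemma measurable_fbm_density H :
  measurable_fun [set: measurableTypeR R] (@fbm_density R H).
Proof.
apply: measurable_funM => //.
by apply: (measurableT_comp (@measurable_powR R (1 - 2 * H)) (g := fun u => `|u|)).
Qed.

Lemma measurable_versine_kernel H r :
  measurable_fun [set: measurableTypeR R] (versine_kernel H r).
Proof.
apply: measurable_funM; last exact: measurable_fbm_density.
apply: measurable_funM.
  apply: measurable_funM => //; apply: measurable_funB => //; exact: measurable_cosZ.
apply: (measurableT_comp measurable_funV (g := fun u => u ^+ 2)).
exact: measurable_funX.
Qed.

Lemma V_integral_fin (H : R) : 0 < H < 1 -> V_integral H = (V_const H)%:E.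
Proof. by move=> H01; rewrite /V_const V_integralE. Qed.

(** Evenness doubles the half-line integral, the factor 2 of the kernel cancels that of [2 pi] in
    the density, and the substitution of [|r| u] extracts [|r|^(2H)]. *)
Lemma integral_versine_kernel H r : 0 < H < 1 ->
  (\int[mu]_u (versine_kernel H r u)%:E = (2 * (V_const H / pi) * `|r| `^ (2 * H))%:E)%E.
Proof.
move=> H01; have H0 : 2 * H != 0 by case/andP: H01 => H0 _; rewrite gt_eqF// mulr_gt0.
have pi0 : (pi : R) != 0 by rewrite gt_eqF// pi_gt0.
rewrite ge0_integral_even; last 4 first.
- exact: measurable_versine_kernel.
- exact: versine_kernel_ge0.
- by move=> u; rewrite /versine_kernel /fbm_density mulrN cosN sqrrN normrN.
- by rewrite /versine_kernel mulr0 cos0 subrr !(mulr0, mul0r).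
have [->|r0] := eqVneq r 0.
  rewrite normr0 powR0// mulr0 integral0_eq ?mule0// => u _.
  by rewrite /versine_kernel mul0r cos0 subrr !(mulr0, mul0r).
have mR : measurable (Rpos : set (measurableTypeR R)) by exact: measurable_itv.
set a := `|r|; have a0 : 0 < a by rewrite normr_gt0.
pose f u : \bar R := ((1 - cos u) / u ^+ 2 * u `^ (1 - 2 * H))%:E.
have mf : measurable_fun (Rpos : set (measurableTypeR R)) f.
  apply/measurable_EFinP; apply: measurable_Rpos => u u0.
  apply: cvgM; last exact: continuous_powR.
  have := @continuous_ratio R (fun x => 1 - cos x) 2 u u0; apply.
  by apply: cvgB; [exact: cvg_cst|exact: continuous_cos].
have f0 u : Rpos u -> (0 <= f u)%E.
  by move=> _; rewrite lee_fin mulr_ge0 ?powR_ge0// divr_ge0 ?subr_cos_ge0 ?sqr_ge0.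
have := ge0_integralZ a0 mR mf f0; rewrite preimage_scale_Rpos// => E.
(* Writing the kernel through [f (a u)] costs [a^(1 + 2H) / pi]; one power of [a] is then spent on
   the Jacobian. *)
pose c := a `^ (2 * H) * a / pi; have c0 : 0 <= c.
  by rewrite !mulr_ge0 ?powR_ge0 ?invr_ge0 ?pi_ge0// ltW.
have -> : (\int[mu]_(u in Rpos) (versine_kernel H r u)%:E
    = \int[mu]_(u in Rpos) (c%:E * f (a * u)%R))%E.
  apply: eq_integral => u /set_mem/Rpos_gt0 u0.
  rewrite -EFinM; congr EFin; rewrite /versine_kernel /fbm_density (gtr0_norm u0).
  have -> : cos (r * u) = cos (a * u).
    rewrite /a; case: (ltgtP r 0) => [q|q|->]; rewrite ?normr0// ?(gtr0_norm q)//.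
    by rewrite (ltr0_norm q) mulNr cosN.
  rewrite powRM ?(ltW a0) ?(ltW u0)//.
  set x := 1 - cos _; set w := u `^ _.
  transitivity (a `^ (2 * H) * a `^ (1 - 2 * H) * a / pi * (x / (a * u) ^+ 2 * w)).
    rewrite -powRD; last by rewrite (gt_eqF a0) implybT.
    rewrite [2 * H + _]addrC subrK powRr1 ?(ltW a0)//.
    by move: (pi : R) pi0 => P P0; field; rewrite P0 !gt_eqF.
  by rewrite /c; ring.
rewrite ge0_integralZl//; last 2 first.
- have ma : measurable_fun (Rpos : set (measurableTypeR R)) (fun u : R => a * u).
    exact: measurable_funM.
  apply: (measurable_comp mR _ mf ma) => _ [u /Rpos_gt0 u0 <-].
  by rewrite /= in_itv/= andbT mulr_gt0.
- move=> u /Rpos_gt0 u0; apply: f0.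
  by rewrite /= in_itv/= andbT mulr_gt0.
rewrite E -/(V_integral H) V_integral_fin// -!EFinM; congr EFin.
by rewrite /c -/a; move: (pi : R) pi0 => P P0; field; rewrite P0 gt_eqF.
Qed.

Lemma integrable_versine_kernel H r : 0 < H < 1 ->
  mu.-integrable setT (EFin \o versine_kernel H r).
Proof.
move=> H01; apply/integrableP; split.
  by apply/measurable_EFinP; exact: measurable_versine_kernel.
under eq_integral do rewrite /= ger0_norm ?versine_kernel_ge0//.
by rewrite integral_versine_kernel// ltry.
Qed.

Definition fbm_cos H t u : R := (1 - cos (t * u)) / u * Num.sqrt (fbm_density H u).
Definition fbm_sin H t u : R := sin (t * u) / u * Num.sqrt (fbm_density H u).

Lemma fbm_kernel_dist H t s u :
  (fbm_cos H t u - fbm_cos H s u) ^+ 2 + (fbm_sin H t u - fbm_sin H s u) ^+ 2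
  = versine_kernel H (t - s) u.
Proof.
rewrite /versine_kernel /fbm_cos /fbm_sin.
have := sqr_sqrtr (fbm_density_ge0 H u); set q := Num.sqrt _; move=> <-.
rewrite (mulrBl u t s) cosB -exprVn.
have := cos2Dsin2 (t * u); have := cos2Dsin2 (s * u).
move: (cos (t * u)) (sin (t * u)) (cos (s * u)) (sin (s * u)) => a b c d E1 E2.
set v := u^-1.
have -> : 2 * (1 - (a * c + b * d)) = (a ^+ 2 + b ^+ 2) + (c ^+ 2 + d ^+ 2)
    - 2 * (a * c + b * d) by rewrite E1 E2; ring.
by ring.
Qed.

Lemma fbm_kernel_norm H t u :
  fbm_cos H t u ^+ 2 + fbm_sin H t u ^+ 2 = versine_kernel H t u.
Proof.
have := fbm_kernel_dist H t 0 u; rewrite subr0 => <-.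
by rewrite /fbm_cos /fbm_sin mul0r cos0 sin0 subrr !mul0r !subr0.
Qed.

Let measurable_kernel H (h : R -> R) : measurable_fun [set: measurableTypeR R] h ->
  measurable_fun [set: measurableTypeR R]
    (fun u => h u / u * Num.sqrt (fbm_density H u)).
Proof.
move=> mh; apply: measurable_funM.
  by apply: measurable_funM => //; exact: measurable_funV.
apply: (eq_measurable_fun (fun u => fbm_density H u `^ 2^-1)).
  by move=> u _; rewrite powR12_sqrt// fbm_density_ge0.
exact: (measurableT_comp (@measurable_powR R 2^-1) (measurable_fbm_density H)).
Qed.

Lemma sqint_fbm_cos H t : 0 < H < 1 -> sqint mu (fbm_cos H t).
Proof.
move=> H01; have mf : measurable_fun [set: measurableTypeR R] (fbm_cos H t).
  by apply: measurable_kernel; apply: measurable_funB => //; exact: measurable_cosZ.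
split=> //; apply: le_Rintegrable (integrable_versine_kernel t H01) => //.
  exact: measurable_funX.
by move=> u _; rewrite ger0_norm ?sqr_ge0// -fbm_kernel_norm lerDl sqr_ge0.
Qed.

Lemma sqint_fbm_sin H t : 0 < H < 1 -> sqint mu (fbm_sin H t).
Proof.
move=> H01; have mf : measurable_fun [set: measurableTypeR R] (fbm_sin H t).
  by apply: measurable_kernel; exact: measurable_sinZ.
split=> //; apply: le_Rintegrable (integrable_versine_kernel t H01) => //.
  exact: measurable_funX.
by move=> u _; rewrite ger0_norm ?sqr_ge0// -fbm_kernel_norm lerDr sqr_ge0.
Qed.

Lemma coef_cosE H t n : coef_cos H t n = coef mu (@hermite_fun R) (fbm_cos H t) n.
Proof. by apply: eq_Rintegral => u _; rewrite /fbm_cos mulrAC. Qed.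

Lemma coef_sinE H t n : coef_sin H t n = coef mu (@hermite_fun R) (fbm_sin H t) n.
Proof. by apply: eq_Rintegral => u _; rewrite /fbm_sin mulrAC. Qed.

(** Parseval for both differences at once, since it is the sum of the two integrals that
    [integral_versine_kernel] evaluates. *)
Lemma fbm_energy_cvg H t s : 0 < H < 1 ->
  \sum_(0 <= n < N) (coef_cos H t n - coef_cos H s n) ^+ 2 +
  \sum_(0 <= n < N) (coef_sin H t n - coef_sin H s n) ^+ 2
    @[N --> \oo] --> 2 * (V_const H / pi) * `|t - s| `^ (2 * H).
Proof.
move=> H01.
have [ct cs] := (sqint_fbm_cos t H01, sqint_fbm_cos s H01).
have [st ss] := (sqint_fbm_sin t H01, sqint_fbm_sin s H01).
have [cB sB] := (sqintB ct cs, sqintB st ss).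
have := cvgD (hermite_parseval cB) (hermite_parseval sB).
rewrite -RintegralD//; [|exact: cB.2|exact: sB.2].
under eq_Rintegral do rewrite fbm_kernel_dist.
rewrite /Rintegral integral_versine_kernel//=.
move=> h; apply: cvg_trans (h eventually_filter); apply: near_eq_cvg; apply: nearW => N /=.
congr (_ + _); apply: eq_bigr => n _.
  by rewrite !coef_cosE -fourier_coefB//; exact: sqint_hermite.
by rewrite !coef_sinE -fourier_coefB//; exact: sqint_hermite.
Qed.

End SpectralKernels.

(** * Isonormal processes *)

Section OrthogonalSeries.
Context {R : realType} (V : hilbert R).
Implicit Types (x y z : V) (a : R).

Lemma hdotDl x y z : hdot V (x + y) z = hdot V x z + hdot V y z.
Proof. exact: linearDl. Qed.

Lemma hdotDr x y z : hdot V x (y + z) = hdot V x y + hdot V x z.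
Proof. exact: linearDr. Qed.

Lemma hdotZl a x y : hdot V (a *: x) y = a * hdot V x y.
Proof. exact: linearZl_LR. Qed.

Lemma hdotZr a x y : hdot V x (a *: y) = a * hdot V x y.
Proof. exact: linearZr_LR. Qed.

Lemma sqr_norm_orthogonalD x y : hdot V x y = 0 -> hdot V y x = 0 ->
  `|x + y| ^+ 2 = `|x| ^+ 2 + `|y| ^+ 2.
Proof.
move=> xy yx; rewrite -!hdotE hdotDl !hdotDr.
by rewrite xy yx addr0 add0r.
Qed.

Variable x : nat -> V.
Hypothesis orth : forall i j, i != j -> hdot V (x i) (x j) = 0.

Lemma sqr_norm_orthogonal_sum m n :
  `|\sum_(m <= k < n) x k| ^+ 2 = \sum_(m <= k < n) `|x k| ^+ 2.
Proof.
elim: n => [|n IH]; first by rewrite !big_geq// normr0 expr0n.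
have [mn|nm] := leqP m n; last by rewrite !big_geq// normr0 expr0n.
rewrite !big_nat_recr//= sqr_norm_orthogonalD ?IH//.
- rewrite linear_sumlz big_nat big1// => k /andP[_ kn]; apply: orth.
  by rewrite neq_ltn kn.
- rewrite linear_sumr big_nat big1// => k /andP[_ kn]; apply: orth.
  by rewrite neq_ltn kn orbT.
Qed.

(** By Pythagoras the squared norm of a block of the series is a block of the series of squared
    norms, so the Cauchy criterion passes over; [V] is complete. *)
Lemma cvg_orthogonal_series : cvgn (series (fun k => `|x k| ^+ 2)) -> cvgn (series x).
Proof.
move=> cx; apply/cauchy_cvgP/cauchy_seriesP => e e0.
have /cauchy_cvgP/cauchy_seriesP/(_ (e ^+ 2)) := cx.
rewrite exprn_gt0// => /(_ isT); apply: filterS => -[m n] /=.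
rewrite ger0_norm; last by apply: sumr_ge0 => k _; exact: sqr_ge0.
by rewrite -sqr_norm_orthogonal_sum ltr_pXn2r// nnegrE // ltW.
Qed.

Lemma sqr_norm_orthogonal_limit k l : series x @ \oo --> k ->
  series (fun k => `|x k| ^+ 2) @ \oo --> l -> `|k| ^+ 2 = l.
Proof.
move=> xk; apply: cvg_unique => //.
have h : `|series x N| @[N --> \oo] --> `|k| by exact: cvg_norm.
have : `|series x N| ^+ 2 @[N --> \oo] --> `|k| ^+ 2 by exact: (cvgM h h).
apply: cvg_trans; apply: near_eq_cvg; apply: nearW => N /=.
exact: sqr_norm_orthogonal_sum.
Qed.

End OrthogonalSeries.

Section InterleavedSeries.
Context {R : realType} (V : hilbert R) (g : nat -> V).
Hypothesis ong : forall m n, hdot V (g m) (g n) = (m == n)%:R.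
Implicit Types (c d : nat -> R).

(** Grouping the cosine and sine terms of the same rank gives a single orthogonal series. Setting
    [c] or [d] to 0 yields either series alone, and differences of coefficients yield increments. *)
Definition interleave c d n : V := c n *: g (2 * n)%N + d n *: g (2 * n).+1.

Lemma hdot_interleave c d i j : hdot V (interleave c d i) (interleave c d j) =
  (i == j)%:R * (c i * c j + d i * d j).
Proof.
rewrite /interleave hdotDl !hdotDr !hdotZl !hdotZr !ong.
have -> : ((2 * i)%N == (2 * j).+1) = false by apply/eqP; lia.
have -> : ((2 * i).+1 == (2 * j)%N) = false by apply/eqP; lia.
have -> : ((2 * i)%N == (2 * j)%N) = (i == j) by apply/eqP/eqP; lia.
have -> : ((2 * i).+1 == (2 * j).+1) = (i == j) by apply/eqP/eqP; lia.
rewrite !mulr0n !mulr0 addr0 add0r; ring.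
Qed.

Lemma sqr_norm_interleave c d n : `|interleave c d n| ^+ 2 = c n ^+ 2 + d n ^+ 2.
Proof. by rewrite -hdotE hdot_interleave eqxx mul1r. Qed.

Lemma orthogonal_interleave c d i j : i != j ->
  hdot V (interleave c d i) (interleave c d j) = 0.
Proof. by move=> /negPf ij; rewrite hdot_interleave ij mul0r. Qed.

End InterleavedSeries.

(** * Almost sure equality and limits in mean square *)

Section AlmostSureEquality.
Context d (T : measurableType d) (R : realType) (P : probability T R).
Implicit Types (X Y f : T -> R).

Lemma ae_Rintegral X Y : measurable_fun setT X -> measurable_fun setT Y ->
  {ae P, forall w, X w = Y w} -> \int[P]_w X w = \int[P]_w Y w.
Proof.
move=> mX mY XY; congr fine; apply: ae_eq_integral => //; [exact/measurable_EFinP..|].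
by apply: filterS XY => w + _ /=; move=> ->.
Qed.

Lemma sqint0_ae X : sqint P X -> \int[P]_w (X w ^+ 2) = 0 ->
  {ae P, forall w, X w = 0}.
Proof.
move=> [mX iX] E.
have mX2 : measurable_fun setT (EFin \o (fun w => X w ^+ 2)) by case/integrableP: iX.
have /(ae_eq_integral_abs _ measurableT mX2) :
    (\int[P]_w `|(EFin \o (fun w => (X w ^+ 2)%R)) w| = 0)%E.
  under eq_integral do rewrite /= ger0_norm ?sqr_ge0//.
  by rewrite -[LHS]fineK ?(integrable_fin_num _ iX)//; congr EFin.
apply: filterS => w /(_ Logic.I) /= /(congr1 fine) /= /eqP.
by rewrite expf_eq0/= => /eqP.
Qed.

Lemma cvg_L2P (u : nat -> T -> R) f : cvg_L2 P u f <->
  [/\ forall n, sqint P (u n), sqint P f &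
      \int[P]_w ((u n w - f w) ^+ 2) @[n --> \oo] --> 0].
Proof.
have E n : sqint P (u n) -> sqint P f -> ('N[P]_2%:E[EFin \o (u n \- f)%R] =
    (Num.sqrt (\int[P]_w ((u n w - f w) ^+ 2)))%:E)%E.
  by move=> su sf; exact: Lnorm2E (sqintB su sf).
split=> -[su sf uf].
  have {}su n : sqint P (u n) by apply/Lfun2P.
  have {}sf : sqint P f by apply/Lfun2P.
  split=> //; move: uf; rewrite (eq_cvg _ _ (fun n => E n (su n) sf)).
  move=> /fine_cvgP[_ h].
  have h2 : Num.sqrt (\int[P]_w ((u n w - f w) ^+ 2)) *
      Num.sqrt (\int[P]_w ((u n w - f w) ^+ 2)) @[n --> \oo] --> (0 * 0 : R).
    exact: (cvgM h h).
  rewrite mul0r in h2; apply: cvg_trans h2; apply: near_eq_cvg; apply: nearW => n /=.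
  by rewrite -expr2 sqr_sqrtr// Rintegral_sqr_ge0.
split=> [n||]; [exact/Lfun2P|exact/Lfun2P|].
rewrite (eq_cvg _ _ (fun n => E n (su n) sf)).
apply: cvg_EFin; first exact: nearW.
have := cvg_comp _ _ uf (@sqrt_continuous R 0).
by rewrite sqrtr0; exact.
Qed.

Lemma cvg_L2_unique (u : nat -> T -> R) X Y : cvg_L2 P u X -> cvg_L2 P u Y ->
  {ae P, forall w, X w = Y w}.
Proof.
move=> /cvg_L2P[su sX uX] /cvg_L2P[_ sY uY].
have sXY := sqintB sX sY.
suff h : \int[P]_w ((X w - Y w) ^+ 2) = 0.
  by apply: filterS (sqint0_ae sXY h) => w /eqP; rewrite subr_eq0 => /eqP.
apply/eqP; rewrite eq_le Rintegral_sqr_ge0 andbT.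
have h : 2 * \int[P]_w ((u n w - X w) ^+ 2) + 2 * \int[P]_w ((u n w - Y w) ^+ 2)
    @[n --> \oo] --> 2 * 0 + 2 * (0 : R).
  by apply: cvgD; apply: cvgM => //; exact: cvg_cst.
have {}h : 2 * \int[P]_w ((u n w - X w) ^+ 2) + 2 * \int[P]_w ((u n w - Y w) ^+ 2)
    @[n --> \oo] --> (0 : R) by move: h; rewrite mulr0 addr0.
rewrite -(cvg_lim _ h)//; apply: limr_ge; first by apply/cvg_ex; exists 0.
apply: nearW => n.
have := Rintegral_sqrD_le (sqintZ (-1) (sqintB (su n) sX)) (sqintB (su n) sY).
have -> : \int[P]_w ((-1 * (u n w - X w) + (u n w - Y w)) ^+ 2) =
    \int[P]_w ((X w - Y w) ^+ 2) by apply: eq_Rintegral => w _; ring.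
have -> // : \int[P]_w ((-1 * (u n w - X w)) ^+ 2) = \int[P]_w ((u n w - X w) ^+ 2).
by apply: eq_Rintegral => w _; ring.
Qed.

(** By the mean value theorem with [1 - cos c <= c]. A quadratic bound is what makes the error in
    [mean_eq0_of_sin] a second moment. *)
Lemma abs_sub_sin_le (x : R) : `|x - sin x| <= x ^+ 2.
Proof.
wlog x0 : x / 0 <= x.
  move=> H; case: (leP 0 x) => [|x0]; first exact: H.
  by rewrite -sqrrN -normrN opprB addrC -{1}(opprK (sin x)) -sinN H// oppr_ge0 ltW.
have [|c] := @MVT_segment R (fun y => y - sin y) (fun y => 1 - cos y) 0 x x0
    (fun z _ => is_derive_fB (is_derive_id z 1) (is_derive_sin z)).
  apply: continuous_subspaceT => z.
  by apply: cvgB; [exact: cvg_id|exact: continuous_sin].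
rewrite in_itv/= sin0 !subr0 => /andP[c0 cx] ->.
rewrite normrM (ger0_norm (subr_cos_ge0 _)) ger0_norm// expr2 ler_wpM2r//.
by rewrite (le_trans (subr_cos_le_norm _))// ger0_norm.
Qed.

Lemma sqint_integrable X : sqint P X -> P.-integrable setT (EFin \o X).
Proof.
move=> sX; have s1 : sqint P (cst 1 : T -> R).
  split; first exact: measurable_cst.
  exact: (finite_measure_integrable_cst P (1 ^+ 2)).
apply: eq_integrable (sqintM sX s1) => // w _.
by rewrite /= mulr1.
Qed.

(** [sin(zX) / z] has mean 0 and differs from [X] by at most [z X^2], so the mean of [X] is at most
    [z] times its second moment; then [z] tends to 0. *)
Lemma mean_eq0_of_sin X : sqint P X -> (forall t, \int[P]_w sin (t * X w) = 0) ->
  \int[P]_w X w = 0.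
Proof.
move=> sX S; have [mX iX2] := sX; have iX := sqint_integrable sX.
set M := \int[P]_w (X w ^+ 2).
have ms t : measurable_fun setT (fun w => sin (t * X w)).
  exact: (measurableT_comp (measurable_sinZ t) mX).
have le n : `|\int[P]_w X w| <= inv_succn n * M.
  pose z : R := inv_succn n; have z0 : 0 < z := inv_succn_gt0 n.
  have mS : measurable_fun setT (fun w => z^-1 * sin (z * X w)).
    by move: (ms z) => mz; exact: measurable_funM.
  have iS : P.-integrable setT (EFin \o (fun w => z^-1 * sin (z * X w))).
    apply: (le_Rintegrable measurableT mS (g := fun w => z^-1)).
      move=> w _; rewrite normrM ger0_norm ?invr_ge0 ?(ltW z0)//.
      by rewrite ler_piMr ?invr_ge0 ?(ltW z0)// sin_max.
    exact: finite_measure_integrable_cst.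
  have -> : \int[P]_w X w = \int[P]_w (X w - z^-1 * sin (z * X w)).
    rewrite RintegralB// RintegralZl ?S ?mulr0 ?subr0//.
    apply: (le_Rintegrable measurableT (ms z) (g := fun w => 1)).
      by move=> w _; exact: sin_max.
    exact: finite_measure_integrable_cst.
  rewrite /M -RintegralZl//.
  have iD := RintegrableB measurableT iX iS.
  apply: (le_trans (le_normr_Rintegral measurableT iD)).
  apply: le_Rintegral => //; first exact: integrable_abse iD.
    exact: RintegrableZl.
  move=> w _.
  have -> : X w - z^-1 * sin (z * X w) = z^-1 * (z * X w - sin (z * X w)).
    by field; rewrite gt_eqF.
  rewrite normrM ger0_norm ?invr_ge0 ?(ltW z0)//.
  rewrite mulrC ler_pdivrMr//.
  have -> : z * X w ^+ 2 * z = (z * X w) ^+ 2 by ring.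
  exact: abs_sub_sin_le.
have h : inv_succn n * M @[n --> \oo] --> 0 * M.
  by apply: cvgM; [exact: cvg_harmonic|exact: cvg_cst].
rewrite mul0r in h; apply/eqP; rewrite -normr_le0 -(cvg_lim _ h)//.
by apply: limr_ge; [apply/cvg_ex; exists 0|exact: nearW].
Qed.

End AlmostSureEquality.

Lemma continuous_eq_on_dense (V : topologicalType) (R : realType) (S : set V)
    (f g : V -> R) : dense S -> continuous f -> continuous g ->
  (forall x, S x -> f x = g x) -> f =1 g.
Proof.
move=> dS cf cg fg x; apply/eqP; apply: contrapT => /negP ne.
pose D y := f y - g y.
have cD : continuous D by move=> y; apply: cvgB; [exact: cf|exact: cg].
have oD : open (D @^-1` [set y | y != 0]).
  apply: open_comp => [y _|]; first exact: cD.
  exact: open_neq.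
have [|y [yD yS]] := dS (D @^-1` [set y | y != 0]) _ oD.
  by exists x; rewrite /= subr_eq0.
by move: yD; rewrite /= /D fg// subrr eqxx.
Qed.

(** * White noise: the law of the isometric image of a vector *)

Section Isonormal.
Context {R : realType} (sigma : {measure set R -> \bar R}).
Variables (P : probability (cylinderType R) R) (V : completion sigma).
Variable Q : V -> cylinderType R -> R.
Hypothesis wn : is_white_noise_measure sigma P.
Hypothesis ext : is_isometric_extension P Q.
Implicit Types (h k : V) (a t : R).

Lemma sqintQ h : sqint P (Q h).
Proof. by apply/Lfun2P; case: ext. Qed.

Lemma Rintegral_sqrQ h : \int[P]_w (Q h w ^+ 2) = `|h| ^+ 2.
Proof.
case: ext => _ _ /(_ h) + _; rewrite Lnorm2E; last exact: sqintQ.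
by move=> -[<-]; rewrite sqr_sqrtr// Rintegral_sqr_ge0.
Qed.

Lemma Q_linear a h k : {ae P, forall w, Q (a *: h + k) w = a * Q h w + Q k w}.
Proof. by case: ext => _ /(_ a h k). Qed.

Lemma Q0 : {ae P, forall w, Q 0 w = 0}.
Proof.
apply: filterS (Q_linear (-1) 0 0) => w.
by rewrite scaler0 addr0 mulN1r addNr.
Qed.

Lemma Q_scale a h : {ae P, forall w, Q (a *: h) w = a * Q h w}.
Proof.
by apply: filterS2 (Q_linear a h 0) Q0 => w; rewrite addr0 => -> ->; rewrite addr0.
Qed.

Lemma Q_sub h k : {ae P, forall w, Q (h - k) w = Q h w - Q k w}.
Proof.
apply: filterS (Q_linear (-1) k h) => w.
by rewrite scaleN1r mulN1r addrC [RHS]addrC.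
Qed.

Lemma Q_sum (I : Type) (s : seq I) (c : I -> R) (e : I -> V) :
  {ae P, forall w, Q (\sum_(i <- s) c i *: e i) w = \sum_(i <- s) c i * Q (e i) w}.
Proof.
elim: s => [|i s IH]; first by apply: filterS Q0 => w; rewrite !big_nil.
apply: filterS2 (Q_linear (c i) (e i) (\sum_(j <- s) c j *: e j)) IH => w.
by rewrite !big_cons => -> ->.
Qed.

Lemma Q_dist h k : \int[P]_w ((Q h w - Q k w) ^+ 2) = `|h - k| ^+ 2.
Proof.
rewrite -Rintegral_sqrQ; apply: ae_Rintegral.
- by case: (sqintB (sqintQ h) (sqintQ k)) => m _; exact: measurable_funX.
- by case: (sqintQ (h - k)) => m _; exact: measurable_funX.
- by apply: filterS (Q_sub h k) => w ->.
Qed.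

Lemma cvg_L2_Q (u : nat -> cylinderType R -> R) (v : nat -> V) k :
  (forall n, sqint P (u n)) -> (forall n, {ae P, forall w, Q (v n) w = u n w}) ->
  v @ \oo --> k -> cvg_L2 P u (Q k).
Proof.
move=> su uv vk; apply/cvg_L2P; split=> //; first exact: sqintQ.
have E n : \int[P]_w ((u n w - Q k w) ^+ 2) = `|v n - k| ^+ 2.
  rewrite -Q_dist; apply: ae_Rintegral.
  - by case: (sqintB (su n) (sqintQ k)) => m _; exact: measurable_funX.
  - by case: (sqintB (sqintQ (v n)) (sqintQ k)) => m _; exact: measurable_funX.
  - by apply: filterS (uv n) => w ->.
under eq_cvg do rewrite E.
have h : `|v n - k| @[n --> \oo] --> (0 : R).
  rewrite -(normr0 V) -(subrr k); apply: cvg_norm; apply: cvgB => //; exact: cvg_cst.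
have : `|v n - k| ^+ 2 @[n --> \oo] --> (0 * 0 : R) by exact: (cvgM h h).
by rewrite mul0r.
Qed.

(** The difference is at most the mean of [|Q h - Q k|], which the isometry controls by [|h - k|].
    The bound [e] is strictly positive so that it can be divided by, also when [h = k]. *)
Lemma Q_lipschitz (f : R -> R) h k (e : R) : 0 < e ->
  measurable_fun [set: measurableTypeR R] f ->
  (forall x, `|f x| <= 1) -> (forall x y, `|f x - f y| <= `|x - y|) ->
  `|h - k| <= e -> `|\int[P]_w f (Q h w) - \int[P]_w f (Q k w)| <= e.
Proof.
move=> e0 mf f1 fL hk.
have ifQ j : P.-integrable setT (EFin \o (fun w => f (Q j w))).
  apply: (le_Rintegrable measurableT _ (g := fun w => 1)).
  - by case: (sqintQ j) => m _; exact: (measurableT_comp mf m).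
  - by move=> w _; exact: f1.
  - exact: finite_measure_integrable_cst.
have sD := sqintB (sqintQ h) (sqintQ k).
have iD := RintegrableB measurableT (ifQ h) (ifQ k).
rewrite -RintegralB//.
apply: (le_trans (le_normr_Rintegral measurableT iD)).
(* AM-GM: [|x| <= e / 2 + x ^+ 2 / (2 * e)] *)
pose b w := e / 2 + (2 * e)^-1 * (Q h w - Q k w) ^+ 2.
have i1 : P.-integrable setT (EFin \o (cst (e / 2) : cylinderType R -> R)).
  exact: finite_measure_integrable_cst.
have i2 := RintegrableZl measurableT (2 * e)^-1 sD.2.
have ib : P.-integrable setT (EFin \o b) by exact: RintegrableD.
apply: (@le_trans _ _ (\int[P]_w b w)).
  apply: le_Rintegral => //; first exact: integrable_abse iD.
  move=> w _; apply: (le_trans (fL _ _)); rewrite /b.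
  set x := Q h w - Q k w.
  have -> : e / 2 + (2 * e)^-1 * x ^+ 2 = (e ^+ 2 + `|x| ^+ 2) / (2 * e).
    by rewrite real_normK ?num_real//; field; rewrite gt_eqF.
  rewrite ler_pdivlMr ?mulr_gt0//.
  by have := sqr_ge0 (e - `|x|); rewrite sqrrB; lra.
have iD2 := sD.2; rewrite /b (RintegralD measurableT i1 i2) RintegralZl//.
rewrite Q_dist Rintegral_cst//= probability_setT/= mulr1.
have : `|h - k| ^+ 2 <= e ^+ 2 by rewrite lerXn2r// nnegrE // ltW.
move=> H; have : (2 * e)^-1 * `|h - k| ^+ 2 <= (2 * e)^-1 * e ^+ 2.
  by rewrite ler_wpM2l// invr_ge0 mulr_ge0// ltW.
have -> : (2 * e)^-1 * e ^+ 2 = e / 2 by field; rewrite gt_eqF.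
lra.
Qed.

Lemma Q_continuous (f : R -> R) : measurable_fun [set: measurableTypeR R] f ->
  (forall x, `|f x| <= 1) -> (forall x y, `|f x - f y| <= `|x - y|) ->
  continuous (fun h => \int[P]_w f (Q h w)).
Proof.
move=> mf f1 fL h; apply/cvgrPdist_le => e e0.
near=> k; apply: Q_lipschitz => //.
Unshelve. all: by end_near. Qed.

Lemma measurable_eval (s : schwartz R) :
  measurable_fun setT (fun w : cylinderType R => (w : tempered R) s).
Proof.
move=> _ B mB; rewrite setTI; apply: sub_sigma_algebra.
by exists s, B.
Qed.

Lemma sqr_norm_completion_map (s : schwartz R) :
  `|completion_map V s| ^+ 2 = \int[sigma]_u (ComplexField.Normc.normc (fourier s u) ^+ 2).
Proof.
rewrite -hdotE completion_dot /spectral_dot /=.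
apply: eq_Rintegral => u _; case: (fourier s u) => x y /=.
by rewrite sqr_sqrtr ?addr_ge0 ?sqr_ge0//; ring.
Qed.

Lemma Q_completion_map (f : R -> R) (s : schwartz R) :
  measurable_fun [set: measurableTypeR R] f ->
  \int[P]_w f (Q (completion_map V s) w) = \int[P]_w f ((w : tempered R) s).
Proof.
move=> mf; apply: ae_Rintegral.
- by case: (sqintQ (completion_map V s)) => m _; exact: (measurableT_comp mf m).
- exact: (measurableT_comp mf (measurable_eval s)).
- by case: ext => _ _ _ /(_ s); apply: filterS => w ->.
Qed.

Let measurable_cos : measurable_fun [set: measurableTypeR R] (@cos R).
Proof. by apply: continuous_measurable_fun; exact: continuous_cos. Qed.

Let measurable_sin : measurable_fun [set: measurableTypeR R] (@sin R).
Proof. by apply: continuous_measurable_fun; exact: continuous_sin. Qed.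

Lemma cos_lipschitz (x y : R) : `|cos x - cos y| <= `|x - y|.
Proof.
have -> : cos x - cos y = - 2 * sin ((x + y) / 2) * sin ((x - y) / 2).
  have E p q : cos (p + q) - cos (p - q) = - 2 * sin p * sin q :> R.
    by rewrite cosB cosD; ring.
  rewrite -E; congr (cos _ - cos _); by field.
rewrite !normrM normrN (ger0_norm (_ : 0 <= 2))//.
have := normr_sin_le ((x - y) / 2); have := sin_max ((x + y) / 2).
rewrite (normrM _ 2^-1) (ger0_norm (_ : 0 <= 2^-1))// => h1 h2.
apply: (@le_trans _ _ (2 * 1 * (`|x - y| / 2))); last by lra.
by apply: ler_pM => //; rewrite ?mulr_ge0//; apply: ler_wpM2l.
Qed.

Lemma sin_lipschitz (x y : R) : `|sin x - sin y| <= `|x - y|.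
Proof.
have := cos_lipschitz (pi / 2 - x) (pi / 2 - y).
rewrite !cosB !cos_pihalf !sin_pihalf !mul0r !mul1r !add0r.
have E (a : R) : a - x - (a - y) = - (x - y) by ring.
by rewrite E normrN.
Qed.

Lemma Q_cos h : \int[P]_w cos (Q h w) = expR (- (2^-1 * `|h| ^+ 2)).
Proof.
move: h; apply: (@continuous_eq_on_dense V R _ (fun h => \int[P]_w cos (Q h w))
  (fun h => expR (- (2^-1 * `|h| ^+ 2))) (@completion_dense _ _ V)).
- apply: Q_continuous; [exact: measurable_cos| |exact: cos_lipschitz].
  exact: cos_max.
- move=> h; have nh : `|k| @[k --> h] --> `|h| by exact: norm_continuous.
  have e : - (2^-1 * `|k| ^+ 2) @[k --> h] --> - (2^-1 * `|h| ^+ 2).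
    by apply: cvgN; apply: cvgM; [exact: cvg_cst|exact: (cvgM nh nh)].
  exact: cvg_comp e (@continuous_expR R _).
- move=> _ [s _ <-]; rewrite Q_completion_map; last exact: measurable_cos.
  by rewrite sqr_norm_completion_map; have /(congr1 (@complex.Re R)) /= -> := wn s.
Qed.

Lemma Q_sin h : \int[P]_w sin (Q h w) = 0.
Proof.
move: h; apply: (@continuous_eq_on_dense V R _ (fun h => \int[P]_w sin (Q h w))
  (fun=> 0) (@completion_dense _ _ V)).
- apply: Q_continuous; [exact: measurable_sin| |exact: sin_lipschitz].
  exact: sin_max.
- by move=> h; exact: cvg_cst.
- move=> _ [s _ <-]; rewrite Q_completion_map; last exact: measurable_sin.
  by have /(congr1 (@complex.Im R)) /= <- := wn s.
Qed.

Section Law.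
Variables (X : cylinderType R -> R) (h : V).
Hypothesis mX : measurable_fun setT X.
Hypothesis XQ : {ae P, forall w, X w = Q h w}.

(** [t X] is almost surely [Q (t h)], so the characteristic function of [X] at every [t] is covered
    by [Q_cos] and [Q_sin]. *)
Let ae_char (f : R -> R) t : measurable_fun [set: measurableTypeR R] f ->
  \int[P]_w f (t * X w) = \int[P]_w f (Q (t *: h) w).
Proof.
move=> mf; apply: ae_Rintegral.
- by apply: (measurableT_comp mf); exact: measurable_funM.
- by case: (sqintQ (t *: h)) => m _; exact: (measurableT_comp mf m).
- by apply: filterS2 XQ (Q_scale t h) => w -> ->.
Qed.

(** [X] stands for any measurable version of [Q h], because the limits in the theorem are determined
    only almost surely. *)
Lemma sqint_ae : sqint P X /\ \int[P]_w (X w ^+ 2) = `|h| ^+ 2.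
Proof.
have [mQ iQ] := sqintQ h.
have mX2 : measurable_fun setT (fun w => X w ^+ 2) by exact: measurable_funX.
split; last first.
  rewrite -Rintegral_sqrQ; apply: ae_Rintegral => //; first exact: measurable_funX.
  by apply: filterS XQ => w ->.
split=> //; apply/integrableP; split; first exact/measurable_EFinP.
case/integrableP: iQ => mQ2; apply: le_lt_trans; rewrite le_eqVlt; apply/orP; left.
apply/eqP; apply: ae_eq_integral => //.
- by apply: measurableT_comp => //; exact/measurable_EFinP.
- exact: measurableT_comp.
- by apply: filterS XQ => w /= -> _.
Qed.

Lemma gaussian_law : gaussian P X /\ \int[P]_w X w = 0.
Proof.
have [sX EX] := sqint_ae.
have C t : \int[P]_w cos (t * X w) = expR (- (t ^+ 2 * `|h| ^+ 2 / 2)).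
  rewrite ae_char; last exact: measurable_cos.
  rewrite Q_cos normrZ exprMn real_normK ?num_real//.
  by congr (expR (- _)); field.
have S t : \int[P]_w sin (t * X w) = 0.
  by rewrite ae_char ?Q_sin//; exact: measurable_sin.
split; last exact: mean_eq0_of_sin.
(* The deviation is [|h|]. If it is 0 then [X] vanishes almost surely and its law is the point mass
   at 0, the separate case of [gaussian]. *)
split=> //; exists 0, `|h|; have [h0|h0] := eqVneq `|h| 0; last exact: normal_law.
move=> A mA; rewrite h0 expr0n/= in EX.
have X0 := sqint0_ae sX EX.
have null (B : set (measurableTypeR R)) : measurable B -> ~ B (0 : R) -> P (X @^-1` B) = 0%E.
  move=> mB B0; apply: measure_negligible.
    by rewrite -[X in measurable X]setTI; exact: mX.
  by apply: negligibleS X0 => w /= Bw X0w; apply: B0; rewrite -X0w.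
rewrite diracE; have [/set_mem A0|/negP nA0] := boolP (0 \in A).
  have mXA : measurable (X @^-1` ~` A).
    by rewrite -[X in measurable X]setTI; apply: mX => //; exact: measurableC.
  have := probability_setC P mXA; rewrite null//; last exact: measurableC.
  by rewrite sube0 preimage_setC setCK.
by rewrite null// => A0; apply: nA0; exact/mem_set.
Qed.

End Law.

End Isonormal.

(** * Fractional Brownian motion as the image of a curve in the Hilbert space *)

Section IsonormalFBM.
Context {R : realType} (H : R) (sigma : {measure set R -> \bar R}).
Variables (P : probability (cylinderType R) R) (V : completion sigma).
Variable Q : V -> cylinderType R -> R.
Variable g : nat -> V.
Hypothesis H01 : 0 < H < 1.
Hypothesis wn : is_white_noise_measure sigma P.
Hypothesis ext : is_isometric_extension P Q.
Hypothesis ong : forall m n, hdot V (g m) (g n) = (m == n)%:R.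
Implicit Types (s t : R).

Let cosv t := series (interleave g (coef_cos H t) (fun=> 0)).
Let sinv t := series (interleave g (fun=> 0) (coef_sin H t)).
Let kcos t : V := limn (cosv t).
Let ksin t : V := limn (sinv t).
Let k t : V := kcos t + ksin t.

Let cvg_cosv t : cosv t @ \oo --> kcos t.
Proof.
apply: cvg_orthogonal_series; first exact: orthogonal_interleave.
apply/cvg_ex; exists (\int[lebesgue_measure]_u (fbm_cos H t u ^+ 2)).
apply: cvg_trans (hermite_parseval (sqint_fbm_cos t H01)).
apply: near_eq_cvg; apply: nearW => N; apply: eq_bigr => n _.
by rewrite sqr_norm_interleave// expr0n addr0 coef_cosE.
Qed.

Let cvg_sinv t : sinv t @ \oo --> ksin t.
Proof.
apply: cvg_orthogonal_series; first exact: orthogonal_interleave.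
apply/cvg_ex; exists (\int[lebesgue_measure]_u (fbm_sin H t u ^+ 2)).
apply: cvg_trans (hermite_parseval (sqint_fbm_sin t H01)).
apply: near_eq_cvg; apply: nearW => N; apply: eq_bigr => n _.
by rewrite sqr_norm_interleave// expr0n add0r coef_sinE.
Qed.

(** [k t - k s] is the sum of the interleaved series of coefficient differences, whose terms are
    orthogonal; its squared norm is the limit computed by [fbm_energy_cvg]. *)
Let sqr_norm_kB t s : `|k t - k s| ^+ 2 = 2 * (V_const H / pi) * `|t - s| `^ (2 * H).
Proof.
pose c n := coef_cos H t n - coef_cos H s n.
pose d n := coef_sin H t n - coef_sin H s n.
apply: (sqr_norm_orthogonal_limit (x := interleave g c d)).
- exact: orthogonal_interleave.
- have h : (cosv t N + sinv t N) - (cosv s N + sinv s N) @[N --> \oo] --> k t - k s.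
    by apply: cvgB; apply: cvgD.
  apply: cvg_trans h; apply: near_eq_cvg; apply: nearW => N.
  rewrite /cosv /sinv /series/= -!big_split/= -sumrB; apply: eq_bigr => n _.
  rewrite /interleave /c /d !scale0r addr0 add0r addr0 add0r !scalerBl.
  by rewrite opprD addrACA.
- apply: cvg_trans (@fbm_energy_cvg _ H t s H01).
  apply: near_eq_cvg; apply: nearW => N.
  rewrite -big_split/=; apply: eq_bigr => n _.
  by rewrite sqr_norm_interleave.
Qed.

Let k0 : k 0 = 0.
Proof.
have z : (fun=> 0 : V) @ \oo --> (0 : V) by exact: cvg_cst.
have c0 n : coef_cos H 0 n = 0.
  rewrite /coef_cos; transitivity (\int[lebesgue_measure]_(u in setT) (cst 0 u : R)).
    by apply: eq_Rintegral => u _; rewrite mul0r cos0 subrr !mul0r.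
  by rewrite /Rintegral integral0.
have s0 n : coef_sin H 0 n = 0.
  rewrite /coef_sin; transitivity (\int[lebesgue_measure]_(u in setT) (cst 0 u : R)).
    by apply: eq_Rintegral => u _; rewrite mul0r sin0 !mul0r.
  by rewrite /Rintegral integral0.
have -> : k 0 = 0 + 0; last by rewrite addr0.
congr (_ + _); apply: (cvg_lim (@norm_hausdorff _ V)); apply: cvg_trans z;
  apply: near_eq_cvg; apply: nearW => N; rewrite ?/cosv ?/sinv /series/= big1// => n _.
- by rewrite /interleave c0 !scale0r addr0.
- by rewrite /interleave s0 !scale0r addr0.
Qed.

Let sqr_norm_k t : `|k t| ^+ 2 = 2 * (V_const H / pi) * `|t| `^ (2 * H).
Proof. by have := sqr_norm_kB t 0; rewrite k0 !subr0. Qed.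

Lemma cvg_partial_sums (c : nat -> R) (e : nat -> V) (l : V) :
  series (fun n => c n *: e n) @ \oo --> l ->
  cvg_L2 P (partial_sums c (fun n => Q (e n))) (Q l).
Proof.
move=> h; apply: (cvg_L2_Q ext _ _ h) => N.
  by apply: sqint_sum => n; apply: sqintZ; exact: (sqintQ ext).
exact: (Q_sum ext).
Qed.

Let S1 t := partial_sums (coef_cos H t) (fun n => Q (g (2 * n)%N)).
Let S3 t := partial_sums (coef_sin H t) (fun n => Q (g (2 * n).+1)).

Lemma cvg_S1 t : cvg_L2 P (S1 t) (Q (kcos t)).
Proof.
apply: (@cvg_partial_sums _ (fun n => g (2 * n)%N)).
apply: cvg_trans (@cvg_cosv t).
apply: near_eq_cvg; apply: nearW => N; apply: eq_bigr => n _.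
by rewrite /interleave scale0r addr0.
Qed.

Lemma cvg_S3 t : cvg_L2 P (S3 t) (Q (ksin t)).
Proof.
apply: (@cvg_partial_sums _ (fun n => g (2 * n).+1)).
apply: cvg_trans (@cvg_sinv t).
apply: near_eq_cvg; apply: nearW => N; apply: eq_bigr => n _.
by rewrite /interleave scale0r add0r.
Qed.

Variables B1 B3 : R -> cylinderType R -> R.
Hypothesis B1E : forall t, cvg_L2 P (S1 t) (B1 t).
Hypothesis B3E : forall t, cvg_L2 P (S3 t) (B3 t).

Let X t w := B1 t w + B3 t w.

(** Each of [B1 t], [B3 t] and the image of the corresponding vector are limits in mean square of
    the same partial sums. *)
Let XQ t : {ae P, forall w, X t w = Q (k t) w}.
Proof.
have h1 := cvg_L2_unique (B1E t) (cvg_S1 t).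
have h3 := cvg_L2_unique (B3E t) (cvg_S3 t).
have h := Q_linear ext 1 (kcos t) (ksin t).
apply: filterS2 (filterI h1 h3) h => w [e1 e3].
by rewrite /X e1 e3 scale1r mul1r => <-.
Qed.

Let mX t : measurable_fun setT (X t).
Proof.
have [_ [m1 _] _] := (cvg_L2P _ _ _).1 (B1E t).
have [_ [m3 _] _] := (cvg_L2P _ _ _).1 (B3E t).
exact: measurable_funD.
Qed.

Let XQ_sum n (i : 'I_n -> R) (a : 'I_n -> R) (r : seq 'I_n) :
  {ae P, forall w, \sum_(j <- r) a j * X (i j) w =
     Q (\sum_(j <- r) a j *: k (i j)) w}.
Proof.
elim: r => [|j r IH]; first by apply: filterS (Q0 ext) => w; rewrite !big_nil => ->.
have h := Q_linear ext (a j) (k (i j)) (\sum_(l <- r) a l *: k (i l)).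
apply: filterS2 (filterI IH (XQ (i j))) h => w [e1 e2].
by rewrite !big_cons e1 e2 => <-.
Qed.

(** A linear combination of values of [X] is a version of [Q] at the same combination of the vectors
    [k], hence Gaussian. *)
Lemma fbm_gaussian : centered_gaussian_process P X.
Proof.
split=> [n i a|t].
  apply: (gaussian_law wn ext _ (XQ_sum i a _)).1.
  by apply: measurable_sum => j; exact: measurable_funM.
have sX := (sqint_ae ext (mX t) (XQ t)).1.
have [_ E] := gaussian_law wn ext (mX t) (XQ t).
have iX := sqint_integrable sX.
rewrite unlock -[LHS]fineK; last exact: (integrable_fin_num _ iX).
by rewrite [X in X%:E]E.
Qed.

Lemma fbm_covariance t s : fine ('E_P[fun w => (X t w * X s w)%R])%E =
  V_const H / pi * (`|t| `^ (2 * H) + `|s| `^ (2 * H) - `|t - s| `^ (2 * H)).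
Proof.
have [st Et] := sqint_ae ext (mX t) (XQ t).
have [ss Es] := sqint_ae ext (mX s) (XQ s).
have hB : {ae P, forall w, X t w - X s w = Q (k t - k s) w}.
  by apply: filterS2 (filterI (XQ t) (XQ s)) (Q_sub ext (k t) (k s)) => w [-> ->] ->.
have [sB EB] := sqint_ae ext (measurable_funB (mX t) (mX s)) hB.
have [[_ it] [_ iS] [_ iB]] := And3 st ss sB.
(* The three second moments on the right are squared norms of [k t], [k s] and [k t - k s]; the
   halves cancel the factor 2 in these norms. *)
have E : \int[P]_w (X t w * X s w) = 2^-1 * \int[P]_w (X t w ^+ 2)
    + 2^-1 * \int[P]_w (X s w ^+ 2) - 2^-1 * \int[P]_w ((X t w - X s w) ^+ 2).
  have [jt js] := (RintegrableZl measurableT 2^-1 it, RintegrableZl measurableT 2^-1 iS).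
  have jB := RintegrableZl measurableT 2^-1 iB.
  have jD := RintegrableD measurableT jt js.
  rewrite -!RintegralZl// -(RintegralD measurableT jt js) -(RintegralB measurableT jD jB).
  apply: eq_Rintegral => w _ /=; by move: (X t w) (X s w) => x y; field.
rewrite unlock [LHS]E Et Es EB !sqr_norm_k sqr_norm_kB.
by move: (V_const H / pi) (`|t| `^ _) (`|s| `^ _) (`|t - s| `^ _) => C a b c; field.
Qed.

End IsonormalFBM.

(** * The two real coordinates of the hyperbolic process *)

Section HyperbolicCoordinates.
Context {R : realType}.
Implicit Types (p q : hyp R) (a b : R).

(** The coordinates are multiplicative and additive, so the covariance and the kernel decouple into
    two copies of the real statement. *)
Lemma hl1M p q : hl1 (p * q) = hl1 p * hl1 q.
Proof. by case: p q => [? ?] [? ?]; rewrite /hl1/=; ring. Qed.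

Lemma hl2M p q : hl2 (p * q) = hl2 p * hl2 q.
Proof. by case: p q => [? ?] [? ?]; rewrite /hl2/=; ring. Qed.

Lemma hl1B p q : hl1 (p - q) = hl1 p - hl1 q.
Proof. by case: p q => [? ?] [? ?]; rewrite /hl1/=; ring. Qed.

Lemma hl2B p q : hl2 (p - q) = hl2 p - hl2 q.
Proof. by case: p q => [? ?] [? ?]; rewrite /hl2/=; ring. Qed.

Lemma K_kernelE (H : R) p q : K_kernel H p q =
  (V_const H / pi * (`|hl1 p| `^ (2 * H) + `|hl1 q| `^ (2 * H)
                     - `|hl1 p - hl1 q| `^ (2 * H))) *: hep R +
  (V_const H / pi * (`|hl2 p| `^ (2 * H) + `|hl2 q| `^ (2 * H)
                     - `|hl2 p - hl2 q| `^ (2 * H))) *: hem R.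
Proof.
rewrite /K_kernel /habspow hl1B hl2B.
move: (V_const H / pi) (`|hl1 p| `^ _) (`|hl1 q| `^ _) (`|hl1 p - hl1 q| `^ _)
  (`|hl2 p| `^ _) (`|hl2 q| `^ _) (`|hl2 p - hl2 q| `^ _) => c x1 y1 z1 x2 y2 z2.
by congr Hyp => /=; ring.
Qed.

End HyperbolicCoordinates.

Theorem theorem9p2 (R : realType) (H : R) (H01 : 0 < H < 1)
    (sigma mu : {measure set R -> \bar R})
    (sigma_adm : admissible sigma) (mu_adm : admissible mu)
    (P1 P2 : probability (cylinderType R) R)
    (P1_sigma : is_white_noise_measure sigma P1)
    (P2_mu : is_white_noise_measure mu P2)
    (Hsigma : completion sigma) (Hmu : completion mu)
    (Hsigma_sep : separable Hsigma) (Hmu_sep : separable Hmu)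
    (Hsigma_inf : infinite_dim Hsigma) (Hmu_inf : infinite_dim Hmu)
    (Qsigma : Hsigma -> cylinderType R -> R)
    (Qmu : Hmu -> cylinderType R -> R)
    (Qsigma_ext : is_isometric_extension P1 Qsigma)
    (Qmu_ext : is_isometric_extension P2 Qmu)
    (g : nat -> Hsigma) (h : nat -> Hmu)
    (g_basis : orthonormal_basis g) (h_basis : orthonormal_basis h) :
  let Z n := Qsigma (g n) in
  let W n := Qmu (h n) in
  let S1 t := partial_sums (coef_cos H t) (fun n => Z (2 * n)%N) in
  let S3 t := partial_sums (coef_sin H t) (fun n => Z (2 * n).+1) in
  let S2 t := partial_sums (coef_cos H t) (fun n => W (2 * n)%N) in
  let S4 t := partial_sums (coef_sin H t) (fun n => W (2 * n).+1) in
  [/\ forall t : R, [/\ exists B, cvg_L2 P1 (S1 t) B, exists B, cvg_L2 P1 (S3 t) B,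
        exists B, cvg_L2 P2 (S2 t) B & exists B, cvg_L2 P2 (S4 t) B],
      V_integral H =
        (if H == 2^-1 then pi / 2
         else Gamma (2 - 2 * H) * cos (H * pi) / ((1 - 2 * H) * (2 * H)))%:E
    & forall B1 B2 B3 B4 : R -> cylinderType R -> R,
      (forall t, cvg_L2 P1 (S1 t) (B1 t)) -> (forall t, cvg_L2 P1 (S3 t) (B3 t)) ->
      (forall t, cvg_L2 P2 (S2 t) (B2 t)) -> (forall t, cvg_L2 P2 (S4 t) (B4 t)) ->
      hyp_centered_gaussian_process P1 P2 (hyp_fbm B1 B2 B3 B4) /\
      forall p q : hyp R,
        hyp_expectation P1 P2
          (fun w => hyp_fbm B1 B2 B3 B4 p w * hyp_fbm B1 B2 B3 B4 q w)
        = K_kernel H p q].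

Proof.
have [g_on _] := g_basis; have [h_on _] := h_basis.
move=> Z W S1 S3 S2 S4; split.
- move=> t; split.
  (* The limit is the image under [Qsigma] of the sum of the series in the Hilbert space. *)
  + by eexists; exact: (cvg_S1 H01 Qsigma_ext g_on t).
  + by eexists; exact: (cvg_S3 H01 Qsigma_ext g_on t).
  + by eexists; exact: (cvg_S1 H01 Qmu_ext h_on t).
  + by eexists; exact: (cvg_S3 H01 Qmu_ext h_on t).
- exact: V_integralE.
move=> B1 B2 B3 B4 B1E B3E B2E B4E; split.
  have [G1 E1] := fbm_gaussian H01 P1_sigma Qsigma_ext g_on B1E B3E.
  have [G2 E2] := fbm_gaussian H01 P2_mu Qmu_ext h_on B2E B4E.
  rewrite /hyp_centered_gaussian_process.
  have -> : (fun p w => hl1 (hyp_fbm B1 B2 B3 B4 p w)) =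
      (fun p w => B1 (hl1 p) w + B3 (hl1 p) w).
    by apply/funext => p; apply/funext => w; rewrite hl1E.
  have -> : (fun p w => hl2 (hyp_fbm B1 B2 B3 B4 p w)) =
      (fun p w => B2 (hl2 p) w + B4 (hl2 p) w).
    by apply/funext => p; apply/funext => w; rewrite hl2E.
  (* Finite families are arbitrary functions into the index set, so points [p] sharing a coordinate
     merely repeat a time of the real process. *)
  split; split=> [n i a|p]; [exact: G1|exact: E1|exact: G2|exact: E2].
move=> p q; rewrite K_kernelE /hyp_expectation.
congr (_ *: _ + _ *: _).
- rewrite -(fbm_covariance H01 Qsigma_ext g_on B1E B3E).
  by congr (fine (expectation P1 _)); apply/funext => w; rewrite hl1M !hl1E.
- rewrite -(fbm_covariance H01 Qmu_ext h_on B2E B4E).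
  by congr (fine (expectation P2 _)); apply/funext => w; rewrite hl2M !hl2E.
Qed.
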